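(* Let $\kappa$ be a successor cardinal and let $\mu,\lambda$ be inaccessible cardinals with $\kappa<\mu<\lambda$. If the stationary tower $\mathcal{I}^\kappa_\mu$ is presaturated, then the stationary tower $\mathcal{I}^\kappa_\lambda$ factors at $\mu$.
   Context: For a regular cardinal $\kappa$ and ordinal $\alpha\ge\kappa$, $NS_{\kappa,\alpha}$ is the non-stationary ideal on $\mathcal{P}_\kappa(V_\alpha)$. For inaccessible $\delta>\kappa$, $\mathcal{I}^\kappa_\delta=\langle NS_{\kappa,\alpha}\mid\alpha\in[\kappa,\delta)\rangle$ and its forcing $\mathbb{Q}^\kappa_\delta$ consists of stationary $X\subseteq\mathcal{P}_\kappa(V_\alpha)$, $\alpha\in[\kappa,\delta)$, ordered by $X\le Y$ iff $\{x\in\mathcal{P}_\kappa(V_\gamma)\mid x\cap\bigcup X\in X,\ x\cap\bigcup Y\notin Y\}$ is non-stationary for some $\gamma<\delta$ with $\bigcup X\cup\bigcup Y\subseteq V_\gamma$. Note $\mathbb{Q}^\kappa_\mu\subseteq\mathbb{Q}^\kappa_\lambda$. $\mathcal{I}^\kappa_\delta$ is presaturated if $\Vdash_{\mathbb{Q}^\kappa_\delta}$ ''$\delta$ is regular''. $\mathcal{I}^\kappa_\lambda$ factors at $\mu$ if for every $X\in\mathbb{Q}^\kappa_\mu$ there is $Y\le X$ in $\mathbb{Q}^\kappa_\lambda$ such that $Y\Vdash_{\mathbb{Q}^\kappa_\lambda}$ ''$\dot G\cap\mathbb{Q}^\kappa_\mu$ is $\mathbb{Q}^\kappa_\mu$-generic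 over $V$'', where $\dot G$ is the canonical name for the generic filter. *)

(* Defs.v *)
From Stdlib Require Import ClassicalEpsilon.

Set Implicit Arguments.
Unset Strict Implicit.

(** A [zfc] is any universe of sets satisfying ZFC, Replacement (hence Separation)
    being available for every relation definable in the metatheory. *)

Record zfc : Type := {
  set :> Type;
  mem : set -> set -> Prop;
  extensionality : forall x y, (forall z, mem z x <-> mem z y) -> x = y;
  foundation : well_founded mem;
  pairing : forall a b, exists c, forall z, mem z c <-> z = a \/ z = b;
  union_ax : forall a, exists u, forall z, mem z u <-> exists y, mem y a /\ mem z y;
  powerset_ax : forall a, exists p, forall z,
    mem z p <-> (forall t, mem t z -> mem t a);
  infinity : exists w,
    (exists e, mem e w /\ forall z, ~ mem z e) /\
    (forall x, mem x w ->
       exists s, mem s w /\ forall z, mem z s <-> mem z x \/ z = x);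
  replacement : forall (R : set -> set -> Prop) a,
    (forall x y y', mem x a -> R x y -> R x y' -> y = y') ->
    exists b, forall y, mem y b <-> exists x, mem x a /\ R x y;
  choice : forall a,
    (forall x, mem x a -> exists z, mem z x) ->
    (forall x y z, mem x a -> mem y a -> mem z x -> mem z y -> x = y) ->
    exists c, forall x, mem x a ->
      exists z, (mem z x /\ mem z c) /\
                forall z', mem z' x -> mem z' c -> z' = z
}.

Declare Scope zfc_scope.
Open Scope zfc_scope.

Notation "x ∈ y" := (mem x y) (at level 70) : zfc_scope.
Notation "x ∉ y" := (~ mem x y) (at level 70) : zfc_scope.

Definition subset {V : zfc} (x y : V) : Prop := forall z, z ∈ x -> z ∈ y.
Notation "x ⊆ y" := (subset x y) (at level 70) : zfc_scope.

Definition el {V : zfc} (D : V) : Type := { x : V | x ∈ D }.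

Lemma zfc_inhabited (V : zfc) : inhabited V.
Proof. destruct (infinity V) as [w _]; exact (inhabits w). Qed.

(** The set with extension [F], unspecified when [F] is a proper class. *)
Definition setof {V : zfc} (F : V -> Prop) : V :=
  epsilon (zfc_inhabited V) (fun s => forall x, x ∈ s <-> F x).

Notation "⦃ x | F ⦄" := (setof (fun x => F)) (at level 0, x binder) : zfc_scope.

Definition bigcup {V : zfc} (X : V) : V := ⦃ z | exists y, y ∈ X /\ z ∈ y ⦄.
Definition cap {V : zfc} (x y : V) : V := ⦃ z | z ∈ x /\ z ∈ y ⦄.
Definition power {V : zfc} (x : V) : V := ⦃ y | y ⊆ x ⦄.

(** Formulas of the language of set theory with parameters from [D] and an
    additional unary predicate [Ground] for the ground model.  Quantifiers are
    in higher-order abstract syntax.  The same formulas are interpreted in [V]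
    (by [sat]) and in the forcing extensions of [V] (by [forces]). *)

Inductive fml (D : Type) : Type :=
| Mem : D -> D -> fml D
| Eq : D -> D -> fml D
| Ground : D -> fml D
| Not : fml D -> fml D
| And : fml D -> fml D -> fml D
| Or : fml D -> fml D -> fml D
| Imp : fml D -> fml D -> fml D
| All : (D -> fml D) -> fml D
| Ex : (D -> fml D) -> fml D.

Declare Scope fml_scope.
Delimit Scope fml_scope with fml.
Bind Scope fml_scope with fml.

Notation "x '∈' y" := (Mem x y) (at level 70) : fml_scope.
Notation "x '≐' y" := (Eq x y) (at level 70) : fml_scope.
Notation "'¬' f" := (Not f) (at level 75, right associativity) : fml_scope.
Notation "f '∧' g" := (And f g) (at level 80, right associativity) : fml_scope.
Notation "f '∨' g" := (Or f g) (at level 85, right associativity) : fml_scope.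
Notation "f '⇒' g" := (Imp f g) (at level 90, right associativity) : fml_scope.
Notation "'∀' x , f" := (All (fun x => f))
  (at level 95, x name, f at level 95) : fml_scope.
Notation "'∃' x , f" := (Ex (fun x => f))
  (at level 95, x name, f at level 95) : fml_scope.
Notation "'∀' x '∈' a , f" := (All (fun x => Imp (Mem x a) f))
  (at level 95, x name, a at level 69, f at level 95) : fml_scope.
Notation "'∃' x '∈' a , f" := (Ex (fun x => And (Mem x a) f))
  (at level 95, x name, a at level 69, f at level 95) : fml_scope.

Section Formulas.
Local Open Scope fml_scope.

Definition Iff D (f g : fml D) : fml D := (f ⇒ g) ∧ (g ⇒ f).
Definition Sub D (x y : D) : fml D := ∀ z ∈ x, z ∈ y.
Definition IsUPair D (a b c : D) : fml D := ∀ z, Iff (z ∈ c) (z ≐ a ∨ z ≐ b).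
(* Kuratowski pair: c = {{a}, {a, b}} *)
Definition IsPair D (a b c : D) : fml D :=
  ∃ u, ∃ v, (IsUPair a a u ∧ IsUPair a b v ∧ IsUPair u v c).
Definition PairIn D (a b r : D) : fml D := ∃ c ∈ r, IsPair a b c.

Definition IsFun D (f a b : D) : fml D :=
  (∀ c ∈ f, ∃ x ∈ a, ∃ y ∈ b, IsPair x y c) ∧
  (∀ x ∈ a, ∃ y ∈ b, (PairIn x y f ∧ (∀ y' ∈ b, (PairIn x y' f ⇒ y' ≐ y)))).
Definition IsBij D (f a b : D) : fml D :=
  IsFun f a b ∧
  (∀ y ∈ b, ∃ x ∈ a, (PairIn x y f ∧ (∀ x' ∈ a, (PairIn x' y f ⇒ x' ≐ x)))).
Definition Equinumerous D (a b : D) : fml D := ∃ f, IsBij f a b.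

Definition IsTransitive D (x : D) : fml D := ∀ y ∈ x, Sub y x.
Definition IsOrdinal D (x : D) : fml D :=
  IsTransitive x ∧ (∀ y ∈ x, IsTransitive y).
Definition IsLimit D (x : D) : fml D :=
  IsOrdinal x ∧ (∃ y, y ∈ x) ∧ (∀ y ∈ x, ∃ z ∈ x, y ∈ z).
Definition IsCardinal D (x : D) : fml D :=
  IsOrdinal x ∧ (∀ y ∈ x, ¬ Equinumerous y x).
Definition IsCofinalFun D (f a b : D) : fml D :=
  IsFun f a b ∧
  (∀ y ∈ b, ∃ x ∈ a, ∃ z ∈ b, (PairIn x z f ∧ (y ∈ z ∨ y ≐ z))).
Definition IsRegular D (x : D) : fml D :=
  IsLimit x ∧ (∀ y ∈ x, ∀ f, ¬ IsCofinalFun f y x).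

(* [P] is the underlying set of a poset, [R] its order, a set of pairs. *)
Definition IsFilter D (P R F : D) : fml D :=
  Sub F P ∧ (∃ p, p ∈ F) ∧
  (∀ p ∈ F, ∀ q ∈ P, (PairIn p q R ⇒ q ∈ F)) ∧
  (∀ p ∈ F, ∀ q ∈ F, ∃ r ∈ F, (PairIn r p R ∧ PairIn r q R)).
Definition IsDense D (P R E : D) : fml D :=
  Sub E P ∧ (∀ p ∈ P, ∃ q ∈ E, PairIn q p R).
Definition IsGenericOverV D (P R F : D) : fml D :=
  IsFilter P R F ∧
  (∀ E, (Ground E ⇒ IsDense P R E ⇒ ∃ p ∈ F, p ∈ E)).
Definition IsCap D (a b c : D) : fml D := ∀ z, Iff (z ∈ c) (z ∈ a ∧ z ∈ b).
End Formulas.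

Fixpoint sat {V : zfc} (f : fml V) : Prop :=
  match f with
  | Mem x y => x ∈ y
  | Eq x y => x = y
  | Ground _ => True
  | Not f => ~ sat f
  | And f g => sat f /\ sat g
  | Or f g => sat f \/ sat g
  | Imp f g => sat f -> sat g
  | All f => forall x, sat (f x)
  | Ex f => exists x, sat (f x)
  end.

Definition ordinal {V : zfc} (x : V) : Prop := sat (IsOrdinal x).
Definition cardinal {V : zfc} (x : V) : Prop := sat (IsCardinal x).
Definition limit {V : zfc} (x : V) : Prop := sat (IsLimit x).
Definition regular {V : zfc} (x : V) : Prop := sat (IsRegular x).
Definition equinumerous {V : zfc} (x y : V) : Prop := sat (Equinumerous x y).

Definition card_lt {V : zfc} (x κ : V) : Prop :=
  exists β, β ∈ κ /\ equinumerous x β.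

(* A cardinal is infinite iff it is a limit ordinal. *)
Definition infinite_cardinal {V : zfc} (x : V) : Prop := cardinal x /\ limit x.

Definition successor_cardinal {V : zfc} (κ : V) : Prop :=
  cardinal κ /\
  exists ν, infinite_cardinal ν /\ ν ∈ κ /\
            forall β, cardinal β -> β ∈ κ -> β ∈ ν \/ β = ν.

Definition inaccessible {V : zfc} (δ : V) : Prop :=
  regular δ /\
  (exists ω, ω ∈ δ /\ limit ω) /\
  (forall α, α ∈ δ -> card_lt (power α) δ).

Inductive in_stage {V : zfc} : V -> V -> Prop :=
| in_stage_intro (α β x : V) :
    β ∈ α -> (forall y, y ∈ x -> in_stage β y) -> in_stage α x.

(* V_α = ⋃_{β ∈ α} P(V_β) *)
Definition stage {V : zfc} (α : V) : V := ⦃ x | in_stage α x ⦄.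

Definition Pk {V : zfc} (κ A : V) : V := ⦃ x | x ⊆ A /\ card_lt x κ ⦄.

Definition unbounded {V : zfc} (κ A C : V) : Prop :=
  forall x, x ∈ Pk κ A -> exists y, y ∈ C /\ x ⊆ y.

(* Closure under unions of ⊆-increasing sequences of length in (0, κ). *)
Definition chain_closed {V : zfc} (κ C : V) : Prop :=
  forall (ξ : V) (s : V -> V),
    ξ ∈ κ -> (exists i, i ∈ ξ) ->
    (forall i, i ∈ ξ -> s i ∈ C) ->
    (forall i j, j ∈ ξ -> i ∈ j -> s i ⊆ s j) ->
    ⦃ z | exists i, i ∈ ξ /\ z ∈ s i ⦄ ∈ C.

Definition club {V : zfc} (κ A C : V) : Prop :=
  C ⊆ Pk κ A /\ unbounded κ A C /\ chain_closed κ C.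

Definition stationary {V : zfc} (κ A X : V) : Prop :=
  X ⊆ Pk κ A /\ forall C, club κ A C -> exists x, x ∈ X /\ x ∈ C.

Definition NS {V : zfc} (κ α : V) : V :=
  ⦃ X | X ⊆ Pk κ (stage α) /\ ~ stationary κ (stage α) X ⦄.

Definition tower {V : zfc} (κ δ : V) : V :=
  ⦃ X | exists α, α ∈ δ /\ κ ⊆ α /\ X ⊆ Pk κ (stage α) /\ X ∉ NS κ α ⦄.

Definition tower_le {V : zfc} (κ δ X Y : V) : Prop :=
  exists γ, γ ∈ δ /\ bigcup X ⊆ stage γ /\ bigcup Y ⊆ stage γ /\
    ⦃ x | x ∈ Pk κ (stage γ) /\ cap x (bigcup X) ∈ X /\ cap x (bigcup Y) ∉ Y ⦄
      ∈ NS κ γ.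

Definition tower_order {V : zfc} (κ δ : V) : V :=
  ⦃ c | exists X Y, X ∈ tower κ δ /\ Y ∈ tower κ δ /\
                    tower_le κ δ X Y /\ sat (IsPair X Y c) ⦄.

(* [Name D σ A] is the name {(σ i, p) | i ∈ D, A i p}; for forcing with a
   poset P only the p ∈ P count.  As D and P are sets and Replacement holds for
   arbitrary functions, these are exactly the P-names of [V]. *)
Inductive name (V : zfc) : Type :=
| Name (D : V) (σ : el D -> name V) (A : el D -> V -> Prop).

Arguments Name {V} D σ A.

Definition check {V : zfc} : V -> name V :=
  Fix (@foundation V) (fun _ => name V)
    (fun x rec => Name x (fun i => rec (proj1_sig i) (proj2_sig i))
                         (fun _ _ => True)).

(* The canonical name {(p̌, p) | p ∈ P} for the generic filter. *)
Definition generic_name {V : zfc} (P : V) : name V :=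
  Name P (fun i => check (proj1_sig i)) (fun i p => p = proj1_sig i).

Definition densely {V : zfc} (P : V) (le : V -> V -> Prop) (p : V)
    (F : V -> Prop) : Prop :=
  forall q, q ∈ P -> le q p -> exists r, r ∈ P /\ le r q /\ F r.

(* p ⊩ τ = τ' iff for all (σ, a) ∈ τ, every q ≤ p, a forces σ ∈ τ', and
   symmetrically. *)
Fixpoint forces_eq {V : zfc} (P : V) (le : V -> V -> Prop)
    (τ τ' : name V) (p : V) {struct τ} : Prop :=
  match τ, τ' with
  | Name D σ A, Name D' σ' A' =>
    (forall (i : el D) a q, a ∈ P -> A i a -> q ∈ P -> le q p -> le q a ->
       densely P le q (fun r =>
         exists (j : el D') b, b ∈ P /\ A' j b /\ le r b /\
                               forces_eq P le (σ i) (σ' j) r)) /\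
    (forall (j : el D') b q, b ∈ P -> A' j b -> q ∈ P -> le q p -> le q b ->
       densely P le q (fun r =>
         exists (i : el D) a, a ∈ P /\ A i a /\ le r a /\
                              forces_eq P le (σ i) (σ' j) r))
  end.

Definition forces_mem {V : zfc} (P : V) (le : V -> V -> Prop)
    (σ τ : name V) (p : V) : Prop :=
  match τ with
  | Name D' σ' A' =>
    densely P le p (fun r =>
      exists (j : el D') b, b ∈ P /\ A' j b /\ le r b /\
                            forces_eq P le σ (σ' j) r)
  end.

Fixpoint forces {V : zfc} (P : V) (le : V -> V -> Prop)
    (p : V) (f : fml (name V)) {struct f} : Prop :=
  match f with
  | Mem x y => forces_mem P le x y p
  | Eq x y => forces_eq P le x y p
  | Ground x => densely P le p (fun q => exists y, forces_eq P le x (check y) q)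
  | Not f => forall q, q ∈ P -> le q p -> ~ forces P le q f
  | And f g => forces P le p f /\ forces P le p g
  | Or f g => densely P le p (fun q => forces P le q f \/ forces P le q g)
  | Imp f g => forall q, q ∈ P -> le q p -> forces P le q f -> forces P le q g
  | All f => forall x, forces P le p (f x)
  | Ex f => densely P le p (fun q => exists x, forces P le q (f x))
  end.

Definition tower_forces {V : zfc} (κ δ : V) (p : V) (f : fml (name V)) : Prop :=
  forces (tower κ δ) (tower_le κ δ) p f.

Definition presaturated {V : zfc} (κ δ : V) : Prop :=
  forall p, p ∈ tower κ δ -> tower_forces κ δ p (IsRegular (check δ)).

Definition factors_at {V : zfc} (κ λ μ : V) : Prop :=
  forall X, X ∈ tower κ μ ->
  exists Y, Y ∈ tower κ λ /\ tower_le κ λ Y X /\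
    tower_forces κ λ Y
      (∃ H, (IsCap (generic_name (tower κ λ)) (check (tower κ μ)) H ∧
             IsGenericOverV (check (tower κ μ)) (check (tower_order κ μ)) H))%fml.

(* Main.v *)
Require Import Defs.
From Stdlib Require Import Classical ClassicalEpsilon FunctionalExtensionality Arith Lia List.
From Stdlib Require Cantor.

Set Implicit Arguments.
Unset Strict Implicit.

(** Given [X], let [Y] consist of the [x ∈ P_κ(V_{μ+1})] with [x ∩ ⋃X ∈ X] such that every
    dense [D ∈ x] of the tower of height [μ] has an element [d ∈ D ∩ x] with [x ∩ ⋃d ∈ d].
    If [Y] is stationary it is a condition below [X], and by Fodor's lemma it forces the
    generic filter to meet every dense set of the smaller tower.

    To see that [Y] meets the sets closed under a finitary operation [F], build in the
    extension hulls [N_0 ⊆ N_1 ⊆ ...] of size less than [μ], closed under [F], where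
    [N_{n+1}] contains the least [V_α] inside which the generic filter meets every dense
    set of [N_n].  As [μ] stays regular, these [α] exist and are bounded below [μ]
    together with the conditions deciding them.  Hence some condition [q] forces the
    whole construction to be decided inside a [V_η] with [η < μ], and a typical
    [x ∈ P_κ(V_η)] hit by [q] codes the trace of such an increasing union, which is a
    member of [Y] closed under [F]. *)

(** The index μ+1 comes from the dense sets: they are subsets of V_μ, hence elements of V_{μ+1}, and
    a point [x] must contain them as elements to be asked about them. This creates the main
    obstacle: [F] acts on V_{μ+1}, while conditions of the small tower and the clubs they respect
    live on stages V_η with η < μ. The way out is that all hulls decided by conditions of one V_ξ
    together have fewer than μ elements. They are coded by ordinals below η, and closure under [F]
    becomes closure under an operation on codes, which is a club condition on P_κ(V_η). No extension
    is formed. A hull is indexed by the finite list of ordinals that a condition decides, and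
    compatible conditions decide the same lists, so the hulls are objects of V. Presaturation is
    used twice, each time as a bound for fewer than μ dense families: for the dense sets inside one
    hull, which gives the next ordinal, and for the ω steps of the construction, which gives ξ. *)

Section Sets.
Context {V : zfc}.
Implicit Types x y z a b c α β γ δ : V.

(** * Elementary set formation *)

Lemma setof_spec (F : V -> Prop) :
  (exists s, forall x, x ∈ s <-> F x) -> forall x, x ∈ setof F <-> F x.
Proof. intros H. exact (epsilon_spec (zfc_inhabited V) _ H). Qed.

(** A class bounded by a set is a set: Replacement is applied to the partial identity on [F]. Most
    set-builder terms below are justified by naming a bound [a]. *)
Lemma in_setof a (F : V -> Prop) :
  (forall x, F x -> x ∈ a) -> forall x, x ∈ setof F <-> F x.
Proof.
  intros HF. apply setof_spec.
  destruct (@replacement V (fun x y => x = y /\ F x) a) as [b Hb].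
  - intros x y y' _ [<- _] [<- _]; reflexivity.
  - exists b. intros x. rewrite Hb. split.
    + intros [x' [_ [<- H]]]; exact H.
    + intros H; exists x; auto.
Qed.

Lemma in_sep a (F : V -> Prop) x : x ∈ ⦃ z | z ∈ a /\ F z ⦄ <-> x ∈ a /\ F x.
Proof. apply (@in_setof a). tauto. Qed.

Lemma in_image a (f : V -> V) y :
  y ∈ ⦃ y | exists x, x ∈ a /\ y = f x ⦄ <-> exists x, x ∈ a /\ y = f x.
Proof.
  apply setof_spec.
  destruct (@replacement V (fun x y => y = f x) a) as [b Hb].
  - intros; congruence.
  - exists b; exact Hb.
Qed.

Lemma set_ext a b : (forall z, z ∈ a <-> z ∈ b) -> a = b.
Proof. apply extensionality. Qed.

Lemma sub_antisym a b : a ⊆ b -> b ⊆ a -> a = b.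
Proof. intros H1 H2; apply set_ext; split; auto. Qed.

Lemma sub_refl a : a ⊆ a.
Proof. intros z; auto. Qed.

Lemma sub_trans a b c : a ⊆ b -> b ⊆ c -> a ⊆ c.
Proof. intros H1 H2 z Hz; auto. Qed.

Lemma in_bigcup a z : z ∈ bigcup a <-> exists y, y ∈ a /\ z ∈ y.
Proof. apply setof_spec, union_ax. Qed.

Lemma in_cap a b z : z ∈ cap a b <-> z ∈ a /\ z ∈ b.
Proof. apply (@in_setof a). tauto. Qed.

Lemma in_power a z : z ∈ power a <-> z ⊆ a.
Proof. apply (@setof_spec (fun y => y ⊆ a)). exact (powerset_ax a). Qed.

Lemma in_iunion (ξ : V) (s : V -> V) z :
  z ∈ ⦃ z | exists i, i ∈ ξ /\ z ∈ s i ⦄ <-> exists i, i ∈ ξ /\ z ∈ s i.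
Proof.
  apply (@in_setof (bigcup ⦃ y | exists i, i ∈ ξ /\ y = s i ⦄)).
  intros w [i [Hi Hw]]. apply in_bigcup. exists (s i). split; auto.
  apply in_image; eauto.
Qed.

Definition upair a b : V := ⦃ z | z = a \/ z = b ⦄.
Definition pair a b : V := upair (upair a a) (upair a b).
Definition cup a b : V := ⦃ z | z ∈ a \/ z ∈ b ⦄.
Definition succ a : V := ⦃ z | z ∈ a \/ z = a ⦄.
Definition empty : V := ⦃ z | False ⦄.

Lemma in_upair a b z : z ∈ upair a b <-> z = a \/ z = b.
Proof. apply setof_spec, pairing. Qed.

Lemma in_cup a b z : z ∈ cup a b <-> z ∈ a \/ z ∈ b.
Proof.
  apply (@in_setof (bigcup (upair a b))). intros w Hw. apply in_bigcup.
  destruct Hw as [Hw|Hw]; [exists a | exists b]; split; auto; apply in_upair; auto.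
Qed.

Lemma in_succ a z : z ∈ succ a <-> z ∈ a \/ z = a.
Proof.
  apply (@in_setof (cup a (upair a a))). intros w Hw.
  apply in_cup. rewrite in_upair. tauto.
Qed.

Lemma in_empty z : z ∈ empty <-> False.
Proof. destruct (zfc_inhabited V) as [a]. apply (@in_setof a). tauto. Qed.

Lemma pair_inj a b a' b' : pair a b = pair a' b' -> a = a' /\ b = b'.
Proof.
  intros H.
  assert (K : forall w, w ∈ pair a b <-> w ∈ pair a' b') by (rewrite H; tauto).
  assert (U : forall u v u' v', upair u v = upair u' v' ->
              (u = u' /\ v = v') \/ (u = v' /\ v = u')).
  { intros u v u' v' E.
    assert (W : forall w, w = u \/ w = v <-> w = u' \/ w = v')
      by (intros w; rewrite <- !in_upair, E; tauto).
    pose proof (proj1 (W u) (or_introl eq_refl)).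
    pose proof (proj1 (W v) (or_intror eq_refl)).
    pose proof (proj2 (W u') (or_introl eq_refl)).
    pose proof (proj2 (W v') (or_intror eq_refl)).
    intuition congruence. }
  destruct (U _ _ _ _ H) as [[E1 E2]|[E1 E2]];
    destruct (U _ _ _ _ E1) as [[? ?]|[? ?]];
    destruct (U _ _ _ _ E2) as [[? ?]|[? ?]]; subst; auto.
Qed.

Lemma sat_IsUPair a b c : sat (IsUPair a b c) <-> c = upair a b.
Proof.
  simpl. split.
  - intros H. apply set_ext; intros z. rewrite in_upair. apply H.
  - intros -> z. rewrite in_upair. tauto.
Qed.

Lemma sat_IsPair a b c : sat (IsPair a b c) <-> c = pair a b.
Proof.
  split.
  - intros [u [v [H1 [H2 H3]]]]. rewrite sat_IsUPair in *. subst. reflexivity.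
  - intros ->. exists (upair a a), (upair a b).
    split; [|split]; rewrite sat_IsUPair; reflexivity.
Qed.

Lemma sat_PairIn a b r : sat (PairIn a b r) <-> pair a b ∈ r.
Proof.
  split.
  - intros [c [H1 H2]]. apply sat_IsPair in H2. subst; exact H1.
  - intros H. exists (pair a b). split; [exact H|]. apply sat_IsPair; reflexivity.
Qed.

Lemma mem_irrefl a : a ∉ a.
Proof. induction a as [a IH] using (well_founded_ind (@foundation V)). intros H. exact (IH a H H). Qed.

Lemma mem_asym a b : a ∈ b -> b ∉ a.
Proof.
  revert b. induction a as [a IH] using (well_founded_ind (@foundation V)).
  intros b Hab Hba. exact (IH b Hba a Hba Hab).
Qed.

(** * Ordinals *)

Lemma ordinalP a :
  ordinal a <-> (forall x, x ∈ a -> x ⊆ a) /\ (forall x, x ∈ a -> forall y, y ∈ x -> y ⊆ x).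
Proof. reflexivity. Qed.

Lemma ord_trans a x : ordinal a -> x ∈ a -> x ⊆ a.
Proof. intros [H _]. apply H. Qed.

Lemma ord_mem a x : ordinal a -> x ∈ a -> ordinal x.
Proof.
  intros Ha Hx. pose proof (ord_trans Ha Hx) as Hs. destruct Ha as [H1 H2].
  split; [exact (H2 x Hx)|]. intros y Hy. apply H2, Hs, Hy.
Qed.

Lemma ord_mem_trans a b c : ordinal c -> a ∈ b -> b ∈ c -> a ∈ c.
Proof. intros Hc Ha Hb. exact (ord_trans Hc Hb Ha). Qed.

Lemma ord_trichotomy a b : ordinal a -> ordinal b -> a ∈ b \/ a = b \/ b ∈ a.
Proof.
  revert b. induction a as [a IHa] using (well_founded_ind (@foundation V)).
  intros b. induction b as [b IHb] using (well_founded_ind (@foundation V)).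
  intros Ha Hb. destruct (classic (a ∈ b)) as [|Nab]; [auto|].
  destruct (classic (b ∈ a)) as [|Nba]; [auto|]. right; left.
  apply sub_antisym; intros c Hc.
  - destruct (IHa c Hc b (ord_mem Ha Hc) Hb) as [H|[H|H]]; [exact H| |].
    + subst; contradiction.
    + exfalso; apply Nba. exact (ord_mem_trans Ha H Hc).
  - destruct (IHb c Hc Ha (ord_mem Hb Hc)) as [H|[H|H]]; [| |exact H].
    + exfalso; apply Nab. exact (ord_mem_trans Hb H Hc).
    + subst; contradiction.
Qed.

Lemma ord_sub_or_mem a b : ordinal a -> ordinal b -> a ⊆ b \/ b ∈ a.
Proof.
  intros Ha Hb. destruct (ord_trichotomy Ha Hb) as [H|[H|H]]; auto.
  - left. exact (ord_trans Hb H).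
  - left. subst; apply sub_refl.
Qed.

Lemma ord_sub_mem a b c : ordinal a -> ordinal c -> a ⊆ b -> b ∈ c -> a ∈ c.
Proof.
  intros Ha Hc Hab Hbc.
  destruct (ord_trichotomy Ha Hc) as [H|[H|H]]; [exact H| |].
  - subst. exfalso. exact (mem_irrefl (Hab b Hbc)).
  - exfalso. apply Hab in H. exact (mem_asym Hbc H).
Qed.

Lemma ord_max a b : ordinal a -> ordinal b ->
  exists c, (c = a \/ c = b) /\ a ⊆ c /\ b ⊆ c.
Proof.
  intros Ha Hb. destruct (ord_sub_or_mem Ha Hb) as [H|H].
  - exists b; auto using sub_refl.
  - exists a; split; [|split]; auto using sub_refl. exact (ord_trans Ha H).
Qed.

Lemma ord_max_in δ a b : ordinal δ -> a ∈ δ -> b ∈ δ ->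
  exists c, c ∈ δ /\ a ⊆ c /\ b ⊆ c.
Proof.
  intros Hδ Ha Hb.
  destruct (ord_max (ord_mem Hδ Ha) (ord_mem Hδ Hb)) as [c [[->| ->] H]]; eauto.
Qed.

Lemma ord_succ a : ordinal a -> ordinal (succ a).
Proof.
  intros Ha. split.
  - intros x Hx y Hy. apply in_succ. left. apply in_succ in Hx.
    destruct Hx as [Hx| ->]; auto. exact (ord_mem_trans Ha Hy Hx).
  - intros x Hx. apply in_succ in Hx. destruct Hx as [Hx| ->].
    + exact (proj2 Ha x Hx).
    + exact (proj1 Ha).
Qed.

Lemma succ_self a : a ∈ succ a.
Proof. apply in_succ; auto. Qed.

Lemma sub_succ a : a ⊆ succ a.
Proof. intros z Hz; apply in_succ; auto. Qed.

Lemma least_ordinal (P : V -> Prop) a :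
  ordinal a -> P a -> exists b, ordinal b /\ b ⊆ a /\ P b /\ forall c, c ∈ b -> ~ P c.
Proof.
  induction a as [a IH] using (well_founded_ind (@foundation V)). intros Ha Pa.
  destruct (classic (exists c, c ∈ a /\ P c)) as [[c [Hc Pc]]|N].
  - destruct (IH c Hc (ord_mem Ha Hc) Pc) as [b [Hb [Hbc H]]].
    exists b; split; [|split]; auto. exact (sub_trans Hbc (ord_trans Ha Hc)).
  - exists a. split; [|split; [|split]]; auto using sub_refl.
    intros c Hc Pc. apply N; eauto.
Qed.

Lemma limit_ord a : limit a -> ordinal a.
Proof. intros [H _]; exact H. Qed.

Lemma limit_succ a b : limit a -> b ∈ a -> succ b ∈ a.
Proof.
  intros [Ha [_ Hl]] Hb. destruct (Hl b Hb) as [c [Hc Hbc]].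
  apply (@ord_sub_mem _ c); auto.
  - apply ord_succ. exact (ord_mem Ha Hb).
  - intros z Hz. apply in_succ in Hz. destruct Hz as [Hz| ->]; auto.
    exact (ord_mem_trans (ord_mem Ha Hc) Hz Hbc).
Qed.

Fixpoint num (n : nat) : V := match n with 0 => empty | S n => succ (num n) end.
Definition omega : V := ⦃ x | exists n, x = num n ⦄.

Lemma in_omega x : x ∈ omega <-> exists n, x = num n.
Proof.
  destruct (infinity V) as [w [[e [He He']] Hs]].
  apply (@in_setof w). intros y [n ->]. induction n as [|n IH]; simpl.
  - replace empty with e; auto. apply set_ext; intros z. rewrite in_empty. split; [apply He'|tauto].
  - destruct (Hs _ IH) as [s [H1 H2]]. replace (succ (num n)) with s; auto.
    apply set_ext; intros z. rewrite in_succ. apply H2.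
Qed.

Lemma num_in_omega n : num n ∈ omega.
Proof. apply in_omega; eauto. Qed.

Lemma ord_num n : ordinal (num n).
Proof.
  induction n; simpl; [|apply ord_succ; auto].
  split; intros x Hx; apply in_empty in Hx; tauto.
Qed.

Lemma in_num n x : x ∈ num n -> exists m, m < n /\ x = num m.
Proof.
  induction n as [|n IH]; simpl; intros H.
  - apply in_empty in H; tauto.
  - apply in_succ in H. destruct H as [H| ->].
    + destruct (IH H) as [m [Hm ->]]. exists m; split; auto; lia.
    + exists n; split; auto.
Qed.

Lemma num_lt m n : m < n -> num m ∈ num n.
Proof.
  induction n as [|n IH]; simpl; intros H; [lia|].
  apply in_succ. destruct (Nat.eq_dec m n) as [->|]; [auto|left; apply IH; lia].
Qed.

Lemma num_inj m n : num m = num n -> m = n.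
Proof.
  intros E. destruct (Nat.lt_trichotomy m n) as [H|[H|H]]; auto;
    apply num_lt in H; rewrite E in H; exfalso; exact (mem_irrefl H).
Qed.

Lemma ord_omega : ordinal omega.
Proof.
  split.
  - intros x Hx y Hy. apply in_omega in Hx. destruct Hx as [n ->].
    apply in_num in Hy. destruct Hy as [m [_ ->]]. apply num_in_omega.
  - intros x Hx. apply in_omega in Hx. destruct Hx as [n ->]. exact (proj1 (ord_num n)).
Qed.

Lemma omega_sub_limit a : limit a -> omega ⊆ a.
Proof.
  intros Ha x Hx. apply in_omega in Hx. destruct Hx as [n ->].
  induction n as [|n IH]; [|exact (limit_succ Ha IH)].
  destruct Ha as [Ho [[y Hy] _]].
  destruct (ord_trichotomy (ord_num 0) Ho) as [H|[H|H]]; auto; exfalso.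
  - simpl in H. rewrite <- H in Hy. apply in_empty in Hy; exact Hy.
  - apply in_empty in H; exact H.
Qed.

(** * Stages of the cumulative hierarchy *)

Lemma in_stage_iff α x : in_stage α x <-> exists β, β ∈ α /\ forall y, y ∈ x -> in_stage β y.
Proof.
  split.
  - intros H. destruct H as [α β x Hb Hx]. eauto.
  - intros [β [Hb Hx]]. exact (in_stage_intro Hb Hx).
Qed.

(** The class [in_stage α] is a set because it lies in the union of the power sets of the [stage β],
    [β ∈ α], which by induction already have the right elements. *)
Lemma in_stageE α x : x ∈ stage α <-> in_stage α x.
Proof.
  revert x. induction α as [α IH] using (well_founded_ind (@foundation V)).
  apply (@in_setof (bigcup ⦃ p | exists β, β ∈ α /\ p = power (stage β) ⦄)).
  intros x Hx. apply in_stage_iff in Hx. destruct Hx as [β [Hb Hx]].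
  apply in_bigcup. exists (power (stage β)). split.
  - apply in_image; eauto.
  - apply in_power. intros y Hy. apply IH; auto.
Qed.

Lemma stage_spec α x : x ∈ stage α <-> exists β, β ∈ α /\ x ⊆ stage β.
Proof.
  rewrite in_stageE, in_stage_iff.
  split; intros [β [Hb Hx]]; exists β; split; auto; intros y Hy; apply in_stageE; auto.
Qed.

Lemma stage_mono α β : α ⊆ β -> stage α ⊆ stage β.
Proof. intros H x Hx. apply stage_spec in Hx. destruct Hx as [γ [Hg Hx]]. apply stage_spec; eauto. Qed.

Lemma stage_trans α x : ordinal α -> x ∈ stage α -> x ⊆ stage α.
Proof.
  intros Ha Hx. apply stage_spec in Hx. destruct Hx as [γ [Hg Hx]].
  exact (sub_trans Hx (stage_mono (ord_trans Ha Hg))).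
Qed.

Lemma stage_succ α x : x ⊆ stage α -> x ∈ stage (succ α).
Proof. intros H. apply stage_spec. exists α; auto using succ_self. Qed.

Lemma ord_in_stage α β : ordinal α -> β ∈ α -> β ∈ stage α.
Proof.
  revert β. induction α as [α IH] using (well_founded_ind (@foundation V)).
  intros β Ha Hb. apply stage_spec. exists β. split; auto.
  intros i Hi. apply IH; auto. exact (ord_mem Ha Hb).
Qed.

End Sets.

(** * Choice functions and trees of arguments *)

Lemma choose_fun (A B : Type) (R : A -> B -> Prop) :
  (forall a, exists b, R a b) -> exists f, forall a, R a (f a).
Proof.
  intros H. exists (fun a => proj1_sig (constructive_indefinite_description _ (H a))).
  intros a. exact (proj2_sig (constructive_indefinite_description _ (H a))).
Qed.

Lemma choose_fun_on (A B : Type) (P : A -> Prop) (R : A -> B -> Prop) :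
  inhabited B -> (forall a, P a -> exists b, R a b) -> exists f, forall a, P a -> R a (f a).
Proof.
  intros [b0] H. apply (@choose_fun A B (fun a b => P a -> R a b)). intros a.
  destruct (classic (P a)) as [Ha|Ha].
  - destruct (H a Ha) as [b Hb]. exists b; auto.
  - exists b0; tauto.
Qed.

(** Bracketed finite tuples. One operation on trees does the work of countably many finitary
    operations, and [node] merges two arguments into one, which makes families indexed by trees
    directed. *)
Inductive tree (T : Type) : Type :=
| leaf : T -> tree T
| node : tree T -> tree T -> tree T.

Fixpoint over (T : Type) (M : T -> Prop) (t : tree T) : Prop :=
  match t with
  | leaf a => M a
  | node s u => over M s /\ over M u
  end.

Fixpoint tmap (T U : Type) (f : T -> U) (t : tree T) : tree U :=
  match t with
  | leaf a => leaf (f a)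
  | node s u => node (tmap f s) (tmap f u)
  end.

Lemma over_impl T (M N : T -> Prop) t : (forall a, M a -> N a) -> over M t -> over N t.
Proof. intros H. induction t; simpl; intuition. Qed.

Lemma over_tmap T U (f : T -> U) (M : U -> Prop) t : over M (tmap f t) <-> over (fun a => M (f a)) t.
Proof. induction t; simpl; tauto. Qed.

Lemma tmap_id_on T (f : T -> T) (M : T -> Prop) t :
  (forall a, M a -> f a = a) -> over M t -> tmap f t = t.
Proof.
  intros H. induction t as [a|s IHs u IHu]; simpl; intros Ht.
  - rewrite H; auto.
  - rewrite IHs, IHu; tauto.
Qed.

Lemma tmap_tmap T U W (f : T -> U) (g : U -> W) t : tmap g (tmap f t) = tmap (fun a => g (f a)) t.
Proof. induction t; simpl; congruence. Qed.

(** * Smallness *)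

Section Small.
Context {V : zfc}.

(** Covering by an index [k] replaces cardinality, so that predicates on arbitrary types, such as
    trees and lists, can be measured. The two instances are [eq ν], meaning size less than κ, and
    [fun β => β ∈ μ], meaning size less than μ. *)
Definition small (K : V -> Prop) (T : Type) (M : T -> Prop) : Prop :=
  exists k f, K k /\ forall m, M m -> exists v, v ∈ k /\ m = f v.

(** What the union of small families consumes. [index_sup] is the regularity axiom: one index
    dominates all [h i]. It is trivial for [eq ν], and for the ordinals below μ it is the regularity
    of μ. *)
Record index_class (K : V -> Prop) : Prop := {
  index_pair : forall k k', K k -> K k' -> exists k'' (f g : V -> V), K k'' /\
    forall a b, a ∈ k -> b ∈ k' -> exists c, c ∈ k'' /\ f c = a /\ g c = b;
  index_sup : forall k (h : V -> V), K k -> (forall i, i ∈ k -> K (h i)) ->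
    exists k', K k' /\ forall i, i ∈ k -> exists f : V -> V,
      forall v, v ∈ h i -> exists w, w ∈ k' /\ v = f w;
  index_nat : exists k, K k /\ omega ⊆ k
}.

Context {K : V -> Prop} (HK : index_class K).

Lemma small_sub T (M N : T -> Prop) : small K N -> (forall m, M m -> N m) -> small K M.
Proof. intros [k [f [Hk Hf]]] H. exists k, f. split; auto. Qed.

Lemma small_image T U (M : T -> Prop) (N : U -> Prop) (g : T -> U) :
  small K M -> (forall n, N n -> exists m, M m /\ n = g m) -> small K N.
Proof.
  intros [k [f [Hk Hf]]] H. exists k, (fun v => g (f v)). split; auto.
  intros n Hn. destruct (H n Hn) as [m [Hm ->]]. destruct (Hf m Hm) as [v [Hv ->]]. eauto.
Qed.

Lemma small_nat : small K (fun _ : nat => True).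
Proof.
  destruct (index_nat HK) as [k [Hk Hw]].
  destruct (@choose_fun_on V nat (fun v => v ∈ omega) (fun v n => v = num n)) as [f Hf].
  - exact (inhabits 0).
  - intros v Hv. apply in_omega in Hv. exact Hv.
  - exists k, f. split; auto. intros n _. exists (num n). split; [apply Hw, num_in_omega|].
    apply (@num_inj V). apply Hf, num_in_omega.
Qed.

Lemma small_union T U (I : T -> Prop) (M : T -> U -> Prop) :
  inhabited U -> small K I -> (forall i, I i -> small K (M i)) ->
  small K (fun u => exists i, I i /\ M i u).
Proof.
  intros [u0] [k [f [Hk Hf]]] HM.
  destruct (@choose_fun_on V (V * (V -> U)) (fun v => I (f v))
    (fun v p => K (fst p) /\ forall m, M (f v) m -> exists w, w ∈ fst p /\ m = snd p w))
    as [g Hg].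
  { exact (inhabits (k, fun _ => u0)). }
  { intros v Hv. destruct (HM _ Hv) as [k' [f' H]]. exists (k', f'); exact H. }
  (* [f] may leave [I]; there [h] takes the value [k], which only has to belong to [K]. *)
  set (h := fun v => if excluded_middle_informative (I (f v)) then fst (g v) else k).
  destruct (@index_sup K HK k h Hk) as [k' [Hk' He]].
  { intros i Hi. unfold h. destruct (excluded_middle_informative _) as [H|H]; auto.
    apply Hg; auto. }
  destruct (@choose_fun_on V (V -> V) (fun i => i ∈ k)
    (fun i e => forall v, v ∈ h i -> exists w, w ∈ k' /\ v = e w)) as [e Hee]; auto.
  destruct (@index_pair K HK k k' Hk Hk') as [k'' [p1 [p2 [Hk'' Hp]]]].
  exists k'', (fun c => snd (g (p1 c)) (e (p1 c) (p2 c))). split; auto.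
  intros u [i [Hi Hu]]. destruct (Hf i Hi) as [v [Hv ->]].
  destruct (proj2 (Hg v Hi) u Hu) as [w [Hw ->]].
  destruct (Hee v Hv w) as [w' [Hw' ->]].
  { unfold h. destruct (excluded_middle_informative _); tauto. }
  destruct (Hp v w' Hv Hw') as [c [Hc [E1 E2]]].
  exists c. rewrite E1, E2. auto.
Qed.

Lemma small_or T (M N : T -> Prop) : inhabited T ->
  small K M -> small K N -> small K (fun t => M t \/ N t).
Proof.
  intros HT HM HN.
  apply small_sub with (N := fun t => exists n : nat, True /\
    match n with 0 => M t | _ => N t end).
  - apply small_union with (I := fun _ : nat => True); auto using small_nat.
    intros [|n] _; auto.
  - intros m [H|H]; [exists 0 | exists 1]; auto.
Qed.

Lemma small_prod T U (M : T -> Prop) (N : U -> Prop) :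
  small K M -> small K N -> small K (fun p : T * U => M (fst p) /\ N (snd p)).
Proof.
  intros HM HN.
  assert (HTU : inhabited (T * U)).
  { destruct HM as [_ [f _]], HN as [_ [g _]]. destruct (zfc_inhabited V) as [v].
    exact (inhabits (f v, g v)). }
  apply small_sub with (N := fun p => exists a, M a /\ (exists b, N b /\ p = (a, b))).
  - apply small_union; auto. intros a Ha.
    apply small_image with (M := N) (g := fun b => (a, b)); auto.
  - intros [a b] [Ha Hb]. simpl in *. eauto.
Qed.

Lemma small_tree T (M : T -> Prop) : small K M -> small K (over M).
Proof.
  intros HM.
  assert (HT : inhabited (tree T)).
  { destruct HM as [_ [f _]]. destruct (zfc_inhabited V) as [v]. exact (inhabits (leaf (f v))). }
  (* [W n] holds of the trees over [M] of height at most [n]. *)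
  set (W := fix W n t := match n with
    | 0 => exists a, M a /\ t = leaf a
    | S n => W n t \/ exists p, (W n (fst p) /\ W n (snd p)) /\ t = node (fst p) (snd p) end).
  apply small_sub with (N := fun t => exists n, True /\ W n t).
  - apply small_union; auto using small_nat. intros n _. induction n as [|n IH]; simpl.
    + apply small_image with (M := M) (g := @leaf T); auto.
    + apply small_or; auto.
      apply (@small_image _ _ (fun p => W n (fst p) /\ W n (snd p)) _ (fun p => node (fst p) (snd p))); auto.
      apply small_prod; auto.
  - assert (HW : forall n m t, n <= m -> W n t -> W m t).
    { intros n m t H. induction H; auto. simpl; auto. }
    intros t Ht.
    assert (exists n, W n t) as [n Hn]; [|eauto].
    induction t as [a|s IHs u IHu]; simpl in Ht.
    + exists 0. simpl. eauto.
    + destruct IHs as [n Hn]; [tauto|]. destruct IHu as [m Hm]; [tauto|].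
      exists (S (max n m)). simpl. right. exists (s, u). simpl.
      split; auto. split; [apply (HW n)|apply (HW m)]; auto; lia.
Qed.

(** ω steps reach the closure, since the finitely many leaves of a tree are all present at one
    finite step. *)
Fixpoint clo_iter (F : tree V -> V) (M : V -> Prop) (n : nat) (z : V) : Prop :=
  match n with
  | 0 => M z
  | S n => clo_iter F M n z \/ exists t, over (clo_iter F M n) t /\ z ∈ F t
  end.

Lemma clo_iter_mono F M n m z : n <= m -> clo_iter F M n z -> clo_iter F M m z.
Proof. intros H. induction H; auto. simpl; auto. Qed.

Lemma clo_iter_tree F M t : over (fun z => exists n, clo_iter F M n z) t ->
  exists n, over (clo_iter F M n) t.
Proof.
  induction t as [a|s IHs u IHu]; simpl; intros H; auto.
  destruct IHs as [n Hn]; [tauto|]. destruct IHu as [m Hm]; [tauto|].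
  exists (max n m). split; [apply over_impl with (2 := Hn)|apply over_impl with (2 := Hm)];
    intros z; apply clo_iter_mono; lia.
Qed.

Definition clo (F : tree V -> V) (M : V -> Prop) (z : V) : Prop := exists n, clo_iter F M n z.

Lemma clo_base F (M : V -> Prop) z : M z -> clo F M z.
Proof. exists 0; auto. Qed.

Lemma clo_step F M t z : over (clo F M) t -> z ∈ F t -> clo F M z.
Proof.
  intros Ht Hz. destruct (clo_iter_tree Ht) as [n Hn]. exists (S n). simpl; eauto.
Qed.

Lemma clo_sub F M (B : V -> Prop) :
  (forall z, M z -> B z) -> (forall t, over B t -> forall z, z ∈ F t -> B z) ->
  forall z, clo F M z -> B z.
Proof.
  intros HM HF z [n Hn].
  revert z Hn. induction n as [|n IH]; simpl; auto.
  intros z [H|[t [Ht Hz]]]; auto. apply HF with (2 := Hz). apply over_impl with (2 := Ht); auto.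
Qed.

(** [F] is controlled only on trees over the invariant [B], which therefore has to contain every
    step. Each step adds a union of small sets over a small class of trees. *)
Lemma small_clo F M (B : V -> Prop) :
  (forall z, M z -> B z) -> (forall t, over B t -> forall z, z ∈ F t -> B z) ->
  (forall t, over B t -> small K (fun z => z ∈ F t)) ->
  small K M -> small K (clo F M).
Proof.
  intros HM HF Hs Sm.
  apply small_sub with (N := fun z => exists n, True /\ clo_iter F M n z).
  2: { intros z [n Hn]. eauto. }
  assert (HB : forall n z, clo_iter F M n z -> B z).
  { induction n as [|n IH]; simpl; auto.
    intros z [H|[t [Ht Hz]]]; auto. apply HF with (2 := Hz). apply over_impl with (2 := Ht); auto. }
  apply small_union; auto using small_nat, zfc_inhabited.
  intros n _. induction n as [|n IH]; simpl; auto.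
  apply small_or; auto using zfc_inhabited.
  apply small_union; auto using zfc_inhabited, small_tree.
  intros t Ht. apply Hs. apply over_impl with (2 := Ht). apply HB.
Qed.

End Small.

(** * Pairing on infinite ordinals *)

Section Ordinals.
Context {V : zfc}.
Implicit Types a b c x y : V.

Definition prod_set a b : V := ⦃ c | exists i j, i ∈ a /\ j ∈ b /\ c = pair i j ⦄.

Lemma in_prod_set a b c : c ∈ prod_set a b <-> exists i j, i ∈ a /\ j ∈ b /\ c = pair i j.
Proof.
  apply (@in_setof _ (bigcup ⦃ y | exists i, i ∈ a /\ y = ⦃ c | exists j, j ∈ b /\ c = pair i j ⦄ ⦄)).
  intros w [i [j [Hi [Hj ->]]]]. apply in_bigcup. eexists; split.
  - apply in_image. eauto.
  - apply (in_image b (fun j => pair i j)). eauto.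
Qed.

Definition fst_of (c : V) : V := epsilon (zfc_inhabited V) (fun i => exists j, c = pair i j).
Definition snd_of (c : V) : V := epsilon (zfc_inhabited V) (fun j => exists i, c = pair i j).

Lemma fst_pair a b : fst_of (pair a b) = a.
Proof.
  unfold fst_of. pose proof (epsilon_spec (zfc_inhabited V) (fun i => exists j, pair a b = pair i j)) as H.
  destruct H as [j Hj]; [eauto|]. apply pair_inj in Hj. symmetry; tauto.
Qed.

Lemma snd_pair a b : snd_of (pair a b) = b.
Proof.
  unfold snd_of. pose proof (epsilon_spec (zfc_inhabited V) (fun j => exists i, pair a b = pair i j)) as H.
  destruct H as [j Hj]; [eauto|]. apply pair_inj in Hj. symmetry; tauto.
Qed.

(** Mostowski collapse on a type. The covering of [S] by a set [A] makes the values sets, and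
    transitivity makes them ordinals; injectivity is left to the callers, who derive it from
    totality. *)
Lemma collapse (T : Type) (lt : T -> T -> Prop) (S : T -> Prop) (A : V) (e : V -> T) :
  well_founded lt ->
  (forall t u v, S t -> S u -> S v -> lt t u -> lt u v -> lt t v) ->
  (forall t, S t -> exists a, a ∈ A /\ t = e a) ->
  exists r : T -> V,
    (forall t z, z ∈ r t <-> exists u, S u /\ lt u t /\ z = r u) /\
    (forall t, S t -> ordinal (r t)).
Proof.
  intros wf tr HA.
  pose (F := fun (t : T) (rec : forall u, lt u t -> V) =>
    ⦃ z | exists u (H : lt u t), S u /\ z = rec u H ⦄).
  pose (r := Fix wf (fun _ => V) F).
  assert (Er : forall t, r t = ⦃ z | exists u (H : lt u t), S u /\ z = r u ⦄).
  { intros t. unfold r at 1. rewrite Fix_eq; [reflexivity|].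
    intros x f g Hfg. replace g with f; auto.
    apply functional_extensionality_dep; intros u.
    apply functional_extensionality_dep; intros H. apply Hfg. }
  assert (Hr : forall t z, z ∈ r t <-> exists u, S u /\ lt u t /\ z = r u).
  { intros t z. rewrite Er. rewrite (@in_setof _ ⦃ z | exists a, a ∈ A /\ z = r (e a) ⦄).
    - split; [intros [u [H [H1 H2]]] | intros [u [H [H1 H2]]]]; eauto.
    - intros w [u [_ [Hu ->]]]. apply (in_image A (fun a => r (e a))).
      destruct (HA u Hu) as [a [Ha ->]]. eauto. }
  assert (Htr : forall t, S t -> forall x, x ∈ r t -> x ⊆ r t).
  { intros t Ht x Hx z Hz. apply Hr in Hx. destruct Hx as [u [Hu [Hut ->]]].
    apply Hr in Hz. destruct Hz as [v [Hv [Hvu ->]]]. apply Hr. exists v; eauto 6. }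
  exists r. split; auto. intros t Ht. apply ordinalP. split; auto.
  intros x Hx. apply Hr in Hx. destruct Hx as [u [Hu [_ ->]]]. auto.
Qed.

(** Hilbert's hotel: the new point [a] goes to 0 and the natural numbers move up by one. *)
Lemma shift_inj a : ordinal a -> omega ⊆ a ->
  exists f : V -> V, (forall i, i ∈ succ a -> f i ∈ a) /\
    forall i j, i ∈ succ a -> j ∈ succ a -> f i = f j -> i = j.
Proof.
  intros Ha Hw.
  exists (fun i : V => if excluded_middle_informative (i = a) then num 0
    else if excluded_middle_informative (i ∈ omega) then succ i else i).
  assert (Hs : forall i : V, i ∈ omega -> exists n, i = num n /\ succ i = num (S n)).
  { intros i Hi. apply in_omega in Hi. destruct Hi as [n ->]. eauto. }
  split.
  - intros i Hi. apply in_succ in Hi.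
    destruct (excluded_middle_informative (i = a)) as [E0|N0]; [apply Hw, num_in_omega|].
    destruct (excluded_middle_informative (i ∈ omega)) as [Hi'|]; [|tauto].
    destruct (Hs i Hi') as [n [_ ->]]. apply Hw, num_in_omega.
  - intros i j Hi Hj.
    assert (O : forall n, num n ∈ @omega V) by apply num_in_omega.
    destruct (excluded_middle_informative (i = a)) as [E0|N0],
      (excluded_middle_informative (j = a)) as [E1|N1];
      [congruence| | |];
    try (destruct (excluded_middle_informative (i ∈ omega)) as [Hi'|Ni];
      [destruct (Hs i Hi') as [n [En ->]]|]);
    try (destruct (excluded_middle_informative (j ∈ omega)) as [Hj'|Nj];
      [destruct (Hs j Hj') as [m [Em ->]]|]); intros E; try congruence;
    try (apply num_inj in E; congruence); exfalso; eauto;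
    try (apply Ni; rewrite E; apply O); try (apply Nj; rewrite <- E; apply O).
Qed.

Definition injects_square a b : Prop := exists g : V -> V -> V,
  (forall i j, i ∈ a -> j ∈ a -> g i j ∈ b) /\
  forall i j i' j', i ∈ a -> j ∈ a -> i' ∈ a -> j' ∈ a -> g i j = g i' j' -> i = i' /\ j = j'.

Lemma square_omega : injects_square omega omega.
Proof.
  destruct (@choose_fun_on V nat (fun v => v ∈ omega) (fun v n => v = num n)) as [f Hf].
  - exact (inhabits 0).
  - intros v Hv. apply in_omega in Hv. exact Hv.
  - exists (fun i j => num (Cantor.to_nat (f i, f j))). split.
    + intros; apply num_in_omega.
    + intros i j i' j' Hi Hj Hi' Hj' E. apply num_inj in E.
      assert (E' : (f i, f j) = (f i', f j'))
        by (rewrite <- (Cantor.cancel_of_to (f i, f j)), E; apply Cantor.cancel_of_to).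
      injection E' as E1 E2. rewrite (Hf i), (Hf j), (Hf i'), (Hf j') by auto. rewrite E1, E2; auto.
Qed.

(** Gödel's order on pairs: by the maximum, which for ordinals is the union, and then
    lexicographically. *)
Definition godel_lt (p q : V * V) : Prop :=
  let mp := cup (fst p) (snd p) in let mq := cup (fst q) (snd q) in
  mp ∈ mq \/ (mp = mq /\ (fst p ∈ fst q \/ (fst p = fst q /\ snd p ∈ snd q))).

Lemma godel_lt_wf : well_founded godel_lt.
Proof.
  assert (H : forall m a b, cup a b = m -> Acc godel_lt (a, b)).
  { induction m as [m IHm] using (well_founded_ind (@foundation V)).
    induction a as [a IHa] using (well_founded_ind (@foundation V)).
    induction b as [b IHb] using (well_founded_ind (@foundation V)).
    intros Em. constructor. intros [a' b'] [H|[E [H|[E1 H]]]]; simpl in *.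
    - rewrite Em in H. eapply IHm; eauto.
    - apply IHa; congruence.
    - subst a'. apply IHb; congruence. }
  intros [a b]. eapply H; reflexivity.
Qed.

Lemma ord_cup a b : ordinal a -> ordinal b -> cup a b = a \/ cup a b = b.
Proof.
  intros Ha Hb. destruct (ord_sub_or_mem Ha Hb) as [H|H].
  - right. apply sub_antisym; intros z; rewrite in_cup; auto. intros [Hz|Hz]; auto.
  - left. apply sub_antisym; intros z; rewrite in_cup; auto. intros [Hz|Hz]; auto.
    exact (ord_mem_trans Ha Hz H).
Qed.

(** Hessenberg's argument. If [a] injects into one of its elements, the induction hypothesis
    transfers. Otherwise the Gödel rank of every pair lies in [a]: a rank including [a] would inject
    [a] into the square of a successor ordinal below [a], and hence into an element of [a]. *)
Lemma square_ordinal a : ordinal a -> omega ⊆ a -> injects_square a a.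
Proof.
  induction a as [a IH] using (well_founded_ind (@foundation V)). intros Ha Hw.
  destruct (ord_trichotomy ord_omega Ha) as [Hwa|[<-|Hwa]];
    [|exact square_omega|exfalso; exact (mem_irrefl (Hw _ Hwa))].
  destruct (classic (exists b f, b ∈ a /\ (forall i, i ∈ a -> f i ∈ b) /\
    forall i j, i ∈ a -> j ∈ a -> f i = f j -> i = j)) as [[b [f [Hb [Hf Hi]]]]|N].
  - destruct (ord_max_in Ha Hb Hwa) as [c [Hc [Hbc Hwc]]].
    destruct (IH c Hc (ord_mem Ha Hc) Hwc) as [g [Hg1 Hg2]].
    exists (fun i j => g (f i) (f j)). split.
    + intros i j Hi' Hj. apply (ord_trans Ha Hc). apply Hg1; auto.
    + intros i j i' j' H1 H2 H3 H4 E. apply Hg2 in E; auto. destruct E; split; apply Hi; auto.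
  - set (S := fun p : V * V => fst p ∈ a /\ snd p ∈ a).
    assert (OS : forall i, i ∈ a -> ordinal i) by (intros i; apply ord_mem; auto).
    assert (Om : forall p, S p -> cup (fst p) (snd p) ∈ a).
    { intros [i j] [Hi Hj]; simpl in *. destruct (ord_cup (OS i Hi) (OS j Hj)) as [->| ->]; auto. }
    destruct (@collapse (V * V) godel_lt S (prod_set a a) (fun c => (fst_of c, snd_of c)) godel_lt_wf)
      as [r [Hr Hro]].
    { intros t u v Ht Hu Hv H1 H2. unfold godel_lt in *.
      pose proof (Om v Hv) as Mv.
      destruct t as [t1 t2], u as [u1 u2], v as [v1 v2]. unfold S in *. simpl in *.
      assert (TR : forall x y z, x ∈ y -> y ∈ z -> z ∈ a -> x ∈ z).
      { intros x y z Hxy Hyz Hz. exact (ord_mem_trans (OS z Hz) Hxy Hyz). }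
      destruct H1 as [H1|[E1 [H1|[E1' H1]]]], H2 as [H2|[E2 [H2|[E2' H2]]]].
      - left. exact (TR _ _ _ H1 H2 Mv).
      - left. rewrite <- E2. exact H1.
      - left. rewrite <- E2. exact H1.
      - left. rewrite E1. exact H2.
      - right; split; [congruence|]. left. exact (TR _ _ _ H1 H2 (proj1 Hv)).
      - right; split; [congruence|]. left. rewrite <- E2'. exact H1.
      - left. rewrite E1. exact H2.
      - right; split; [congruence|]. left. rewrite E1'. exact H2.
      - right; split; [congruence|]. right. split; [congruence|]. exact (TR _ _ _ H1 H2 (proj2 Hv)). }
    { intros [i j] [Hi Hj]; simpl in *. exists (pair i j). split.
      - apply in_prod_set; eauto.
      - rewrite fst_pair, snd_pair; reflexivity. }
    assert (Tot : forall p q, S p -> S q -> godel_lt p q \/ p = q \/ godel_lt q p).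
    { intros p q Hp Hq. unfold godel_lt.
      pose proof (Om p Hp) as Mp. pose proof (Om q Hq) as Mq.
      destruct p as [p1 p2], q as [q1 q2]; unfold S in *; simpl in *.
      destruct Hp as [P1 P2], Hq as [Q1 Q2].
      destruct (ord_trichotomy (OS _ Mp) (OS _ Mq)) as [H|[H|H]]; auto.
      destruct (ord_trichotomy (OS _ P1) (OS _ Q1)) as [H'|[H'|H']]; auto 6.
      destruct (ord_trichotomy (OS _ P2) (OS _ Q2)) as [H''|[H''|H'']]; auto 8.
      subst; auto. }
    assert (Inj : forall p q, S p -> S q -> r p = r q -> p = q).
    { intros p q Hp Hq E. destruct (Tot p q Hp Hq) as [H|[H|H]]; auto; exfalso.
      - apply (@mem_irrefl V (r q)). rewrite <- E at 1. apply Hr. eauto.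
      - apply (@mem_irrefl V (r p)). rewrite E at 1. apply Hr. eauto. }
    exists (fun i j => r (i, j)). split.
    2: { intros i j i' j' H1 H2 H3 H4 E. apply Inj in E; try (split; auto).
         all: injection E; auto. }
    intros i j Hi Hj.
    destruct (ord_sub_or_mem Ha (Hro (i, j) (conj Hi Hj))) as [Hsub|]; auto.
    exfalso. apply N.
    set (m := cup i j).
    assert (Hm : m ∈ a) by (apply (Om (i, j)); split; auto).
    (* everything below [(i, j)] lies in the square of [succ m] *)
    destruct (@choose_fun_on V (V * V) (fun k => k ∈ a)
      (fun k q => S q /\ godel_lt q (i, j) /\ k = r q)) as [q Hq].
    { exact (inhabits (i, i)). }
    { intros k Hk. apply Hsub in Hk. apply Hr in Hk. exact Hk. }
    assert (Bd : forall q, S q -> godel_lt q (i, j) -> fst q ∈ succ m /\ snd q ∈ succ m).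
    { intros [u v] HS Hlt. pose proof (Om _ HS) as Muv. destruct HS as [Hu Hv].
      assert (Hle : cup u v ⊆ m).
      { destruct Hlt as [H|[H _]]; simpl in *.
        - exact (ord_trans (OS m Hm) H).
        - rewrite H. apply sub_refl. }
      simpl in *.
      split; (apply (@ord_sub_mem V _ m); [apply OS; auto|apply ord_succ, OS; auto| |apply succ_self]);
        intros z Hz; apply Hle, in_cup; auto. }
    (* [c] is [m] enlarged to include ω, so that both [shift_inj] and the induction hypothesis apply
       to it. *)
    destruct (ord_max_in Ha Hm Hwa) as [c [Hc [Hmc Hwc]]].
    assert (exists f : V -> V, (forall k, k ∈ succ m -> f k ∈ c) /\
      forall k l, k ∈ succ m -> l ∈ succ m -> f k = f l -> k = l) as [f [Hf1 Hf2]].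
    { destruct (shift_inj (OS c Hc) Hwc) as [f [H1 H2]].
      assert (succ m ⊆ succ c).
      { intros z Hz. apply (@ord_sub_mem V _ c); [| |intros w Hw'|apply succ_self].
        - exact (ord_mem (ord_succ (OS m Hm)) Hz).
        - apply ord_succ, OS; auto.
        - apply in_succ in Hz. destruct Hz as [Hz| ->]; auto.
          apply Hmc. exact (ord_mem_trans (OS m Hm) Hw' Hz). }
      exists f. split; auto. }
    destruct (IH c Hc (OS c Hc) Hwc) as [g [Hg1 Hg2]].
    exists c, (fun k => g (f (fst (q k))) (f (snd (q k)))). split; auto. split.
    + intros k Hk. destruct (Hq k Hk) as [HS [Hlt _]]. destruct (Bd _ HS Hlt). auto.
    + intros k l Hk Hl E. destruct (Hq k Hk) as [HS [Hlt Ek]]. destruct (Hq l Hl) as [HS' [Hlt' El]].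
      destruct (Bd _ HS Hlt), (Bd _ HS' Hlt'). apply Hg2 in E; auto. destruct E as [E1 E2].
      apply Hf2 in E1; auto. apply Hf2 in E2; auto.
      rewrite Ek, El. f_equal. destruct (q k), (q l); simpl in *; congruence.
Qed.

Lemma index_pair_ordinal a : ordinal a -> omega ⊆ a ->
  exists (f g : V -> V), forall i j, i ∈ a -> j ∈ a -> exists c, c ∈ a /\ f c = i /\ g c = j.
Proof.
  intros Ha Hw. destruct (square_ordinal Ha Hw) as [g [Hg1 Hg2]].
  destruct (@choose_fun_on V (V * V) (fun c => exists i j, i ∈ a /\ j ∈ a /\ c = g i j)
    (fun c p => fst p ∈ a /\ snd p ∈ a /\ c = g (fst p) (snd p))) as [h Hh].
  { exact (inhabits (a, a)). }
  { intros c [i [j H]]. exists (i, j). exact H. }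
  exists (fun c => fst (h c)), (fun c => snd (h c)). intros i j Hi Hj.
  exists (g i j). split; auto.
  destruct (Hh (g i j)) as [H1 [H2 H3]]; [eauto 6|].
  apply Hg2 in H3; auto. destruct H3; auto.
Qed.

(** * Cardinality *)

Lemma sat_IsFun f a b : sat (IsFun f a b) <->
  (forall c, c ∈ f -> exists x, x ∈ a /\ exists y, y ∈ b /\ c = pair x y) /\
  (forall x, x ∈ a -> exists y, y ∈ b /\ pair x y ∈ f /\ forall y', y' ∈ b -> pair x y' ∈ f -> y' = y).
Proof.
  change (sat (IsFun f a b)) with
  ((forall c, c ∈ f -> exists x, x ∈ a /\ exists y, y ∈ b /\ sat (IsPair x y c)) /\
  (forall x, x ∈ a -> exists y, y ∈ b /\ sat (PairIn x y f) /\
     forall y', y' ∈ b -> sat (PairIn x y' f) -> y' = y)).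
  setoid_rewrite sat_IsPair. setoid_rewrite sat_PairIn. reflexivity.
Qed.

Lemma equinumerousP a b : equinumerous a b <-> exists f : V -> V,
  (forall x, x ∈ a -> f x ∈ b) /\
  (forall x y, x ∈ a -> y ∈ a -> f x = f y -> x = y) /\
  (forall y, y ∈ b -> exists x, x ∈ a /\ y = f x).
Proof.
  assert (E : equinumerous a b <-> exists f, sat (IsFun f a b) /\
    forall y, y ∈ b -> exists x, x ∈ a /\ pair x y ∈ f /\ forall x', x' ∈ a -> pair x' y ∈ f -> x' = x).
  { change (equinumerous a b) with (exists f, sat (IsFun f a b) /\
    forall y, y ∈ b -> exists x, x ∈ a /\ sat (PairIn x y f) /\
      forall x', x' ∈ a -> sat (PairIn x' y f) -> x' = x).
    setoid_rewrite sat_PairIn. reflexivity. }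
  rewrite E. setoid_rewrite sat_IsFun. clear E. split.
  - intros [f [[Hf1 Hf2] Hf3]].
    destruct (@choose_fun_on V V (fun x => x ∈ a) (fun x y => y ∈ b /\ pair x y ∈ f /\
      forall y', y' ∈ b -> pair x y' ∈ f -> y' = y)) as [g Hg]; auto using zfc_inhabited.
    exists g. split; [|split].
    + intros x Hx. apply Hg; auto.
    + intros x y Hx Hy Exy. destruct (Hg x Hx) as [G1 [G2 _]], (Hg y Hy) as [_ [G3 _]].
      destruct (Hf3 (g x) G1) as [u [_ [_ Hu]]]. rewrite <- Exy in G3.
      rewrite (Hu x), (Hu y); auto.
    + intros y Hy. destruct (Hf3 y Hy) as [x [Hx [Hxy _]]]. exists x; split; auto.
      apply Hg; auto.
  - intros [g [H1 [H2 H3]]]. exists ⦃ c | exists x, x ∈ a /\ c = pair x (g x) ⦄.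
    assert (Hp : forall x y, pair x y ∈ ⦃ c | exists x, x ∈ a /\ c = pair x (g x) ⦄ <-> x ∈ a /\ y = g x).
    { intros x y. rewrite (in_image a (fun x => pair x (g x))). split.
      - intros [x' [Hx Exy]]. apply pair_inj in Exy. destruct Exy; subst; auto.
      - intros [Hx ->]; eauto. }
    split; [split|].
    + intros c Hc. apply (in_image a (fun x => pair x (g x))) in Hc. destruct Hc as [x [Hx ->]]. eauto 7.
    + intros x Hx. exists (g x). split; auto. split; [apply Hp; auto|].
      intros y' _ Hy'. apply Hp in Hy'. tauto.
    + intros y Hy. destruct (H3 y Hy) as [x [Hx ->]]. exists x. split; auto. split; [apply Hp; auto|].
      intros x' Hx' Hxx. apply Hp in Hxx. apply H2; auto. symmetry; tauto.
Qed.

Lemma equinumerous_trans a b c : equinumerous a b -> equinumerous b c -> equinumerous a c.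
Proof.
  rewrite !equinumerousP. intros [f [F1 [F2 F3]]] [g [G1 [G2 G3]]].
  exists (fun x => g (f x)). split; [|split]; auto.
  intros z Hz. destruct (G3 z Hz) as [y [Hy ->]]. destruct (F3 y Hy) as [x [Hx ->]]. eauto.
Qed.

Lemma equinumerous_refl a : equinumerous a a.
Proof. apply equinumerousP. exists (fun x => x). split; [|split]; eauto. Qed.

Lemma index_class_ordinal (ν : V) : ordinal ν -> omega ⊆ ν -> index_class (eq ν).
Proof.
  intros Hν Hw. split.
  - intros k k' <- <-. destruct (index_pair_ordinal Hν Hw) as [f [g H]]. exists ν, f, g; auto.
  - intros k h <- Hh. exists ν. split; auto. intros i Hi. rewrite <- (Hh i Hi).
    exists (fun v => v). eauto.
  - exists ν; auto.
Qed.

(** From left to right, the least ordinal equinumerous with [x] is a cardinal, hence included in ν,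
    the largest cardinal below κ. From right to left, a covering by ν has an injective section, and
    the collapse of its range is an ordinal included in ν. *)
Lemma successor_cardinal_spec (κ : V) : successor_cardinal κ ->
  exists ν, ordinal κ /\ ν ∈ κ /\ omega ⊆ ν /\
    forall x, card_lt x κ <-> small (eq ν) (fun z => z ∈ x).
Proof.
  intros [Hκ [ν [[Hν1 Hν2] [Hνκ Hmax]]]]. exists ν.
  assert (Oκ : ordinal κ) by exact (proj1 Hκ).
  assert (Oν : ordinal ν) by exact (proj1 Hν1).
  split; auto. split; auto. split; [exact (omega_sub_limit Hν2)|].
  intros x. split.
  - intros [β [Hβ Hx]].
    destruct (@least_ordinal V (fun γ => equinumerous x γ) β (ord_mem Oκ Hβ) Hx)
      as [γ [Oγ [Hγβ [Hγ Hl]]]].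
    assert (Cγ : cardinal γ).
    { split; [exact Oγ|]. intros y Hy Ey. apply (Hl y Hy).
      apply equinumerousP in Ey. destruct Ey as [f [F1 [F2 F3]]].
      apply equinumerous_trans with γ; auto. apply equinumerousP.
      destruct (@choose_fun_on V V (fun z => z ∈ γ) (fun z u => u ∈ y /\ z = f u)) as [g Hg];
        auto using zfc_inhabited.
      exists g. split; [|split].
      - intros z Hz; apply Hg; auto.
      - intros z w Hz Hw E. destruct (Hg z Hz) as [_ ->], (Hg w Hw) as [_ ->]. congruence.
      - intros u Hu. exists (f u). split; auto. destruct (Hg (f u) (F1 u Hu)) as [G1 G2]. apply F2; auto. }
    assert (Hγν : γ ⊆ ν).
    { destruct (Hmax γ Cγ (ord_sub_mem Oγ Oκ Hγβ Hβ)) as [H|H].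
      - exact (ord_trans Oν H).
      - subst; apply sub_refl. }
    apply equinumerousP in Hγ. destruct Hγ as [f [F1 [F2 F3]]].
    destruct (@choose_fun_on V V (fun z => z ∈ γ) (fun z u => u ∈ x /\ z = f u)) as [g Hg];
      auto using zfc_inhabited.
    exists ν, g. split; auto. intros m Hm. exists (f m). split; auto.
    destruct (Hg (f m) (F1 m Hm)) as [G1 G2]. auto.
  - intros [k [f [<- Hf]]].
    destruct (@choose_fun_on V V (fun z => z ∈ x) (fun z v => v ∈ ν /\ z = f v)) as [g Hg];
      auto using zfc_inhabited.
    set (S := fun i => exists z, z ∈ x /\ i = g z).
    assert (HS : forall i, S i -> i ∈ ν) by (intros i [z [Hz ->]]; apply Hg; auto).
    destruct (@collapse V (@mem V) S ν (fun v => v) (@foundation V)) as [r [Hr Hro]].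
    { intros t u v Ht Hu Hv H1 H2. exact (ord_mem_trans (ord_mem Oν (HS v Hv)) H1 H2). }
    { intros t Ht. eauto. }
    assert (Hle : forall i, i ∈ ν -> S i -> r i ⊆ i).
    { induction i as [i IH] using (well_founded_ind (@foundation V)).
      intros Hi Si z Hz. apply Hr in Hz. destruct Hz as [j [Sj [Hj ->]]].
      apply (@ord_sub_mem V _ j); auto. exact (ord_mem Oν Hi). }
    set (β := ⦃ y | exists z, z ∈ x /\ y = r (g z) ⦄).
    assert (Hβ : forall y, y ∈ β <-> exists z, z ∈ x /\ y = r (g z)) by (intros y; apply (in_image x (fun z => r (g z)))).
    assert (Sg : forall z, z ∈ x -> S (g z)) by (intros z Hz; exists z; auto).
    assert (Oβ : ordinal β).
    { apply ordinalP. split.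
      - intros y Hy w Hw. apply Hβ in Hy. destruct Hy as [z [Hz ->]].
        apply Hr in Hw. destruct Hw as [u [[z' [Hz' ->]] [_ ->]]]. apply Hβ; eauto.
      - intros y Hy. apply Hβ in Hy. destruct Hy as [z [Hz ->]].
        exact (proj1 (Hro _ (Sg z Hz))). }
    exists β. split.
    + apply (@ord_sub_mem V _ ν); auto. intros y Hy. apply Hβ in Hy. destruct Hy as [z [Hz ->]].
      apply (@ord_sub_mem V _ (g z)); auto.
    + apply equinumerousP. exists (fun z => r (g z)). split; [|split].
      * intros z Hz. apply Hβ; eauto.
      * intros z w Hz Hw E. destruct (Hg z Hz) as [G1 ->], (Hg w Hw) as [G2 ->]. f_equal.
        destruct (ord_trichotomy (ord_mem Oν G1) (ord_mem Oν G2)) as [H|[H|H]]; auto; exfalso.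
        -- apply (@mem_irrefl V (r (g w))). rewrite <- E at 1. apply Hr; eauto.
        -- apply (@mem_irrefl V (r (g z))). rewrite E at 1. apply Hr; eauto.
      * intros y Hy. apply Hβ; auto.
Qed.

(** * Inaccessible cardinals *)

Lemma regular_limit (μ : V) : regular μ -> limit μ.
Proof. intros [H _]; exact H. Qed.

(** Without a bound the graph of [h] would be a cofinal function from [β] to [μ]. *)
Lemma regular_bound (μ : V) : regular μ -> forall β (h : V -> V), β ∈ μ ->
  (forall i, i ∈ β -> h i ∈ μ) -> exists η, η ∈ μ /\ forall i, i ∈ β -> h i ∈ η.
Proof.
  intros Hμ β h Hβ Hh. pose proof (limit_ord (regular_limit Hμ)) as Oμ.
  apply NNPP. intros N.
  set (f := ⦃ c | exists i, i ∈ β /\ c = pair i (h i) ⦄).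
  assert (Hp : forall c, c ∈ f <-> exists i, i ∈ β /\ c = pair i (h i))
    by (intros c; apply (in_image β (fun i => pair i (h i)))).
  apply (proj2 Hμ β Hβ f).
  change (sat (IsFun f β μ) /\ forall y, y ∈ μ -> exists x, x ∈ β /\ exists z, z ∈ μ /\
    (sat (PairIn x z f) /\ (y ∈ z \/ y = z))).
  split.
  - apply sat_IsFun. split.
    + intros c Hc. apply Hp in Hc. destruct Hc as [i [Hi ->]]. eauto 7.
    + intros i Hi. exists (h i). split; auto. split; [apply Hp; eauto|].
      intros y _ Hy. apply Hp in Hy. destruct Hy as [j [Hj E]]. apply pair_inj in E.
      destruct E; subst; auto.
  - intros y Hy. apply NNPP. intros N'. apply N. exists y. split; auto.
    intros i Hi.
    destruct (ord_trichotomy (ord_mem Oμ (Hh i Hi)) (ord_mem Oμ Hy)) as [H|H]; auto. exfalso.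
    apply N'. exists i. split; auto. exists (h i). split; auto. split.
    + apply sat_PairIn, Hp; eauto.
    + destruct H; auto.
Qed.

Lemma inaccessible_limit (μ : V) : inaccessible μ -> limit μ.
Proof. intros [H _]. exact (regular_limit H). Qed.

Lemma index_class_inaccessible (μ : V) : inaccessible μ -> index_class (fun β => β ∈ μ).
Proof.
  intros Hμ. pose proof (limit_ord (inaccessible_limit Hμ)) as Oμ.
  destruct Hμ as [Hreg [[w [Hw Lw]] _]].
  assert (Hω : omega ∈ μ).
  { apply (@ord_sub_mem V _ w); auto using ord_omega. exact (omega_sub_limit Lw). }
  split.
  - intros k k' Hk Hk'. destruct (ord_max_in Oμ Hk Hk') as [c [Hc [H1 H2]]].
    destruct (ord_max_in Oμ Hc Hω) as [d [Hd [H3 H4]]].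
    destruct (index_pair_ordinal (ord_mem Oμ Hd) H4) as [f [g H]].
    exists d, f, g. split; auto.
  - intros k h Hk Hh. destruct (regular_bound Hreg Hk Hh) as [η [Hη H]].
    exists η. split; auto. intros i Hi. exists (fun v => v). intros v Hv. exists v. split; auto.
    exact (ord_mem_trans (ord_mem Oμ Hη) Hv (H i Hi)).
  - exists omega. split; auto using sub_refl.
Qed.

(** A subset of [x] is recovered from its preimage under the covering of [x] by [β], and [power β]
    is equinumerous with an ordinal below μ. *)
Lemma small_power (μ : V) x : inaccessible μ ->
  small (fun β => β ∈ μ) (fun z => z ∈ x) -> small (fun β => β ∈ μ) (fun y => y ⊆ x).
Proof.
  intros [_ [_ Hpow]] [β [f [Hβ Hf]]].
  destruct (Hpow β Hβ) as [θ [Hθ Hbij]].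
  apply equinumerousP in Hbij. destruct Hbij as [g [G1 [G2 G3]]].
  destruct (@choose_fun_on V V (fun z => z ∈ θ) (fun z u => u ∈ power β /\ z = g u)) as [g' Hg'];
    auto using zfc_inhabited.
  exists θ, (fun v => ⦃ z | z ∈ x /\ exists i, i ∈ g' v /\ z = f i ⦄). split; auto.
  intros y Hy. set (u := ⦃ i | i ∈ β /\ f i ∈ y ⦄).
  assert (Hu : u ∈ power β). { apply in_power. intros i Hi. apply in_sep in Hi. tauto. }
  exists (g u). split; auto.
  destruct (Hg' (g u) (G1 u Hu)) as [H1 H2]. apply G2 in H2; auto. rewrite <- H2.
  apply set_ext. intros z. rewrite in_sep. split.
  - intros Hz. split; auto. destruct (Hf z (Hy z Hz)) as [v [Hv ->]]. exists v. split; auto.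
    apply in_sep; auto.
  - intros [_ [i [Hi ->]]]. apply in_sep in Hi. tauto.
Qed.

Lemma small_stage (μ : V) : inaccessible μ -> forall ξ, ξ ∈ μ ->
  small (fun β => β ∈ μ) (fun z => z ∈ stage ξ).
Proof.
  intros Hμ. pose proof (limit_ord (inaccessible_limit Hμ)) as Oμ.
  induction ξ as [ξ IH] using (well_founded_ind (@foundation V)). intros Hξ.
  apply small_sub with (N := fun z => exists β, β ∈ ξ /\ z ⊆ stage β).
  - apply small_union; auto using index_class_inaccessible, zfc_inhabited.
    + exists ξ, (fun v => v). eauto.
    + intros β Hβ. apply small_power; auto. apply IH; auto. exact (ord_mem_trans Oμ Hβ Hξ).
  - intros z Hz. apply stage_spec; auto.
Qed.

End Ordinals.

(** * Clubs and stationary sets *)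

(** κ = ν⁺ in the form in which it is used. As a class it is found by instance search throughout the
    theory of clubs. *)
Class successor_index {V : zfc} (κ ν : V) : Prop := {
  si_ord : ordinal κ;
  si_mem : ν ∈ κ;
  si_inf : omega ⊆ ν;
  si_card : forall x, card_lt x κ <-> small (eq ν) (fun z => z ∈ x)
}.

Section Clubs.
Context {V : zfc} {κ ν : V} {Hκ : successor_index κ ν}.
Implicit Types A B x y z w : V.

Lemma si_ordν : ordinal ν.
Proof. exact (ord_mem si_ord si_mem). Qed.

Lemma si_class : index_class (eq ν).
Proof. exact (index_class_ordinal si_ordν si_inf). Qed.

Lemma si_omega : omega ∈ κ.
Proof. exact (ord_sub_mem ord_omega si_ord si_inf si_mem). Qed.

Lemma in_Pk A x : x ∈ Pk κ A <-> x ⊆ A /\ card_lt x κ.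
Proof. apply (@in_setof V (power A)). intros y [H _]. apply in_power; auto. Qed.

Lemma in_Pk_small A x : x ∈ Pk κ A <-> x ⊆ A /\ small (eq ν) (fun z => z ∈ x).
Proof. rewrite in_Pk, si_card. reflexivity. Qed.

Lemma Pk_sub A x : x ∈ Pk κ A -> x ⊆ A.
Proof. rewrite in_Pk. tauto. Qed.

Lemma small_index (ξ : V) : ξ ∈ κ -> small (eq ν) (fun z => z ∈ ξ).
Proof. intros H. apply si_card. exists ξ. split; auto using equinumerous_refl. Qed.

Lemma Pk_mono A B x : A ⊆ B -> x ∈ Pk κ A -> x ∈ Pk κ B.
Proof. rewrite !in_Pk. intros H [H1 H2]. split; eauto using sub_trans. Qed.

Lemma Pk_cap A B x : x ∈ Pk κ B -> cap x A ∈ Pk κ A.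
Proof.
  rewrite !in_Pk_small. intros [H1 H2]. split.
  - intros z Hz. apply in_cap in Hz. tauto.
  - eapply small_sub; eauto. intros z Hz. apply in_cap in Hz. tauto.
Qed.

Lemma Pk_cup A x y : x ∈ Pk κ A -> y ∈ Pk κ A -> cup x y ∈ Pk κ A.
Proof.
  rewrite !in_Pk_small. intros [H1 H2] [H3 H4]. split.
  - intros z Hz. apply in_cup in Hz. destruct Hz; auto.
  - apply small_sub with (N := fun z => z ∈ x \/ z ∈ y).
    + apply small_or; auto using si_class, zfc_inhabited.
    + intros z Hz. apply in_cup; auto.
Qed.

Definition single (a : V) : V := upair a a.

Lemma in_single (a z : V) : z ∈ single a <-> z = a.
Proof. unfold single. rewrite in_upair. tauto. Qed.

Lemma Pk_single A (a : V) : a ∈ A -> single a ∈ Pk κ A.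
Proof.
  intros Ha. rewrite in_Pk_small. split.
  - intros z Hz. apply in_single in Hz. subst; auto.
  - exists ν, (fun _ => a). split; auto. intros m Hm. apply in_single in Hm.
    exists (num 0). split; auto. apply si_inf, num_in_omega.
Qed.

Lemma Pk_iunion A (ξ : V) (s : V -> V) : ξ ∈ κ -> (forall i, i ∈ ξ -> s i ∈ Pk κ A) ->
  ⦃ z | exists i, i ∈ ξ /\ z ∈ s i ⦄ ∈ Pk κ A.
Proof.
  intros Hξ Hs. rewrite in_Pk_small. split.
  - intros z Hz. apply in_iunion in Hz. destruct Hz as [i [Hi Hz]]. exact (Pk_sub (Hs i Hi) Hz).
  - apply small_sub with (N := fun z => exists i, i ∈ ξ /\ z ∈ s i).
    + apply small_union; auto using si_class, zfc_inhabited, small_index.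
      intros i Hi. specialize (Hs i Hi). apply in_Pk_small in Hs. tauto.
    + intros z Hz. apply in_iunion in Hz; auto.
Qed.

Definition nunion (s : nat -> V) : V := ⦃ z | exists n, z ∈ s n ⦄.

Lemma nunion_index : exists f : V -> nat, forall n, f (num n) = n.
Proof.
  destruct (@choose_fun_on V nat (fun v => v ∈ omega) (fun v n => v = num n)) as [f Hf].
  - exact (inhabits 0).
  - intros v Hv. apply in_omega in Hv. exact Hv.
  - exists f. intros n. symmetry. apply (@num_inj V). apply Hf, num_in_omega.
Qed.

Lemma nunion_omega (s : nat -> V) (f : V -> nat) : (forall n, f (num n) = n) ->
  ⦃ z | exists i, i ∈ omega /\ z ∈ s (f i) ⦄ = nunion s /\
  forall z, z ∈ nunion s <-> exists n, z ∈ s n.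
Proof.
  intros Hf.
  assert (H : forall z, z ∈ ⦃ z | exists i, i ∈ omega /\ z ∈ s (f i) ⦄ <-> exists n, z ∈ s n).
  { intros z. rewrite (in_iunion omega (fun i => s (f i))). split.
    - intros [i [_ Hz]]; eauto.
    - intros [n Hz]. exists (num n). rewrite Hf. split; auto. apply num_in_omega. }
  assert (H' : forall z, z ∈ nunion s <-> exists n, z ∈ s n).
  { apply setof_spec. eexists. exact H. }
  split; auto. apply set_ext; intros z. rewrite H, H'. tauto.
Qed.

Lemma in_nunion (s : nat -> V) z : z ∈ nunion s <-> exists n, z ∈ s n.
Proof. destruct nunion_index as [f Hf]. apply (nunion_omega s Hf). Qed.

Lemma Pk_nunion A (s : nat -> V) : (forall n, s n ∈ Pk κ A) -> nunion s ∈ Pk κ A.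
Proof.
  intros Hs. destruct nunion_index as [f Hf]. rewrite <- (proj1 (nunion_omega s Hf)).
  apply (@Pk_iunion A omega (fun i => s (f i))); auto using si_omega.
Qed.

(** * The club filter and its normality *)

Definition clubP A (C : V -> Prop) : Prop :=
  (forall x, C x -> x ∈ Pk κ A) /\
  (forall x, x ∈ Pk κ A -> exists y, C y /\ x ⊆ y) /\
  (forall (ξ : V) (s : V -> V), ξ ∈ κ -> (exists i, i ∈ ξ) ->
    (forall i, i ∈ ξ -> C (s i)) -> (forall i j, j ∈ ξ -> i ∈ j -> s i ⊆ s j) ->
    C ⦃ z | exists i, i ∈ ξ /\ z ∈ s i ⦄).

(** The club filter, for predicates. Compared with clubs, weakening is free and no set has to be
    formed, so that a property can be stated directly as holding at club many points. *)
Definition clubF A (C : V -> Prop) : Prop := exists D, clubP A D /\ forall x, D x -> C x.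

Lemma clubP_clubF A C : clubP A C -> clubF A C.
Proof. intros H; exists C; auto. Qed.

Lemma clubF_mono A (C D : V -> Prop) : clubF A C -> (forall x, C x -> D x) -> clubF A D.
Proof. intros [E [H1 H2]] H. exists E; auto. Qed.

Lemma clubF_Pk A (C D : V -> Prop) : clubF A C -> (forall x, x ∈ Pk κ A -> C x -> D x) -> clubF A D.
Proof.
  intros [E [H1 H2]] H. exists E. split; auto. intros x Hx. apply H; auto. apply H1; auto.
Qed.

Lemma stationaryP A X : stationary κ A X <->
  X ⊆ Pk κ A /\ forall C, clubF A C -> exists x, x ∈ X /\ C x.
Proof.
  split; intros [H1 H2]; split; auto.
  - intros C [D [[D1 [D2 D3]] HD]].
    assert (E : forall x, x ∈ ⦃ x | D x ⦄ <-> D x) by (apply (@in_setof V (Pk κ A)); auto).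
    destruct (H2 ⦃ x | D x ⦄) as [x [Hx Hx']].
    + split; [|split].
      * intros x Hx. apply D1, E, Hx.
      * intros x Hx. destruct (D2 x Hx) as [y [Hy Hxy]]. exists y. rewrite E. auto.
      * intros ξ s Hξ Hn Hs Hm. apply E. apply D3; auto. intros i Hi. apply E; auto.
    + exists x. split; auto. apply HD, E, Hx'.
  - intros C HC. apply H2. exists (fun x => x ∈ C). split; auto.
Qed.

Lemma not_stationaryP A X : X ⊆ Pk κ A ->
  (~ stationary κ A X <-> clubF A (fun x => x ∉ X)).
Proof.
  intros HX. rewrite stationaryP. split.
  - intros N. apply NNPP. intros N'. apply N. split; auto. intros C HC.
    apply NNPP. intros N''. apply N'. eapply clubF_mono; eauto.

  - intros H [_ H']. destruct (H' _ H) as [x [H1 H2]]. auto.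
Qed.

(** The finitely many leaves of a tree appear at one index of an increasing chain. *)
Lemma over_chain (ξ : V) (Q : V -> V -> Prop) t : ordinal ξ ->
  (forall i j z, j ∈ ξ -> i ∈ j -> Q i z -> Q j z) ->
  over (fun z => exists i, i ∈ ξ /\ Q i z) t -> exists i, i ∈ ξ /\ over (Q i) t.
Proof.
  intros Oξ HQ. induction t as [a|s IHs u IHu]; simpl; intros H; auto.
  destruct IHs as [i [Hi Hs]]; [tauto|]. destruct IHu as [j [Hj Hu]]; [tauto|].
  destruct (ord_trichotomy (ord_mem Oξ Hi) (ord_mem Oξ Hj)) as [E|[E|E]].
  - exists j. split; auto. split; auto. apply over_impl with (2 := Hs). intros z; apply HQ; auto.
  - subst. eauto.
  - exists i. split; auto. split; auto. apply over_impl with (2 := Hu). intros z; apply HQ; auto.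
Qed.

Lemma over_nat (Q : nat -> V -> Prop) t : (forall n z, Q n z -> Q (S n) z) ->
  over (fun z => exists n, Q n z) t -> exists n, over (Q n) t.
Proof.
  intros HQ. assert (HQ' : forall n m z, n <= m -> Q n z -> Q m z).
  { intros n m z H. induction H; auto. }
  induction t as [a|s IHs u IHu]; simpl; intros H; auto.
  destruct IHs as [i Hs]; [tauto|]. destruct IHu as [j Hu]; [tauto|].
  exists (max i j). split; [apply over_impl with (2 := Hs)|apply over_impl with (2 := Hu)];
    intros z; apply HQ'; lia.
Qed.

Lemma clubP_nat A C (s : nat -> V) : clubP A C -> (forall n, C (s n)) ->
  (forall n, s n ⊆ s (S n)) -> C (nunion s).
Proof.
  intros [_ [_ HC]] Hs Hm. destruct nunion_index as [f Hf].
  rewrite <- (proj1 (nunion_omega s Hf)).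
  apply (HC omega (fun i => s (f i))); auto using si_omega.
  - exists (num 0). apply num_in_omega.
  - intros i j Hj Hi. apply in_omega in Hj. destruct Hj as [n ->].
    apply in_num in Hi. destruct Hi as [m [Hm' ->]]. rewrite !Hf.
    induction Hm' as [|n _ IH]; auto. exact (sub_trans IH (Hm n)).
Qed.

(** Closure asks for all terms of the chain to be in [C], which is known only from [i0] on.
    Replacing the earlier terms by [s i0] does not change the union. *)
Lemma chain_tail A C (ξ : V) (s : V -> V) (i0 : V) : clubP A C -> ξ ∈ κ -> i0 ∈ ξ ->
  (forall i j, j ∈ ξ -> i ∈ j -> s i ⊆ s j) -> (forall i, i ∈ ξ -> s i0 ⊆ s i -> C (s i)) ->
  C ⦃ z | exists i, i ∈ ξ /\ z ∈ s i ⦄.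
Proof.
  intros [_ [_ HC]] Hξ Hi0 Hm Hs. pose proof (ord_mem si_ord Hξ) as Oξ.
  set (s' := fun i => if excluded_middle_informative (i0 ∈ i) then s i else s i0).
  replace ⦃ z | exists i, i ∈ ξ /\ z ∈ s i ⦄ with ⦃ z | exists i, i ∈ ξ /\ z ∈ s' i ⦄.
  - apply HC; auto; [eauto| |].
    + intros i Hi. unfold s'. destruct (excluded_middle_informative (i0 ∈ i)); auto using sub_refl.
    + intros i j Hj Hij. unfold s'.
      destruct (excluded_middle_informative (i0 ∈ i)) as [H|H],
        (excluded_middle_informative (i0 ∈ j)) as [H'|H']; auto using sub_refl.
      exfalso. apply H'. exact (ord_mem_trans (ord_mem Oξ Hj) H Hij).
  - apply set_ext. intros z. rewrite !in_iunion. unfold s'. split; intros [i [Hi Hz]].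
    + destruct (excluded_middle_informative (i0 ∈ i)); eauto.
    + destruct (ord_trichotomy (ord_mem Oξ Hi) (ord_mem Oξ Hi0)) as [H|[H|H]].
      * exists i0. split; auto. destruct (excluded_middle_informative _); auto; apply (Hm i); auto.
      * subst. exists i0. split; auto. destruct (excluded_middle_informative _); auto.
      * exists i. split; auto. destruct (excluded_middle_informative _); tauto.
Qed.

(** Diagonal intersection over finite tuples. For unboundedness, ω steps add to the current set [w],
    for every tree [t] over [w], a member of [C t] that includes [w]. *)
Lemma clubP_diag A (C : tree V -> V -> Prop) :
  (forall t, over (fun z => z ∈ A) t -> clubP A (C t)) ->
  clubP A (fun x => x ∈ Pk κ A /\ forall t, over (fun z => z ∈ x) t -> C t x).
Proof.
  intros HC. split; [tauto|]. split.
  - intros x Hx.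
    destruct (@choose_fun_on (tree V * V) V
      (fun p => over (fun z => z ∈ A) (fst p) /\ snd p ∈ Pk κ A)
      (fun p y => C (fst p) y /\ snd p ⊆ y)) as [c Hc].
    { apply zfc_inhabited. }
    { intros [t w] [H1 H2]. simpl in *. destruct (HC t H1) as [_ [Hu _]]. auto. }
    set (step := fun w => ⦃ z | z ∈ w \/ exists t, over (fun z => z ∈ w) t /\ z ∈ c (t, w) ⦄).
    assert (Ov : forall w t, w ∈ Pk κ A -> over (fun z => z ∈ w) t -> over (fun z => z ∈ A) t).
    { intros w t Hw. apply over_impl. apply Pk_sub; auto. }
    assert (Hcp : forall w t, w ∈ Pk κ A -> over (fun z => z ∈ w) t -> c (t, w) ∈ Pk κ A).
    { intros w t Hw Ht. destruct (HC t (Ov _ _ Hw Ht)) as [Hp _]. apply Hp, (Hc (t, w)); simpl; eauto. }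
    assert (Hstep : forall w z, w ∈ Pk κ A ->
      (z ∈ step w <-> z ∈ w \/ exists t, over (fun z => z ∈ w) t /\ z ∈ c (t, w))).
    { intros w z Hw. apply (@in_setof V A). intros u [Hu|[t [Ht Hu]]].
      - exact (Pk_sub Hw Hu).
      - exact (Pk_sub (Hcp w t Hw Ht) Hu). }
    assert (Hsp : forall w, w ∈ Pk κ A -> step w ∈ Pk κ A).
    { intros w Hw. apply in_Pk_small. split.
      - intros u Hu. apply Hstep in Hu; auto. destruct Hu as [Hu|[t [Ht Hu]]].
        + exact (Pk_sub Hw Hu).
        + exact (Pk_sub (Hcp w t Hw Ht) Hu).
      - apply small_sub with (N := fun z => z ∈ w \/ exists t, over (fun z => z ∈ w) t /\ z ∈ c (t, w)).
        + assert (Sw : small (eq ν) (fun z => z ∈ w)) by (apply in_Pk_small in Hw; tauto).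
          apply small_or; auto using si_class, zfc_inhabited.
          apply small_union; auto using si_class, zfc_inhabited, small_tree.
          intros t Ht. specialize (Hcp w t Hw Ht). apply in_Pk_small in Hcp. tauto.
        + intros z Hz. apply Hstep; auto. }
    set (xs := fix xs n := match n with 0 => x | S n => step (xs n) end).
    assert (Hxs : forall n, xs n ∈ Pk κ A) by (induction n; simpl; auto).
    assert (Hm : forall n, xs n ⊆ xs (S n)) by (intros n z Hz; apply Hstep; auto).
    exists (nunion xs). split; [split|].
    + apply Pk_nunion; auto.
    + intros t Ht.
      destruct (@over_nat (fun n z => z ∈ xs n) t) as [n0 Hn0].
      { intros n z. apply Hm. }
      { apply over_impl with (2 := Ht). intros z. apply in_nunion. }
      assert (Htn : forall n, over (fun z => z ∈ xs (n + n0)) t).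
      { induction n; auto. apply over_impl with (2 := IHn). apply Hm. }
      (* [ys] interleaves with the tail of [xs] from the first step that contains [t]. Both have the
         same union, and the [ys] lie in [C t]. *)
      set (ys := fun n => c (t, xs (n + n0))).
      assert (HtA : over (fun z => z ∈ A) t) by eauto.
      assert (Hys : forall n, C t (ys n) /\ xs (n + n0) ⊆ ys n) by (intros n; apply (Hc (t, xs (n + n0))); simpl; auto).
      assert (Hyx : forall n, ys n ⊆ xs (S n + n0)).
      { intros n z Hz. apply Hstep; auto. right. exists t. split; auto. }
      replace (nunion xs) with (nunion ys).
      * apply clubP_nat with A; auto.
        -- intros n. apply Hys.
        -- intros n. exact (sub_trans (Hyx n) (proj2 (Hys (S n)))).
      * apply set_ext. intros z. rewrite !in_nunion. split; intros [n Hz].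
        -- exists (S n + n0). apply Hyx; auto.
        -- exists n. apply Hys. clear - Hz Hm. replace (n + n0) with (n0 + n) by lia.
           induction n0; simpl; auto. apply Hm. auto.
    + intros z Hz. apply in_nunion. exists 0. exact Hz.
  - intros ξ s Hξ Hn Hs Hm. split.
    + apply Pk_iunion; auto. apply Hs.
    + intros t Ht. pose proof (ord_mem si_ord Hξ) as Oξ.
      destruct (@over_chain ξ (fun i z => z ∈ s i) t Oξ) as [i0 [Hi0 Ht0]].
      { intros i j z Hj Hi. apply (Hm i j); auto. }
      { apply over_impl with (2 := Ht). intros z Hz. apply in_iunion in Hz; auto. }
      apply chain_tail with (A := A) (i0 := i0); auto.
      * apply HC. apply over_impl with (2 := Ht0). apply Pk_sub. apply Hs; auto.
      * intros i Hi Hsub. apply Hs; auto. apply over_impl with (2 := Ht0). auto.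
Qed.

Lemma clubF_diag A (C : tree V -> V -> Prop) :
  (forall t, over (fun z => z ∈ A) t -> clubF A (C t)) ->
  clubF A (fun x => forall t, over (fun z => z ∈ x) t -> C t x).
Proof.
  intros H.
  destruct (@choose_fun_on (tree V) (V -> Prop) (over (fun z => z ∈ A))
    (fun t D => clubP A D /\ forall x, D x -> C t x)) as [D HD]; auto.
  { exact (inhabits (fun _ => True)). }
  eexists. split.
  - apply (@clubP_diag A D). intros t Ht. apply HD; auto.
  - simpl. intros x [Hx Hx'] t Ht. apply HD; auto.
    apply over_impl with (2 := Ht). apply Pk_sub; auto.
Qed.

Fixpoint root (t : tree V) : V :=
  match t with leaf a => a | node s _ => root s end.

Lemma clubF_diag1 A (C : V -> V -> Prop) :
  (forall a, a ∈ A -> clubF A (C a)) -> clubF A (fun x => forall a, a ∈ x -> C a x).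
Proof.
  intros H. eapply clubF_mono.
  - apply (@clubF_diag A (fun t x => C (root t) x)). intros t Ht. apply H.
    induction t; simpl in *; tauto.
  - simpl. intros x Hx a Ha. exact (Hx (leaf a) Ha).
Qed.

Lemma clubF_sup A w : w ∈ Pk κ A -> clubF A (fun x => w ⊆ x).
Proof.
  intros Hw. exists (fun x => x ∈ Pk κ A /\ w ⊆ x). split; [|tauto]. split; [tauto|]. split.
  - intros x Hx. exists (cup w x). split; [split|].
    + apply Pk_cup; auto.
    + intros z Hz; apply in_cup; auto.
    + intros z Hz; apply in_cup; auto.
  - intros ξ s Hξ [i Hi] Hs Hm. split.
    + apply Pk_iunion; auto. apply Hs.
    + intros z Hz. apply in_iunion. exists i. split; auto. apply Hs; auto.
Qed.

Lemma clubF_in A (a : V) : a ∈ A -> clubF A (fun x => a ∈ x).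
Proof.
  intros Ha. eapply clubF_mono; [apply (clubF_sup (Pk_single Ha))|].
  simpl. intros x Hx. apply Hx, in_single; auto.
Qed.

(** A binary intersection is read off a diagonal one: the shape of the tree selects the club, and a
    single point of [x] supplies trees of both shapes. *)
Lemma clubF_and A (C D : V -> Prop) : (exists a, a ∈ A) ->
  clubF A C -> clubF A D -> clubF A (fun x => C x /\ D x).
Proof.
  intros [a Ha] [E [HE HEC]] [G [HG HGD]].
  exists (fun x => E x /\ G x). split; [|intros x [H1 H2]; auto].
  split; [intros x [H1 _]; apply HE; auto|]. split.
  2: { intros ξ s Hξ Hn Hs Hm. split; [apply HE|apply HG]; auto; apply Hs. }
  intros x Hx.
  destruct (@clubP_diag A (fun t y => match t with leaf _ => E y | _ => G y end)) as [_ [U _]].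
  { intros [b|s u] _; auto. }
  destruct (U (cup x (single a))) as [y [[Hy Hyt] Hxy]].
  { apply Pk_cup; auto using Pk_single. }
  assert (Hay : a ∈ y) by (apply Hxy, in_cup; right; apply in_single; auto).
  exists y. split.
  - split; [exact (Hyt (leaf a) Hay)|exact (Hyt (node (leaf a) (leaf a)) (conj Hay Hay))].
  - intros z Hz. apply Hxy, in_cup; auto.
Qed.

(** Combs over one point code the natural numbers, which turns diagonal intersections into countable
    ones in [clubF_all]. *)
Fixpoint comb (a : V) (n : nat) : tree V :=
  match n with 0 => leaf a | S n => node (leaf a) (comb a n) end.
Fixpoint right_depth (t : tree V) : nat :=
  match t with leaf _ => 0 | node _ u => S (right_depth u) end.

Lemma clubF_all A (C : nat -> V -> Prop) : (exists a, a ∈ A) ->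
  (forall n, clubF A (C n)) -> clubF A (fun x => forall n, C n x).
Proof.
  intros [a Ha] HC. eapply clubF_mono.
  - apply clubF_and; [eauto|apply (clubF_in Ha)|].
    apply (@clubF_diag A (fun t x => C (right_depth t) x)). auto.
  - simpl. intros x [Hax Hx] n.
    assert (E : right_depth (comb a n) = n) by (induction n; simpl; congruence).
    rewrite <- E. apply Hx. clear E. induction n; simpl; auto.
Qed.

Lemma clubF_closed A (Ψ : tree V -> V) :
  (forall t, over (fun z => z ∈ A) t -> Ψ t ∈ Pk κ A) ->
  clubF A (fun x => forall t, over (fun z => z ∈ x) t -> Ψ t ⊆ x).
Proof.
  intros H. apply (@clubF_diag A (fun t x => Ψ t ⊆ x)). intros t Ht. apply clubF_sup; auto.
Qed.

Lemma clubF_closed1 A (f : V -> V) :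
  (forall a, a ∈ A -> f a ∈ A) -> clubF A (fun x => forall a, a ∈ x -> f a ∈ x).
Proof.
  intros H. apply (@clubF_diag1 A (fun a x => f a ∈ x)). intros a Ha. apply clubF_in; auto.
Qed.

(** For unboundedness, the trace of [x] on [A] is enlarged to a member [y] of the club and added
    back; the new trace is exactly [y]. *)
Lemma clubF_lift A B C : A ⊆ B -> clubF A C -> clubF B (fun x => C (cap x A)).
Proof.
  intros HAB [D [[D1 [D2 D3]] HD]].
  exists (fun x => x ∈ Pk κ B /\ D (cap x A)). split; [|intros x [_ H]; auto].
  split; [tauto|]. split.
  - intros x Hx. destruct (D2 (cap x A) (Pk_cap A Hx)) as [y [Hy Hxy]].
    exists (cup x y). split; [split|].
    + apply Pk_cup; auto. apply (Pk_mono HAB); auto.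
    + replace (cap (cup x y) A) with y; auto.
      apply set_ext; intros z. rewrite in_cap, in_cup. split.
      * intros Hz. split; auto. exact (Pk_sub (D1 y Hy) Hz).
      * intros [[Hz|Hz] HzA]; auto. apply Hxy, in_cap; auto.
    + intros z Hz. apply in_cup; auto.
  - intros ξ s Hξ Hn Hs Hm. split.
    + apply Pk_iunion; auto. apply Hs.
    + replace (cap ⦃ z | exists i, i ∈ ξ /\ z ∈ s i ⦄ A)
        with ⦃ z | exists i, i ∈ ξ /\ z ∈ cap (s i) A ⦄.
      * apply D3; auto.
        -- intros i Hi. apply Hs; auto.
        -- intros i j Hj Hi z Hz. apply in_cap in Hz. apply in_cap. split; [|tauto].
           apply (Hm i j Hj Hi); tauto.
      * apply set_ext; intros z. rewrite in_cap, !in_iunion. split.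
        -- intros [i [Hi Hz]]. apply in_cap in Hz. destruct Hz; eauto.
        -- intros [[i [Hi Hz]] HzA]. exists i. rewrite in_cap. auto.
Qed.

(** * Clubs given by operations, lifting, and pressing down *)

Lemma countable_trees (y : V) (a : nat -> V) :
  (forall z, z ∈ y <-> exists n, z = a n) ->
  exists e : nat -> tree V, forall t, over (fun z => z ∈ y) t <-> exists n, t = e n.
Proof.
  intros Ha.
  assert (exists pr : nat * nat -> nat, forall p q, pr p = pr q -> p = q) as [pr inj].
  { exists Cantor.to_nat. intros p q E. rewrite <- (Cantor.cancel_of_to p), E.
    apply Cantor.cancel_of_to. }
  set (code := fix code (t : tree nat) := match t with
    | leaf n => pr (0, n)
    | node s u => pr (1, pr (code s, code u)) end).
  assert (cinj : forall s t, code s = code t -> s = t).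
  { induction s as [n|s1 IH1 s2 IH2]; intros [m|t1 t2] E; simpl in E; apply inj in E;
      try discriminate; injection E as E.
    - congruence.
    - apply inj in E. injection E as E1 E2. f_equal; auto. }
  destruct (@choose_fun_on nat (tree nat) (fun n => exists t, code t = n) (fun n t => code t = n)) as [d Hd].
  { exact (inhabits (leaf 0)). }
  { auto. }
  exists (fun n => tmap a (d n)). intros t. split.
  - intros Ht. assert (exists s, t = tmap a s) as [s ->].
    { induction t as [b|t1 IH1 t2 IH2]; simpl in Ht.
      - apply Ha in Ht. destruct Ht as [n ->]. exists (leaf n); auto.
      - destruct IH1 as [s1 ->]; [tauto|]. destruct IH2 as [s2 ->]; [tauto|].
        exists (node s1 s2); auto. }
    exists (code s). f_equal. symmetry. apply cinj. apply Hd. eauto.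
  - intros [n ->]. apply over_tmap. generalize (d n). induction t; simpl; auto.
    apply Ha; eauto.
Qed.

(* [F] maps trees monotonically into the club; by induction on [θ], the union of [F]
   over the trees with leaves in [{a j | j < θ}] is in the club. *)
Lemma club_operation A C : clubP A C -> exists F : tree V -> V,
  (forall t, over (fun z => z ∈ A) t -> F t ∈ Pk κ A) /\
  forall y, y ∈ Pk κ A -> (exists a, a ∈ y) ->
    (forall t, over (fun z => z ∈ y) t -> F t ⊆ y) -> C y.
Proof.
  intros HC. pose proof HC as [C1 [C2 C3]].
  destruct (@choose_fun_on V V (fun x => x ∈ Pk κ A) (fun x y => C y /\ x ⊆ y)) as [c Hc];
    auto using zfc_inhabited.
  set (F := fix F t := match t with leaf a => c (single a) | node s u => c (cup (F s) (F u)) end).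
  assert (HF : forall t, over (fun z => z ∈ A) t -> C (F t) /\ F t ∈ Pk κ A).
  { induction t as [a|s IHs u IHu]; simpl; intros Ht.
    - destruct (Hc (single a)) as [H _]; auto using Pk_single.
    - destruct (Hc (cup (F s) (F u))) as [H _]; auto. apply Pk_cup; [apply IHs|apply IHu]; tauto. }
  assert (HFn : forall s u, over (fun z => z ∈ A) (node s u) -> F s ⊆ F (node s u) /\ F u ⊆ F (node s u)).
  { intros s u [Hs Hu]. destruct (Hc (cup (F s) (F u))) as [_ H].
    - apply Pk_cup; apply HF; auto.
    - simpl. split; intros z Hz; apply H, in_cup; auto. }
  exists F. split; [intros t Ht; apply HF; auto|].
  set (U := fun y => ⦃ z | exists t, over (fun z => z ∈ y) t /\ z ∈ F t ⦄).
  assert (HU : forall y, y ⊆ A -> forall z, z ∈ U y <-> exists t, over (fun z => z ∈ y) t /\ z ∈ F t).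
  { intros y Hy. apply (@in_setof V A). intros z [t [Ht Hz]].
    assert (HtA : over (fun z => z ∈ A) t) by (apply over_impl with (2 := Ht); auto).
    exact (Pk_sub (proj2 (HF t HtA)) Hz). }
  assert (Main : forall θ, θ ∈ κ -> (exists i, i ∈ θ) -> forall a : V -> V, (forall j, j ∈ θ -> a j ∈ A) ->
    C (U ⦃ z | exists j, j ∈ θ /\ z = a j ⦄)).
  { induction θ as [θ IH] using (well_founded_ind (@foundation V)). intros Hθ [i0 Hi0] a Ha.
    pose proof (ord_mem si_ord Hθ) as Oθ.
    set (y := ⦃ z | exists j, j ∈ θ /\ z = a j ⦄).
    assert (Hy : forall z, z ∈ y <-> exists j, j ∈ θ /\ z = a j) by (intros z; apply in_image).
    assert (HyA : y ⊆ A). { intros z Hz. apply Hy in Hz. destruct Hz as [j [Hj ->]]; auto. }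
    destruct (classic (θ ⊆ omega)) as [Hfin|Hinf].
    - (* countable: the left combs of an enumeration of the trees form a cofinal chain *)
      set (a' := fun n => if excluded_middle_informative (num n ∈ θ) then a (num n) else a i0).
      destruct (@countable_trees y a') as [e He].
      { intros z. rewrite Hy. split.
        - intros [j [Hj ->]]. pose proof (Hfin j Hj) as Hj'. apply in_omega in Hj'. destruct Hj' as [n ->].
          exists n. unfold a'. destruct (excluded_middle_informative _); tauto.
        - intros [n ->]. unfold a'. destruct (excluded_middle_informative _); eauto. }
      set (w := fix w n := match n with 0 => e 0 | S n => node (w n) (e (S n)) end).
      assert (Hw : forall n, over (fun z => z ∈ y) (w n)).
      { induction n; simpl; [apply He; eauto|split; auto; apply He; eauto]. }
      assert (HwA : forall n, over (fun z => z ∈ A) (w n)).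
      { intros n. apply over_impl with (2 := Hw n). auto. }
      replace (U y) with (nunion (fun n => F (w n))).
      + apply clubP_nat with A; auto.
        * intros n. apply HF; auto.
        * intros n. apply (@HFn (w n) (e (S n))). apply (HwA (S n)).
      + apply set_ext. intros z. rewrite in_nunion, HU by auto. split.
        * intros [n Hz]. eauto.
        * intros [t [Ht Hz]]. apply He in Ht. destruct Ht as [n ->]. exists n.
          destruct n as [|n]; auto. apply (@HFn (w n) (e (S n))); auto. apply (HwA (S n)).
    - assert (Hωθ : omega ∈ θ).
      { destruct (ord_sub_or_mem Oθ ord_omega); tauto. }
      destruct (classic (exists m, m ∈ θ /\ succ m ∉ θ)) as [[m [Hm Hsm]]|Hlim].
      + (* [θ = succ m] is re-indexed by [m] *)
        assert (Eθ : θ = succ m).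
        { apply sub_antisym.
          - destruct (ord_sub_or_mem Oθ (ord_succ (ord_mem Oθ Hm))); tauto.
          - intros z Hz. apply in_succ in Hz. destruct Hz as [Hz| ->]; auto.
            exact (ord_mem_trans Oθ Hz Hm). }
        assert (Hωm : omega ⊆ m).
        { rewrite Eθ in Hωθ. apply in_succ in Hωθ. destruct Hωθ as [H| <-]; [|apply sub_refl].
          exact (ord_trans (ord_mem Oθ Hm) H). }
        destruct (shift_inj (ord_mem Oθ Hm) Hωm) as [f [F1 F2]]. rewrite <- Eθ in F1, F2.
        destruct (@choose_fun_on V V (fun k => k ∈ m)
          (fun k j => j ∈ θ /\ forall j', j' ∈ θ -> f j' = k -> j' = j)) as [g Hg].
        { apply zfc_inhabited. }
        { intros k Hk. destruct (classic (exists j, j ∈ θ /\ f j = k)) as [[j [Hj Ej]]|N].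
          - exists j. split; auto. intros j' Hj' E. apply F2; auto. congruence.
          - exists i0. split; auto. intros j' Hj' E. exfalso. eauto. }
        assert (E : y = ⦃ z | exists k, k ∈ m /\ z = a (g k) ⦄).
        { apply set_ext. intros z. rewrite Hy, (in_image m (fun k => a (g k))). split.
          - intros [j [Hj ->]]. exists (f j). split; auto. f_equal. apply Hg; auto.
          - intros [k [Hk ->]]. exists (g k). split; auto. apply Hg; auto. }
        rewrite E. apply (IH m Hm (ord_mem_trans si_ord Hm Hθ)) with (a := fun k => a (g k)).
        * exists (num 0). apply Hωm, num_in_omega.
        * intros k Hk. apply Ha. apply Hg; auto.
      + assert (Hs : forall m, m ∈ θ -> succ m ∈ θ).
        { intros m Hm. apply NNPP. intros N. apply Hlim; eauto. }
        (* [succ i] rather than [i], so that the initial segment is nonempty for [i] = 0 as well. *)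
        set (Y := fun i => ⦃ z | exists j, j ∈ succ i /\ z = a j ⦄).
        assert (HY : forall i z, z ∈ Y i <-> exists j, j ∈ succ i /\ z = a j) by (intros i z; apply in_image).
        assert (HYA : forall i, i ∈ θ -> Y i ⊆ A).
        { intros i Hi z Hz. apply HY in Hz. destruct Hz as [j [Hj ->]]. apply Ha.
          exact (ord_mem_trans Oθ Hj (Hs i Hi)). }
        assert (HYm : forall i j, j ∈ θ -> i ∈ j -> Y i ⊆ Y j).
        { intros i j Hj Hi z Hz. apply HY in Hz. destruct Hz as [k [Hk ->]]. apply HY. exists k. split; auto.
          apply in_succ. left. apply in_succ in Hk. destruct Hk as [Hk| ->]; auto.
          exact (ord_mem_trans (ord_mem Oθ Hj) Hk Hi). }
        replace (U y) with ⦃ z | exists i, i ∈ θ /\ z ∈ U (Y i) ⦄.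
        * apply C3; eauto.
          -- intros i Hi. apply (IH (succ i) (Hs i Hi) (ord_mem_trans si_ord (Hs i Hi) Hθ)).
             ++ exists i. apply succ_self.
             ++ intros j Hj. apply Ha. exact (ord_mem_trans Oθ Hj (Hs i Hi)).
          -- intros i j Hj Hi z Hz. apply HU; [auto|]. apply HU in Hz.
             ++ destruct Hz as [t [Ht Hz]]. exists t. split; auto. apply over_impl with (2 := Ht).
                apply HYm; auto.
             ++ apply HYA. exact (ord_mem_trans Oθ Hi Hj).
        * apply set_ext. intros z. rewrite in_iunion, HU by auto. split.
          -- intros [i [Hi Hz]]. apply HU in Hz; auto. destruct Hz as [t [Ht Hz]]. exists t. split; auto.
             apply over_impl with (2 := Ht). intros v Hv. apply HY in Hv. destruct Hv as [j [Hj ->]].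
             apply Hy. exists j. split; auto. exact (ord_mem_trans Oθ Hj (Hs i Hi)).
          -- intros [t [Ht Hz]].
             destruct (@over_chain θ (fun i z => z ∈ Y i) t Oθ) as [i [Hi Hti]].
             ++ intros i j v Hj Hi. apply HYm; auto.
             ++ apply over_impl with (2 := Ht). intros v Hv. apply Hy in Hv. destruct Hv as [j [Hj ->]].
                exists j. split; auto. apply HY. exists j. split; auto using succ_self.
             ++ exists i. split; auto. apply HU; eauto. }
  intros y Hy [a0 Ha0] Hcl.
  pose proof Hy as Hy'. apply in_Pk_small in Hy'. destruct Hy' as [HyA [k [f [<- Hf]]]].
  (* The covering [f] may leave [y]; sending those indices to [a0] gives an enumeration whose range
     is exactly [y]. *)
  set (a := fun i => if excluded_middle_informative (f i ∈ y) then f i else a0).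
  assert (Haz : forall i, a i ∈ y) by (intros i; unfold a; destruct (excluded_middle_informative _); auto).
  assert (E : y = ⦃ z | exists j, j ∈ ν /\ z = a j ⦄).
  { apply set_ext. intros z. rewrite in_image. split.
    - intros Hz. destruct (Hf z Hz) as [v [Hv ->]]. exists v. split; auto. unfold a.
      destruct (excluded_middle_informative _); tauto.
    - intros [j [_ ->]]. auto. }
  assert (E' : U y = y).
  { apply sub_antisym; intros z Hz.
    - apply HU in Hz; auto. destruct Hz as [t [Ht Hz]]. exact (Hcl t Ht z Hz).
    - apply HU; auto. exists (leaf z). split; auto. simpl.
      destruct (Hc (single z)) as [_ H]; [apply Pk_single; auto|]. apply H, in_single; auto. }
  rewrite <- E', E. apply Main; auto using si_mem.
  exists (num 0). apply si_inf, num_in_omega.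
Qed.

Lemma clo_mono F (M N : V -> Prop) z : (forall z, M z -> N z) -> clo F M z -> clo F N z.
Proof.
  intros H [n Hn]. exists n. revert z Hn. induction n as [|n IH]; simpl; auto.
  intros z [Hz|[t [Ht Hz]]]; auto. right. exists t. split; auto. apply over_impl with (2 := Ht); auto.
Qed.

Lemma clo_idem F (M : V -> Prop) z : clo F (clo F M) z -> clo F M z.
Proof.
  apply clo_sub; auto. intros t Ht z' Hz. exact (clo_step Ht Hz).
Qed.

(* The points [x] with [clo F x ∩ A = x] form a club of [P_κ(A)]. *)
Lemma stationary_lift A B X C : (exists a, a ∈ A) -> A ⊆ B -> stationary κ A X -> clubF B C ->
  exists x, x ∈ Pk κ B /\ cap x A ∈ X /\ C x.
Proof.
  intros [a0 Ha0] HAB HX [D [HD HDC]].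
  destruct (club_operation HD) as [F [HF1 HF2]].
  assert (Hclo : forall x, x ∈ Pk κ A -> exists y, y ∈ Pk κ B /\ forall z, z ∈ y <-> clo F (fun z => z ∈ x) z).
  { intros x Hx. set (y := ⦃ z | clo F (fun z => z ∈ x) z ⦄).
    assert (HB : forall z, clo F (fun z => z ∈ x) z -> z ∈ B).
    { apply clo_sub.
      - intros z Hz. apply HAB, (Pk_sub Hx Hz).
      - intros t Ht z Hz. exact (Pk_sub (HF1 t Ht) Hz). }
    assert (Hy : forall z, z ∈ y <-> clo F (fun z => z ∈ x) z) by (apply (@in_setof V B); auto).
    exists y. split; auto. apply in_Pk_small. split.
    - intros z Hz. apply HB, Hy, Hz.
    - apply small_sub with (N := clo F (fun z => z ∈ x)); [|intros m; apply Hy].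
      apply small_clo with (B := fun z => z ∈ B); auto using si_class.
      + intros z Hz. apply HAB, (Pk_sub Hx Hz).
      + intros t Ht z Hz. exact (Pk_sub (HF1 t Ht) Hz).
      + intros t Ht. specialize (HF1 t Ht). apply in_Pk_small in HF1. tauto.
      + apply in_Pk_small in Hx. tauto. }
  assert (HE : clubP A (fun x => x ∈ Pk κ A /\ (exists a, a ∈ x) /\
    forall z, clo F (fun z => z ∈ x) z -> z ∈ A -> z ∈ x)).
  { split; [tauto|]. split.
    (* [a0] is added because [club_operation] speaks only of nonempty closed sets. *)
    - intros x Hx. set (x1 := cup x (single a0)).
      assert (Hx1 : x1 ∈ Pk κ A) by (apply Pk_cup; auto using Pk_single).
      destruct (Hclo x1 Hx1) as [y [Hy Hyz]].
      assert (Hxy : x1 ⊆ cap y A).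
      { intros z Hz. apply in_cap. split; [apply Hyz, clo_base; auto|exact (Pk_sub Hx1 Hz)]. }
      exists (cap y A). split; [split; [|split]|].
      + apply (Pk_cap A Hy).
      + exists a0. apply Hxy, in_cup. right. apply in_single; auto.
      + intros z Hz HzA. apply in_cap. split; auto. apply Hyz, clo_idem.
        apply clo_mono with (2 := Hz). intros v Hv. apply in_cap in Hv. apply Hyz; tauto.
      + intros z Hz. apply Hxy, in_cup; auto.
    - intros ξ s Hξ [i0 Hi0] Hs Hm. pose proof (ord_mem si_ord Hξ) as Oξ. split; [|split].
      + apply Pk_iunion; auto. intros i Hi. apply Hs; auto.
      + destruct (Hs i0 Hi0) as [_ [[a Ha] _]]. exists a. apply in_iunion; eauto.
      + intros z Hz HzA. apply in_iunion.
        assert (exists i, i ∈ ξ /\ clo F (fun z => z ∈ s i) z) as [i [Hi Hzi]].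
        { clear HzA. revert z Hz. apply clo_sub.
          - intros z Hz. apply in_iunion in Hz. destruct Hz as [i [Hi Hz]]. exists i. split; auto.
            apply clo_base; auto.
          - intros t Ht z Hz. apply over_chain in Ht; auto.
            + destruct Ht as [i [Hi Ht]]. exists i. split; auto. exact (clo_step Ht Hz).
            + intros i j v Hj Hi. apply clo_mono. intros u. apply (Hm i j); auto. }
        exists i. split; auto. apply Hs; auto. }
  apply stationaryP in HX. destruct HX as [HX1 HX2].
  destruct (HX2 _ (clubP_clubF HE)) as [x [Hx [HxP [[a Ha] Hxc]]]].
  destruct (Hclo x HxP) as [y [Hy Hyz]].
  exists y. split; auto. split.
  - replace (cap y A) with x; auto. apply set_ext. intros z. rewrite in_cap, Hyz. split.
    + intros Hz. split; [apply clo_base; auto|exact (Pk_sub HxP Hz)].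
    + intros [H1 H2]; auto.
  - apply HDC, HF2; auto.
    + exists a. apply Hyz, clo_base; auto.
    + intros t Ht z Hz. apply Hyz. apply clo_step with t; auto.
      apply over_impl with (2 := Ht). intros v; apply Hyz.
Qed.

(** Otherwise each [d] has a club avoiding its piece of [T], and [T] meets the diagonal intersection
    of these clubs. *)
Lemma fodor A T (R : V -> V -> Prop) : stationary κ A T ->
  (forall x, x ∈ T -> exists d, d ∈ x /\ R d x) ->
  exists d, d ∈ A /\ stationary κ A ⦃ x | x ∈ T /\ d ∈ x /\ R d x ⦄.
Proof.
  intros HT HR. apply stationaryP in HT. destruct HT as [HT1 HT2].
  apply NNPP. intros N.
  assert (HC : clubF A (fun x => forall d, d ∈ x -> x ∉ ⦃ x | x ∈ T /\ d ∈ x /\ R d x ⦄)).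
  { apply (@clubF_diag1 A (fun d x => x ∉ ⦃ x | x ∈ T /\ d ∈ x /\ R d x ⦄)).
    intros d Hd. apply not_stationaryP.
    - intros x Hx. apply in_sep in Hx. apply HT1; tauto.
    - intros H. apply N; eauto. }
  destruct (HT2 _ HC) as [x [Hx Hxd]]. destruct (HR x Hx) as [d [Hd Hr]].
  apply (Hxd d Hd). apply in_sep. auto.
Qed.

End Clubs.

(** * Forcing *)

Class preorder_on {V : zfc} (P : V) (le : V -> V -> Prop) : Prop := {
  po_refl : forall p, p ∈ P -> le p p;
  po_trans : forall p q r, p ∈ P -> q ∈ P -> r ∈ P -> le p q -> le q r -> le p r
}.

Section Forcing.
Context {V : zfc} {P : V} {le : V -> V -> Prop} {HP : preorder_on P le}.
Implicit Types p q r : V.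
Implicit Types σ τ u v : name V.

Local Notation "p ⊩ f" := (forces P le p f) (at level 70).
Local Notation dns := (densely P le).

Lemma le_refl p : p ∈ P -> le p p.
Proof. apply po_refl. Qed.

Lemma le_trans p q r : p ∈ P -> q ∈ P -> r ∈ P -> le p q -> le q r -> le p r.
Proof. apply po_trans. Qed.

Lemma densely_mono p q (F : V -> Prop) : p ∈ P -> q ∈ P -> le q p -> dns p F -> dns q F.
Proof. intros Hp Hq Hqp H r Hr Hrq. apply H; auto. exact (le_trans Hr Hq Hp Hrq Hqp). Qed.

Lemma densely_impl p (F G : V -> Prop) :
  p ∈ P -> dns p F -> (forall r, r ∈ P -> le r p -> F r -> G r) -> dns p G.
Proof.
  intros Hp H HFG q Hq Hqp. destruct (H q Hq Hqp) as [r [Hr [Hrq HF]]].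
  exists r. split; auto. split; auto. apply HFG; auto. exact (le_trans Hr Hq Hp Hrq Hqp).
Qed.

Lemma densely_idem p (F : V -> Prop) : p ∈ P -> dns p (fun q => dns q F) -> dns p F.
Proof.
  intros Hp H q Hq Hqp. destruct (H q Hq Hqp) as [r [Hr [Hrq HF]]].
  destruct (HF r Hr (le_refl Hr)) as [s [Hs [Hsr HFs]]].
  exists s. split; auto. split; auto. exact (le_trans Hs Hr Hq Hsr Hrq).
Qed.

Lemma densely_here p (F : V -> Prop) : p ∈ P ->
  (forall r, r ∈ P -> le r p -> F r) -> dns p F.
Proof. intros Hp H q Hq Hqp. exists q. auto using le_refl. Qed.

Lemma eq_mono τ τ' p q : p ∈ P -> q ∈ P -> le q p ->
  forces_eq P le τ τ' p -> forces_eq P le τ τ' q.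
Proof.
  intros Hp Hq Hqp. destruct τ as [D σ A], τ' as [D' σ' A']. simpl. intros [H1 H2].
  split; intros i a r Ha HA Hr Hrq Hra; [apply (H1 i a r) | apply (H2 i a r)]; auto;
    exact (le_trans Hr Hq Hp Hrq Hqp).
Qed.

Lemma eq_refl_name τ p : p ∈ P -> forces_eq P le τ τ p.
Proof.
  revert p. induction τ as [D σ IH A]. intros p Hp. simpl.
  split; intros i a q Ha HA Hq Hqp Hqa; apply densely_here; auto;
    intros r Hr Hrq; exists i, a; repeat split; auto; exact (le_trans Hr Hq Ha Hrq Hqa).
Qed.

Lemma eq_sym_name τ τ' p : forces_eq P le τ τ' p -> forces_eq P le τ' τ p.
Proof.
  revert τ' p. induction τ as [D σ IH A]. intros [D' σ' A'] p. simpl. intros [H1 H2].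
  split.
  - intros j b q Hb HA Hq Hqp Hqb s Hs Hsq.
    destruct (H2 j b q Hb HA Hq Hqp Hqb s Hs Hsq) as [r [Hr [Hrs [i [a [? [? [? ?]]]]]]]].
    exists r. repeat split; auto. exists i, a. auto.
  - intros i a q Ha HA Hq Hqp Hqa s Hs Hsq.
    destruct (H1 i a q Ha HA Hq Hqp Hqa s Hs Hsq) as [r [Hr [Hrs [j [b [? [? [? ?]]]]]]]].
    exists r. repeat split; auto. exists j, b. auto.
Qed.

Lemma eq_trans_name τ τ' τ'' p : p ∈ P ->
  forces_eq P le τ τ' p -> forces_eq P le τ' τ'' p -> forces_eq P le τ τ'' p.
Proof.
  revert τ' τ'' p. induction τ as [D σ IH A]. intros [D' σ' A'] [D'' σ'' A''] p Hp.
  simpl. intros [H1 H2] [H3 H4]. split.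
  - intros i a q Ha HA Hq Hqp Hqa s Hs Hsq.
    destruct (H1 i a q Ha HA Hq Hqp Hqa s Hs Hsq) as [r [Hr [Hrs [j [b [Hb [HA' [Hrb E1]]]]]]]].
    assert (Hrp : le r p) by exact (le_trans Hr Hs Hp Hrs (le_trans Hs Hq Hp Hsq Hqp)).
    destruct (H3 j b r Hb HA' Hr Hrp Hrb r Hr (le_refl Hr)) as [t [Ht [Htr [k [c [Hc [HA'' [Htc E2]]]]]]]].
    exists t. split; auto. split; [exact (le_trans Ht Hr Hs Htr Hrs)|]. exists k, c. repeat split; auto.
    apply (IH i) with (σ' j); auto. exact (eq_mono Hr Ht Htr E1).
  - intros k c q Hc HA Hq Hqp Hqc s Hs Hsq.
    destruct (H4 k c q Hc HA Hq Hqp Hqc s Hs Hsq) as [r [Hr [Hrs [j [b [Hb [HA' [Hrb E1]]]]]]]].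
    assert (Hrp : le r p) by exact (le_trans Hr Hs Hp Hrs (le_trans Hs Hq Hp Hsq Hqp)).
    destruct (H2 j b r Hb HA' Hr Hrp Hrb r Hr (le_refl Hr)) as [t [Ht [Htr [i [a [Ha [HA'' [Hta E2]]]]]]]].
    exists t. split; auto. split; [exact (le_trans Ht Hr Hs Htr Hrs)|]. exists i, a. repeat split; auto.
    apply (IH i) with (σ' j); auto. exact (eq_mono Hr Ht Htr E1).
Qed.

Lemma eq_dense τ τ' p : p ∈ P -> dns p (forces_eq P le τ τ') -> forces_eq P le τ τ' p.
Proof.
  intros Hp. destruct τ as [D σ A], τ' as [D' σ' A']. intros H. split.
  - intros i a q Ha HA Hq Hqp Hqa s Hs Hsq.
    destruct (H s Hs) as [r [Hr [Hrs [H1 _]]]];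
      [exact (le_trans Hs Hq Hp Hsq Hqp)|].
    assert (Hra : le r a) by exact (le_trans Hr Hs Ha Hrs (le_trans Hs Hq Ha Hsq Hqa)).
    destruct (H1 i a r Ha HA Hr (le_refl Hr) Hra r Hr (le_refl Hr)) as [t [Ht [Htr HF]]].
    exists t. split; auto. split; auto. exact (le_trans Ht Hr Hs Htr Hrs).
  - intros i a q Ha HA Hq Hqp Hqa s Hs Hsq.
    destruct (H s Hs) as [r [Hr [Hrs [_ H1]]]];
      [exact (le_trans Hs Hq Hp Hsq Hqp)|].
    assert (Hra : le r a) by exact (le_trans Hr Hs Ha Hrs (le_trans Hs Hq Ha Hsq Hqa)).
    destruct (H1 i a r Ha HA Hr (le_refl Hr) Hra r Hr (le_refl Hr)) as [t [Ht [Htr HF]]].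
    exists t. split; auto. split; auto. exact (le_trans Ht Hr Hs Htr Hrs).
Qed.

Lemma mem_mono σ τ p q : p ∈ P -> q ∈ P -> le q p ->
  forces_mem P le σ τ p -> forces_mem P le σ τ q.
Proof. destruct τ. apply densely_mono. Qed.

Lemma mem_eq_l σ σ' τ p : p ∈ P ->
  forces_eq P le σ σ' p -> forces_mem P le σ τ p -> forces_mem P le σ' τ p.
Proof.
  intros Hp E. destruct τ as [D s A]. simpl. intros H. apply densely_impl with (2 := H); auto.
  intros r Hr Hrp [j [b [Hb [HA [Hrb E']]]]]. exists j, b. repeat split; auto.
  apply eq_trans_name with σ; auto. apply eq_sym_name. exact (eq_mono Hp Hr Hrp E).
Qed.

Lemma mem_eq_r σ τ τ' p : p ∈ P ->
  forces_eq P le τ τ' p -> forces_mem P le σ τ p -> forces_mem P le σ τ' p.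
Proof.
  intros Hp E. destruct τ as [D s A], τ' as [D' s' A']. simpl in *. destruct E as [E _].
  intros H. apply densely_idem; auto. apply densely_impl with (2 := H); auto.
  intros r Hr Hrp [j [b [Hb [HA [Hrb E']]]]].
  specialize (E j b r Hb HA Hr Hrp Hrb). apply densely_impl with (2 := E); auto.
  intros t Ht Htr [k [c [Hc [HA' [Htc E'']]]]]. exists k, c. repeat split; auto.
  apply eq_trans_name with (s j); auto. exact (eq_mono Hr Ht Htr E').
Qed.

Lemma forces_mono p q f : p ∈ P -> q ∈ P -> le q p -> p ⊩ f -> q ⊩ f.
Proof.
  revert p q. induction f; intros p q Hp Hq Hqp; simpl.
  - apply mem_mono; auto.
  - apply eq_mono; auto.
  - apply densely_mono; auto.
  - intros H r Hr Hrq. apply H; auto. exact (le_trans Hr Hq Hp Hrq Hqp).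
  - intros [H1 H2]. split; eauto.
  - apply densely_mono; auto.
  - intros H r Hr Hrq. apply H; auto. exact (le_trans Hr Hq Hp Hrq Hqp).
  - intros H0 x. eauto.
  - apply densely_mono; auto.
Qed.

(** This is what allows a proof to pass to densely many stronger conditions that have fixed a
    witness or a ground model value. *)
Lemma forces_dense p f : p ∈ P -> dns p (fun q => q ⊩ f) -> p ⊩ f.
Proof.
  revert p. induction f; intros p Hp; simpl.
  - destruct d0. apply densely_idem; auto.
  - apply eq_dense; auto.
  - apply densely_idem; auto.
  - intros H q Hq Hqp Hf. destruct (H q Hq Hqp) as [r [Hr [Hrq HN]]].
    apply (HN r Hr (le_refl Hr)). exact (forces_mono Hq Hr Hrq Hf).
  - intros H. split; [apply IHf1|apply IHf2]; auto; apply densely_impl with (2 := H); auto; tauto.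
  - apply densely_idem; auto.
  - intros H q Hq Hqp Hf. apply IHf2; auto.
    apply densely_impl with (F := fun r => forall s, s ∈ P -> le s r -> s ⊩ f1 -> s ⊩ f2); auto.
    + apply densely_mono with p; auto.
    + intros r Hr Hrq HF. apply HF; auto using le_refl. exact (forces_mono Hq Hr Hrq Hf).
  - intros H0 x. apply H; auto. apply densely_impl with (2 := H0); auto.
  - apply densely_idem; auto.
Qed.

(** In higher-order syntax [φ] is an arbitrary function and may inspect its argument, so
    substitution of equal names is no general theorem. It is checked for each formula, connective by
    connective, by [solve_extensional]. *)
Definition extensional (φ : name V -> fml (name V)) : Prop :=
  forall p x y, p ∈ P -> forces_eq P le x y p -> p ⊩ φ x -> p ⊩ φ y.

Lemma extensional_mem (φ ψ : name V -> name V) :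
  (forall p x y, p ∈ P -> forces_eq P le x y p -> forces_eq P le (φ x) (φ y) p) ->
  (forall p x y, p ∈ P -> forces_eq P le x y p -> forces_eq P le (ψ x) (ψ y) p) ->
  extensional (fun x => Mem (φ x) (ψ x)).
Proof.
  intros H1 H2 p x y Hp E H. simpl in *.
  apply mem_eq_r with (ψ x); auto. apply mem_eq_l with (φ x); auto.
Qed.

Lemma extensional_eq (φ ψ : name V -> name V) :
  (forall p x y, p ∈ P -> forces_eq P le x y p -> forces_eq P le (φ x) (φ y) p) ->
  (forall p x y, p ∈ P -> forces_eq P le x y p -> forces_eq P le (ψ x) (ψ y) p) ->
  extensional (fun x => Eq (φ x) (ψ x)).
Proof.
  intros H1 H2 p x y Hp E H. simpl in *.
  apply eq_trans_name with (φ x); auto; [apply eq_sym_name; auto|].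
  apply eq_trans_name with (ψ x); auto.
Qed.

Lemma extensional_and φ ψ : extensional φ -> extensional ψ -> extensional (fun x => And (φ x) (ψ x)).
Proof. intros H1 H2 p x y Hp E [A1 A2]. split; [apply (H1 p x)|apply (H2 p x)]; auto. Qed.

Lemma extensional_or φ ψ : extensional φ -> extensional ψ -> extensional (fun x => Or (φ x) (ψ x)).
Proof.
  intros H1 H2 p x y Hp E H. apply densely_impl with (2 := H); auto.
  intros r Hr Hrp [H'|H']; [left; apply (H1 r x)|right; apply (H2 r x)]; auto;
    exact (eq_mono Hp Hr Hrp E).
Qed.

Lemma extensional_imp φ ψ : extensional φ -> extensional ψ -> extensional (fun x => Imp (φ x) (ψ x)).
Proof.
  intros H1 H2 p x y Hp E H q Hq Hqp Hf. pose proof (eq_mono Hp Hq Hqp E) as E'.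
  apply (H2 q x); auto. apply H; auto. apply (H1 q y); auto. apply eq_sym_name; auto.
Qed.

Lemma extensional_all (φ : name V -> name V -> fml (name V)) :
  (forall z, extensional (fun x => φ x z)) -> extensional (fun x => All (φ x)).
Proof. intros H p x y Hp E Ha z. apply (H z p x); auto. Qed.

Lemma extensional_ex (φ : name V -> name V -> fml (name V)) :
  (forall z, extensional (fun x => φ x z)) -> extensional (fun x => Ex (φ x)).
Proof.
  intros H p x y Hp E He. apply densely_impl with (2 := He); auto.
  intros r Hr Hrp [z Hz]. exists z. apply (H z r x); auto. exact (eq_mono Hp Hr Hrp E).
Qed.

End Forcing.

Ltac solve_extensional :=
  unfold PairIn, IsPair, IsUPair, Sub, Iff; cbv beta;
  repeat match goal with
  | |- extensional (fun x => All _) => apply extensional_all; intro; cbv beta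
  | |- extensional (fun x => Ex _) => apply extensional_ex; intro; cbv beta
  | |- extensional (fun x => Imp _ _) => apply extensional_imp; cbv beta
  | |- extensional (fun x => And _ _) => apply extensional_and; cbv beta
  | |- extensional (fun x => Or _ _) => apply extensional_or; cbv beta
  | |- extensional (Eq ?z) => apply (@extensional_eq _ _ _ _ (fun _ => z) (fun x => x)); cbv beta
  | |- extensional (Mem ?z) => apply (@extensional_mem _ _ _ _ (fun _ => z) (fun x => x)); cbv beta
  | |- extensional (fun x => Mem _ _) => apply extensional_mem; cbv beta
  | |- extensional (fun x => Eq _ _) => apply extensional_eq; cbv beta
  end; auto; intros; apply eq_refl_name; auto.

(** * Forcing statements about names of ground model sets *)

Section Check.
Context {V : zfc} {P : V} {le : V -> V -> Prop} {HP : preorder_on P le}.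
Implicit Types p q r : V.
Implicit Types σ τ u v : name V.

Local Notation "p ⊩ f" := (forces P le p f) (at level 70).
Local Notation dns := (densely P le).
Local Notation extensional := (@extensional V P le).

#[local] Hint Extern 1 (le _ _) => apply le_refl : core.

Lemma check_unfold (x : V) : check x = Name x (fun i => check (proj1_sig i)) (fun _ _ => True).
Proof.
  unfold check at 1. rewrite Fix_eq; [reflexivity|].
  intros y f g Hfg. replace g with f; auto.
  apply functional_extensionality_dep; intros u.
  apply functional_extensionality_dep; intros H. apply Hfg.
Qed.

Lemma mem_check σ (x : V) p : p ∈ P -> (forces_mem P le σ (check x) p <->
  dns p (fun r => exists y, y ∈ x /\ forces_eq P le σ (check y) r)).
Proof.
  intros Hp. rewrite check_unfold. simpl. split; intros H; apply densely_impl with (2 := H); auto.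
  - intros r Hr Hrp [[y Hy] [b [_ [_ [_ E]]]]]. eauto.
  - intros r Hr Hrp [y [Hy E]]. exists (exist _ y Hy), r. auto.
Qed.

Lemma eq_check (x y : V) p : p ∈ P -> (forces_eq P le (check x) (check y) p <-> x = y).
Proof.
  intros Hp. split; [|intros ->; apply eq_refl_name; auto].
  revert y p Hp. induction x as [x IH] using (well_founded_ind (@foundation V)). intros y p Hp E.
  rewrite (check_unfold x), (check_unfold y) in E. simpl in E. destruct E as [E1 E2].
  apply set_ext. intros z. split; intros Hz.
  - destruct (E1 (exist _ z Hz) p p Hp I Hp (le_refl Hp) (le_refl Hp) p Hp (le_refl Hp))
      as [r [Hr [_ [[w Hw] [b [_ [_ [_ E]]]]]]]].
    simpl in E. rewrite (IH z Hz w r Hr E). exact Hw.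
  - destruct (E2 (exist _ z Hz) p p Hp I Hp (le_refl Hp) (le_refl Hp) p Hp (le_refl Hp))
      as [r [Hr [_ [[w Hw] [b [_ [_ [_ E]]]]]]]].
    simpl in E. rewrite <- (IH w Hw z r Hr E). exact Hw.
Qed.

Lemma check_mem (x y : V) p : p ∈ P -> (forces_mem P le (check x) (check y) p <-> x ∈ y).
Proof.
  intros Hp. rewrite mem_check by auto. split.
  - intros H. destruct (H p Hp (le_refl Hp)) as [r [Hr [_ [z [Hz E]]]]].
    apply eq_check in E; auto. subst; auto.
  - intros H. apply densely_here; auto. intros r Hr _. exists x. split; auto.
    apply eq_check; auto.
Qed.

(** A member of [check S] is densely equal to some [check i], so extensionality reduces the bounded
    quantifier to elements of the ground model. *)
Lemma forces_all_check (S : V) φ p : p ∈ P -> extensional φ ->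
  (p ⊩ All (fun x => Imp (Mem x (check S)) (φ x)) <-> forall i, i ∈ S -> p ⊩ φ (check i)).
Proof.
  intros Hp Hφ. split.
  - intros H i Hi. apply (H (check i) p Hp (le_refl Hp)). apply check_mem; auto.
  - intros H x q Hq Hqp Hx. apply mem_check in Hx; auto. apply forces_dense; auto.
    apply densely_impl with (2 := Hx); auto. intros r Hr Hrq [y [Hy E]].
    apply (Hφ r (check y) x); auto; [apply eq_sym_name; auto|].
    apply forces_mono with p; auto. exact (le_trans Hr Hq Hp Hrq Hqp).
Qed.

Lemma forces_ex_check (S : V) φ p : p ∈ P -> extensional φ ->
  (p ⊩ Ex (fun x => And (Mem x (check S)) (φ x)) <->
   dns p (fun r => exists i, i ∈ S /\ r ⊩ φ (check i))).
Proof.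
  intros Hp Hφ. split.
  - intros H. apply densely_idem; auto. apply densely_impl with (2 := H); auto.
    intros r Hr Hrp [x [Hx Hf]]. apply mem_check in Hx; auto.
    apply densely_impl with (2 := Hx); auto. intros t Ht Htr [y [Hy E]].
    exists y. split; auto. apply (Hφ t x); auto. exact (forces_mono Hr Ht Htr Hf).
  - intros H. apply densely_impl with (2 := H); auto.
    intros r Hr Hrp [i [Hi Hf]]. exists (check i). split; auto. apply check_mem; auto.
Qed.

Lemma forces_Iff p f g : p ∈ P -> (p ⊩ Iff f g <->
  forall q, q ∈ P -> le q p -> (q ⊩ f <-> q ⊩ g)).
Proof.
  intros Hp. simpl. split.
  - intros [H1 H2] q Hq Hqp. split; auto.
  - intros H. split; intros q Hq Hqp; apply H; auto.
Qed.

(** It suffices to test the hypothesis on the names occurring in [u] and in [v], each of which its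
    own condition forces to be a member. *)
Lemma name_ext u v p : p ∈ P -> (forall z, p ⊩ Iff (Mem z u) (Mem z v)) -> forces_eq P le u v p.
Proof.
  intros Hp H.
  assert (H' : forall z q, q ∈ P -> le q p -> (forces_mem P le z u q <-> forces_mem P le z v q)).
  { intros z q Hq Hqp. specialize (H z). rewrite forces_Iff in H by auto. exact (H q Hq Hqp). }
  clear H. destruct u as [D s A], v as [D' s' A']. simpl in *. split.
  - intros i a q Ha HA Hq Hqp Hqa. apply (H' (s i)); auto. apply densely_here; auto.
    intros r Hr Hrq. exists i, a. repeat split; auto; [exact (le_trans Hr Hq Ha Hrq Hqa)|].
    apply eq_refl_name; auto.
  - intros i a q Ha HA Hq Hqp Hqa.
    assert (HH : dns q (fun r => exists (j : el D) b, b ∈ P /\ A j b /\ le r b /\ forces_eq P le (s' i) (s j) r)).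
    { apply (H' (s' i)); auto. apply densely_here; auto.
      intros r Hr Hrq. exists i, a. repeat split; auto; [exact (le_trans Hr Hq Ha Hrq Hqa)|].
      apply eq_refl_name; auto. }
    apply densely_impl with (2 := HH); auto. intros r Hr Hrq [j [b [Hb [HA' [Hrb E]]]]].
    exists j, b. repeat split; auto. apply eq_sym_name; auto.
Qed.

Lemma IsUPair_unique x y u v p : p ∈ P -> p ⊩ IsUPair x y u -> p ⊩ IsUPair x y v ->
  forces_eq P le u v p.
Proof.
  intros Hp Hu Hv. apply name_ext; auto. intros z.
  pose proof (proj1 (forces_Iff (Mem z u) (Or (Eq z x) (Eq z y)) Hp) (Hu z)) as Hu'.
  pose proof (proj1 (forces_Iff (Mem z v) (Or (Eq z x) (Eq z y)) Hp) (Hv z)) as Hv'.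
  apply forces_Iff; auto.
  intros q Hq Hqp. rewrite (Hu' q Hq Hqp), (Hv' q Hq Hqp). reflexivity.
Qed.

Lemma IsUPair_check (a b : V) p : p ∈ P -> p ⊩ IsUPair (check a) (check b) (check (upair a b)).
Proof.
  intros Hp z. apply forces_Iff; auto. intros q Hq _.
  change (forces_mem P le z (check (upair a b)) q <->
    dns q (fun r => forces_eq P le z (check a) r \/ forces_eq P le z (check b) r)).
  rewrite mem_check by auto. split; intros H; apply densely_impl with (2 := H); auto.
  - intros r Hr _ [y [Hy E]]. apply in_upair in Hy. destruct Hy; subst; auto.
  - intros r Hr _ [E|E]; [exists a|exists b]; split; auto; apply in_upair; auto.
Qed.

Lemma forces_IsPair (a b : V) c p : p ∈ P ->
  (p ⊩ IsPair (check a) (check b) c <-> forces_eq P le c (check (pair a b)) p).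
Proof.
  intros Hp. split.
  - intros H. apply eq_dense; auto. apply densely_idem; auto. apply densely_impl with (2 := H); auto.
    intros r Hr _ [u Hu]. apply densely_impl with (2 := Hu); auto.
    intros t Ht _ [v [H1 [H2 H3]]].
    apply IsUPair_unique with u v; auto.
    (* The witnesses [u] and [v] are replaced, one at a time, by the check names to which uniqueness
       of unordered pairs makes them equal. *)
    assert (E1 : extensional (fun u => IsUPair u v (check (pair a b)))) by solve_extensional.
    apply (E1 t (check (upair a a)) u); auto.
    { apply (@IsUPair_unique (check a) (check a)); auto. apply IsUPair_check; auto. }
    assert (E2 : extensional (fun v => IsUPair (check (upair a a)) v (check (pair a b)))) by solve_extensional.
    apply (E2 t (check (upair a b)) v); auto.
    { apply (@IsUPair_unique (check a) (check b)); auto. apply IsUPair_check; auto. }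
    apply IsUPair_check; auto.
  - intros H.
    assert (E1 : extensional (fun c => IsPair (check a) (check b) c)) by solve_extensional.
    apply (E1 p (check (pair a b)) c); auto. { apply eq_sym_name; auto. }
    apply densely_here; auto. intros r Hr _. exists (check (upair a a)).
    apply densely_here; auto. intros t Ht _. exists (check (upair a b)).
    split; [|split]; apply IsUPair_check; auto.
Qed.

Lemma forces_PairIn (a b : V) τ p : p ∈ P ->
  (p ⊩ PairIn (check a) (check b) τ <-> forces_mem P le (check (pair a b)) τ p).
Proof.
  intros Hp. split.
  - intros H. apply (forces_dense (f := Mem (check (pair a b)) τ)); auto. apply densely_impl with (2 := H); auto.
    intros r Hr _ [c [H1 H2]]. apply forces_IsPair in H2; auto. exact (mem_eq_l Hr H2 H1).
  - intros H. apply densely_here; auto. intros r Hr Hrp. exists (check (pair a b)).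
    split; [exact (mem_mono Hp Hr Hrp H)|]. apply forces_IsPair; auto. apply eq_refl_name; auto.
Qed.

End Check.

(** * The stationary tower *)

Section Tower.
Context {V : zfc} {κ ν : V} {Hκ : successor_index κ ν}.
Implicit Types X Y Z T x y z α β γ δ : V.

(** Insensitive to the stage from which [x] is taken ([hit_cap]), so conditions of different heights
    are compared at any common stage. *)
Definition hit x X : Prop := cap x (bigcup X) ∈ X.

Definition compat δ X Y : Prop :=
  exists Z, Z ∈ tower κ δ /\ tower_le κ δ Z X /\ tower_le κ δ Z Y.

Lemma in_NS α X : X ∈ NS κ α <-> X ⊆ Pk κ (stage α) /\ ~ stationary κ (stage α) X.
Proof. apply (@in_setof V (power (Pk κ (stage α)))). intros Y [H _]. apply in_power; auto. Qed.

Lemma in_tower δ X : X ∈ tower κ δ <-> exists α, α ∈ δ /\ κ ⊆ α /\ stationary κ (stage α) X.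
Proof.
  transitivity (exists α, α ∈ δ /\ κ ⊆ α /\ X ⊆ Pk κ (stage α) /\ X ∉ NS κ α).
  - apply (@in_setof V (bigcup ⦃ p | exists α, α ∈ δ /\ p = power (Pk κ (stage α)) ⦄)).
    intros Y [α [Ha [_ [H _]]]]. apply in_bigcup. eexists. split.
    + apply in_image. eauto.
    + apply in_power; auto.
  - split; intros [α [H1 [H2 H3]]]; exists α; split; auto; split; auto.
    + destruct H3 as [H3 H4]. rewrite in_NS in H4. apply NNPP. tauto.
    + split; [apply H3|]. rewrite in_NS. tauto.
Qed.

Lemma stage_inhabited γ : κ ⊆ γ -> ordinal γ -> exists a, a ∈ stage γ.
Proof.
  intros H Hg. exists (num 0). apply ord_in_stage; auto. apply H.
  apply (ord_trans si_ord si_omega). apply num_in_omega.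
Qed.

(** A condition determines its base set, since for each [z] in [A] the points containing [z] form a
    club. *)
Lemma stationary_bigcup A X : stationary κ A X -> bigcup X = A.
Proof.
  intros HX. apply stationaryP in HX. destruct HX as [H1 H2]. apply sub_antisym; intros z Hz.
  - apply in_bigcup in Hz. destruct Hz as [x [Hx Hz]]. exact (Pk_sub (H1 x Hx) Hz).
  - destruct (H2 _ (clubF_in Hz)) as [x [Hx Hzx]]. apply in_bigcup; eauto.
Qed.

Lemma cap_cap x A B : B ⊆ A -> cap (cap x A) B = cap x B.
Proof. intros H. apply set_ext. intros z. rewrite !in_cap. split; [tauto|]. intros [H1 H2]; auto. Qed.

Lemma cap_id x A : x ⊆ A -> cap x A = x.
Proof. intros H. apply set_ext. intros z. rewrite in_cap. split; [tauto|auto]. Qed.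

Lemma hit_cap x X A : bigcup X ⊆ A -> (hit (cap x A) X <-> hit x X).
Proof. intros H. unfold hit. rewrite cap_cap; tauto. Qed.

Lemma hit_top x γ T : stationary κ (stage γ) T -> x ∈ Pk κ (stage γ) -> (hit x T <-> x ∈ T).
Proof.
  intros HT Hx. unfold hit. rewrite (stationary_bigcup HT), cap_id; [tauto|]. exact (Pk_sub Hx).
Qed.

Lemma clubF_True A : (exists a, a ∈ A) -> clubF (κ := κ) A (fun _ => True).
Proof. intros [a Ha]. eapply clubF_mono; [apply (clubF_in Ha)|auto]. Qed.

Lemma clubF_up γ γ' (C : V -> Prop) : γ ⊆ γ' ->
  clubF (κ := κ) (stage γ) C -> clubF (κ := κ) (stage γ') (fun x => C (cap x (stage γ))).
Proof. intros H. apply clubF_lift. apply stage_mono; auto. Qed.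

Lemma tower_leP δ X Y : tower_le κ δ X Y <->
  exists γ, γ ∈ δ /\ bigcup X ⊆ stage γ /\ bigcup Y ⊆ stage γ /\
    clubF (κ := κ) (stage γ) (fun x => hit x X -> hit x Y).
Proof.
  unfold tower_le.
  enough (H : forall γ, ⦃ x | x ∈ Pk κ (stage γ) /\ cap x (bigcup X) ∈ X /\ cap x (bigcup Y) ∉ Y ⦄ ∈ NS κ γ <->
    clubF (κ := κ) (stage γ) (fun x => hit x X -> hit x Y)).
  { split; intros [γ [H1 [H2 [H3 H4]]]]; exists γ; repeat split; auto; apply H; auto. }
  intros γ. rewrite in_NS.
  set (S := ⦃ x | x ∈ Pk κ (stage γ) /\ cap x (bigcup X) ∈ X /\ cap x (bigcup Y) ∉ Y ⦄).
  assert (HS : forall x, x ∈ S <-> x ∈ Pk κ (stage γ) /\ hit x X /\ ~ hit x Y) by (intros x; apply (in_sep (Pk κ (stage γ)) (fun x => hit x X /\ ~ hit x Y))).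
  assert (HSP : S ⊆ Pk κ (stage γ)). { intros x Hx. apply HS in Hx. tauto. }
  rewrite not_stationaryP by auto. split.
  - intros [_ H]. apply clubF_Pk with (1 := H). intros x Hx Hn HX. apply NNPP. intros N. apply Hn, HS; auto.
  - intros H. split; auto. apply clubF_mono with (1 := H). intros x Hx Hs. apply HS in Hs. tauto.
Qed.

Lemma clubF_hit_up γ γ' X Y : γ ⊆ γ' -> bigcup X ⊆ stage γ -> bigcup Y ⊆ stage γ ->
  clubF (κ := κ) (stage γ) (fun x => hit x X -> hit x Y) ->
  clubF (κ := κ) (stage γ') (fun x => hit x X -> hit x Y).
Proof.
  intros H HX HY HC. eapply clubF_mono; [apply (clubF_up H HC)|]. simpl. intros x.
  rewrite !hit_cap by auto. auto.
Qed.

Lemma tower_bigcup δ X : X ∈ tower κ δ -> exists α, α ∈ δ /\ κ ⊆ α /\ stationary κ (stage α) X /\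
  bigcup X = stage α.
Proof.
  intros H. apply in_tower in H. destruct H as [α [H1 [H2 H3]]]. exists α. repeat split; auto.
  - apply H3.
  - apply H3.
  - apply stationary_bigcup; auto.
Qed.

#[global] Instance tower_preorder δ (Lδ : limit δ) : preorder_on (tower κ δ) (tower_le κ δ).
Proof.
  pose proof (limit_ord Lδ) as Oδ. split.
  - intros X HX. destruct (tower_bigcup HX) as [α [Ha [Hka [_ E]]]]. apply tower_leP.
    exists α. rewrite E. repeat split; auto using sub_refl.
    apply clubF_mono with (C := fun _ => True); auto.
    apply clubF_True, stage_inhabited; auto. exact (ord_mem Oδ Ha).
  - intros X Y Z HX _ _ H1 H2. apply tower_leP in H1, H2. apply tower_leP.
    destruct H1 as [γ [Hg [X1 [Y1 C1]]]], H2 as [γ' [Hg' [X2 [Y2 C2]]]].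
    destruct (ord_max_in Oδ Hg Hg') as [c [Hc [Hgc Hgc']]].
    exists c. split; auto. split; [exact (sub_trans X1 (stage_mono Hgc))|].
    split; [exact (sub_trans Y2 (stage_mono Hgc'))|].
    eapply clubF_mono.
    + apply clubF_and; [|apply (clubF_hit_up Hgc X1 Y1 C1)|apply (clubF_hit_up Hgc' X2 Y2 C2)].
      destruct (tower_bigcup HX) as [α [Ha [Hka [_ E]]]].
      destruct (stage_inhabited Hka (ord_mem Oδ Ha)) as [a Haa].
      exists a. apply (stage_mono Hgc), X1. rewrite E; auto.
    + simpl. tauto.
Qed.

Lemma hit_stationary δ X γ C : ordinal δ -> X ∈ tower κ δ -> bigcup X ⊆ stage γ ->
  clubF (κ := κ) (stage γ) C -> exists x, x ∈ Pk κ (stage γ) /\ hit x X /\ C x.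
Proof.
  intros Oδ HX Hs HC. destruct (tower_bigcup HX) as [α [Ha [Hka [HS E]]]].
  unfold hit. rewrite E in *. apply (@stationary_lift V κ ν Hκ (stage α)); auto.
  apply stage_inhabited; auto. exact (ord_mem Oδ Ha).
Qed.

Lemma in_tower_at δ γ T : γ ∈ δ -> κ ⊆ γ -> stationary κ (stage γ) T -> T ∈ tower κ δ.
Proof. intros. apply in_tower; eauto. Qed.

Lemma tower_le_at δ γ T Y : ordinal δ -> γ ∈ δ -> κ ⊆ γ -> stationary κ (stage γ) T -> bigcup Y ⊆ stage γ ->
  (forall x, x ∈ T -> hit x Y) -> tower_le κ δ T Y.
Proof.
  intros Oδ Hg Hk HT HY H. apply tower_leP. exists γ. rewrite (stationary_bigcup HT).
  repeat split; auto using sub_refl.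
  apply clubF_Pk with (C := fun _ => True).
  - apply clubF_True, stage_inhabited; auto. exact (ord_mem Oδ Hg).
  - intros x Hx _ Hh. apply H. apply (hit_top HT Hx); auto.
Qed.

(* The conclusion does not mention the height of the tower, which is why incompatibility
   is absolute between towers. *)
Lemma compat_hit δ γ X Y C : ordinal δ -> γ ∈ δ -> κ ⊆ γ ->
  bigcup X ⊆ stage γ -> bigcup Y ⊆ stage γ -> compat δ X Y -> clubF (κ := κ) (stage γ) C ->
  exists x, x ∈ Pk κ (stage γ) /\ hit x X /\ hit x Y /\ C x.
Proof.
  intros Oδ Hg Hkg HX HY [Z [HZ [H1 H2]]] HC. apply tower_leP in H1, H2.
  destruct H1 as [γ1 [Hg1 [Z1 [X1 C1]]]], H2 as [γ2 [Hg2 [Z2 [Y2 C2]]]].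
  destruct (ord_max_in Oδ Hg Hg1) as [c [Hc [Hgc Hgc1]]].
  destruct (ord_max_in Oδ Hc Hg2) as [d [Hd [Hcd Hgd2]]].
  pose proof (sub_trans Hgc Hcd) as Hgd. pose proof (sub_trans Hgc1 Hcd) as Hgd1.
  assert (HI : exists a, a ∈ stage d).
  { apply stage_inhabited; [exact (sub_trans Hkg Hgd)|exact (ord_mem Oδ Hd)]. }
  destruct (@hit_stationary δ Z d (fun x => (hit x Z -> hit x X) /\ (hit x Z -> hit x Y) /\ C (cap x (stage γ))))
    as [x [Hx [HxZ [HxX [HxY HxC]]]]]; auto.
  - exact (sub_trans Z1 (stage_mono Hgd1)).
  - apply clubF_and; auto; [apply (clubF_hit_up Hgd1 Z1 X1 C1)|].
    apply clubF_and; auto; [apply (clubF_hit_up Hgd2 Z2 Y2 C2)|]. apply clubF_up; auto.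
  - exists (cap x (stage γ)). rewrite !hit_cap by auto. repeat split; auto. exact (Pk_cap (stage γ) Hx).
Qed.

Definition both γ X Y : V := ⦃ x | x ∈ Pk κ (stage γ) /\ hit x X /\ hit x Y ⦄.

Lemma in_both γ X Y x : x ∈ both γ X Y <-> x ∈ Pk κ (stage γ) /\ hit x X /\ hit x Y.
Proof. apply (in_sep (Pk κ (stage γ)) (fun x => hit x X /\ hit x Y)). Qed.

Lemma both_stationary_compat δ γ X Y : ordinal δ -> γ ∈ δ -> κ ⊆ γ -> bigcup X ⊆ stage γ -> bigcup Y ⊆ stage γ ->
  stationary κ (stage γ) (both γ X Y) -> compat δ X Y.
Proof.
  intros Oδ Hg Hk HX HY HT. exists (both γ X Y). split; [exact (in_tower_at Hg Hk HT)|].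
  split; apply tower_le_at with γ; auto; intros x Hx; apply in_both in Hx; tauto.
Qed.

Lemma tower_height2 δ X Y : ordinal δ -> X ∈ tower κ δ -> Y ∈ tower κ δ ->
  exists γ, γ ∈ δ /\ κ ⊆ γ /\ bigcup X ⊆ stage γ /\ bigcup Y ⊆ stage γ.
Proof.
  intros Oδ HX HY.
  destruct (tower_bigcup HX) as [α [Ha [Hka [_ ->]]]]. destruct (tower_bigcup HY) as [β [Hb [Hkb [_ ->]]]].
  destruct (ord_max_in Oδ Ha Hb) as [c [Hc [Hac Hbc]]].
  exists c. split; auto. split; [exact (sub_trans Hka Hac)|].
  split; apply stage_mono; auto.
Qed.

(** Compatibility in the taller tower already makes [both γ X Y] stationary at a stage below [δ],
    where it is a common lower bound. *)
Lemma compat_absolute δ δ' X Y : ordinal δ -> ordinal δ' -> δ ⊆ δ' ->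
  X ∈ tower κ δ -> Y ∈ tower κ δ -> compat δ' X Y -> compat δ X Y.
Proof.
  intros Oδ Oδ' Hs HX HY HC. destruct (tower_height2 Oδ HX HY) as [γ [Hg [Hk [X1 Y1]]]].
  apply both_stationary_compat with γ; auto. apply stationaryP. split.
  - intros x Hx. apply in_both in Hx. tauto.
  - intros C HCl. destruct (compat_hit Oδ' (Hs γ Hg) Hk X1 Y1 HC HCl) as [x [Hx [H1 [H2 H3]]]].
    exists x. split; auto. apply in_both; auto.
Qed.

Lemma incompat_club δ γ X Y : ordinal δ -> γ ∈ δ -> κ ⊆ γ -> bigcup X ⊆ stage γ -> bigcup Y ⊆ stage γ ->
  ~ compat δ X Y -> clubF (κ := κ) (stage γ) (fun x => ~ (hit x X /\ hit x Y)).
Proof.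
  intros Oδ Hg Hk HX HY N. apply clubF_Pk with (C := fun x => x ∉ both γ X Y).
  - apply not_stationaryP.
    + intros x Hx. apply in_both in Hx. tauto.
    + intros H. apply N. apply both_stationary_compat with γ; auto.
  - intros x Hx Hn [H1 H2]. apply Hn, in_both; auto.
Qed.

Lemma stage_bigcup γ d : ordinal γ -> d ∈ stage γ -> bigcup d ⊆ stage γ.
Proof.
  intros Og Hd z Hz. apply in_bigcup in Hz. destruct Hz as [y [Hy Hz]].
  apply (stage_trans Og (stage_trans Og Hd Hy) Hz).
Qed.

(** * Predense sets seen by the points of a stage *)

Definition predense_below δ (E : V -> Prop) a : Prop :=
  forall r, r ∈ tower κ δ -> tower_le κ δ r a -> exists d, E d /\ compat δ r d.

(** If the set of counterexamples were stationary, it would itself be a condition below [a], hence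
    compatible with some [d] in [E]. As [d] is an element of V_γ, club many points contain it, and a
    point hitting both conditions and containing [d] is no counterexample. *)
Lemma capture δ γ a (E : V -> Prop) : ordinal δ -> γ ∈ δ -> κ ⊆ γ -> bigcup a ⊆ stage γ ->
  predense_below δ (fun d => E d /\ d ∈ stage γ) a ->
  clubF (κ := κ) (stage γ) (fun x => hit x a -> exists d, E d /\ d ∈ stage γ /\ d ∈ x /\ hit x d).
Proof.
  intros Oδ Hg Hk Ha HE.
  set (T := ⦃ x | x ∈ Pk κ (stage γ) /\ hit x a /\ ~ exists d, E d /\ d ∈ stage γ /\ d ∈ x /\ hit x d ⦄).
  assert (HT : forall x, x ∈ T <-> x ∈ Pk κ (stage γ) /\ hit x a /\
    ~ exists d, E d /\ d ∈ stage γ /\ d ∈ x /\ hit x d)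
    by (intros x; apply (in_sep (Pk κ (stage γ)) (fun x => hit x a /\
      ~ exists d, E d /\ d ∈ stage γ /\ d ∈ x /\ hit x d))).
  apply clubF_Pk with (C := fun x => x ∉ T).
  2: { intros x Hx Hn Hh. apply NNPP. intros N. apply Hn, HT; auto. }
  apply not_stationaryP; [intros x Hx; apply HT in Hx; tauto|]. intros ST.
  destruct (HE T) as [d [[Ed Hd] Cd]].
  - exact (in_tower_at Hg Hk ST).
  - apply tower_le_at with γ; auto. intros x Hx. apply HT in Hx. tauto.
  - pose proof (ord_mem Oδ Hg) as Og.
    destruct (@compat_hit δ γ T d (fun x => d ∈ x)) as [x [Hx [H1 [H2 H3]]]]; auto.
    + rewrite (stationary_bigcup ST). apply sub_refl.
    + apply stage_bigcup; auto.
    + apply clubF_in; auto.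
    + apply (hit_top ST Hx) in H1. apply HT in H1. destruct H1 as [_ [_ H1]]. apply H1; eauto.
Qed.

Lemma tower_rank δ X : limit δ -> X ∈ tower κ δ -> exists ξ, ξ ∈ δ /\ X ∈ stage ξ.
Proof.
  intros Lδ HX. destruct (tower_bigcup HX) as [α [Ha [_ [HS _]]]].
  exists (succ (succ α)). split; [apply limit_succ, limit_succ; auto|].
  apply stage_succ. intros x Hx. apply stage_succ. exact (Pk_sub (proj1 HS x Hx)).
Qed.

Definition dense δ D : Prop :=
  D ⊆ tower κ δ /\ forall p, p ∈ tower κ δ -> exists q, q ∈ D /\ tower_le κ δ q p.

(** * Presaturation as a boundedness property *)

(* The name used below sends [i] to the least [ξ] for which the generic filter
   meets [E i ∩ V_ξ]. *)
Lemma presaturated_bound μ : limit μ -> presaturated κ μ ->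
  forall β (E : V -> V -> Prop), β ∈ μ ->
  (forall i a, i ∈ β -> E i a -> a ∈ tower κ μ) ->
  (forall i p, i ∈ β -> p ∈ tower κ μ -> exists a, E i a /\ compat μ p a) ->
  forall p, p ∈ tower κ μ -> exists q, q ∈ tower κ μ /\ tower_le κ μ q p /\
    exists ξ, ξ ∈ μ /\ forall i, i ∈ β -> predense_below μ (fun a => E i a /\ a ∈ stage ξ) q.
Proof.
  intros Lμ Hps β E Hβ HE1 HE2 p Hp. pose proof (limit_ord Lμ) as Oμ.
  pose proof (tower_preorder Lμ) as PO.
  set (Q := tower κ μ) in *. set (le := tower_le κ μ) in *.
  apply NNPP. intros N.
  (* [R i a ξ]: the condition [a] decides ξ as the value at [i]. It lies below a member of [E i] in
     V_ξ and is incompatible with all members that appear earlier. *)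
  set (R := fun i a ξ => a ∈ Q /\ ξ ∈ μ /\ (exists e, E i e /\ e ∈ stage ξ /\ le a e) /\
    forall ξ' e', ξ' ∈ ξ -> E i e' -> e' ∈ stage ξ' -> ~ compat μ a e').
  assert (R_dense : forall i q, i ∈ β -> q ∈ Q -> exists a ξ, R i a ξ /\ le a q).
  { intros i q Hi Hq.
    set (S := fun ξ => exists b e, b ∈ Q /\ le b q /\ E i e /\ e ∈ stage ξ /\ le b e /\ ξ ∈ μ).
    assert (exists ξ, ordinal ξ /\ S ξ) as [ξ0 [Oξ0 Sξ0]].
    { destruct (HE2 i q Hi Hq) as [e [He [b [Hb [Hbq Hbe]]]]].
      destruct (tower_rank Lμ (HE1 i e Hi He)) as [ξ [Hξ Heξ]].
      exists ξ. split; [exact (ord_mem Oμ Hξ)|]. exists b, e. repeat split; auto. }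
    destruct (least_ordinal Oξ0 Sξ0) as [ξ [Oξ [_ [[b [e [Hb [Hbq [He [Heξ [Hbe Hξ]]]]]]] Hmin]]]].
    exists b, ξ. split; auto. split; auto. split; auto. split; [eauto|].
    intros ξ' e' Hξ' He' Heξ' [c [Hc [Hcb Hce]]]. apply (Hmin ξ' Hξ').
    exists c, e'. repeat split; auto.
    - exact (le_trans Hc Hb Hq Hcb Hbq).
    - exact (ord_mem_trans Oμ Hξ' Hξ). }
  (* The member of [E i] above [a] is compatible with [b], so minimality of ξ' forbids ξ below
     ξ'. *)
  assert (R_lt : forall i a b c ξ ξ', i ∈ β -> R i a ξ -> R i b ξ' -> c ∈ Q -> le c a -> le c b -> ξ ∉ ξ').
  { intros i a b c ξ ξ' Hi [Ha [_ [[e [He [Heξ Hae]]] _]]] [Hb [_ [_ Hmin]]] Hc Hca Hcb Hlt.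
    apply (Hmin ξ e Hlt He Heξ). exists c. split; auto. split; auto.
    exact (le_trans Hc Ha (HE1 i e Hi He) Hca Hae). }
  assert (R_unique : forall i a b c ξ ξ', i ∈ β -> R i a ξ -> R i b ξ' -> c ∈ Q -> le c a -> le c b -> ξ = ξ').
  { intros i a b c ξ ξ' Hi Ha Hb Hc Hca Hcb.
    assert (Oξ : ordinal ξ) by (destruct Ha as [_ [H _]]; exact (ord_mem Oμ H)).
    assert (Oξ' : ordinal ξ') by (destruct Hb as [_ [H _]]; exact (ord_mem Oμ H)).
    destruct (ord_trichotomy Oξ Oξ') as [H|[H|H]]; auto; exfalso.
    - exact (R_lt i a b c ξ ξ' Hi Ha Hb Hc Hca Hcb H).
    - exact (R_lt i b a c ξ' ξ Hi Hb Ha Hc Hcb Hca H). }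
  set (f := Name (prod_set β μ) (fun c => check (proj1_sig c))
    (fun c a => R (fst_of (proj1_sig c)) a (snd_of (proj1_sig c)))).
  assert (mem_f : forall τ q, q ∈ Q -> (forces_mem Q le τ f q <-> densely Q le q (fun r =>
    exists i ξ b, i ∈ β /\ R i b ξ /\ le r b /\ forces_eq Q le τ (check (pair i ξ)) r))).
  { intros τ q Hq. simpl. split; intros H; apply densely_impl with (2 := H); auto.
    - intros r Hr _ [[c Hc] [b [Hb [HR [Hrb HEq]]]]]. simpl in *.
      pose proof Hc as Hc'. apply in_prod_set in Hc'. destruct Hc' as [i [ξ [Hi [Hξ ->]]]].
      rewrite fst_pair, snd_pair in HR. exists i, ξ, b. auto.
    - intros r Hr _ [i [ξ [b [Hi [HR [Hrb HEq]]]]]].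
      assert (Hc : pair i ξ ∈ prod_set β μ).
      { apply in_prod_set. exists i, ξ. repeat split; auto. apply HR. }
      exists (exist (fun c => c ∈ prod_set β μ) _ Hc), b. simpl. rewrite fst_pair, snd_pair. split; [apply HR|auto]. }
  assert (pair_f : forall i ξ q, i ∈ β -> q ∈ Q ->
    (forces Q le q (PairIn (check i) (check ξ) f) <-> densely Q le q (fun r => exists b, R i b ξ /\ le r b))).
  { intros i ξ q Hi Hq. rewrite forces_PairIn, mem_f by auto.
    split; intros H; apply densely_impl with (2 := H); auto.
    - intros r Hr _ [j [ζ [b [Hj [HR [Hrb HEq]]]]]]. apply eq_check in HEq; auto.
      apply pair_inj in HEq. destruct HEq; subst. eauto.
    - intros r Hr _ [b [HR Hrb]]. exists i, ξ, b. repeat split; auto; try apply HR.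
      apply eq_check; auto. }
  assert (Hfun : forces Q le p (IsFun f (check β) (check μ))).
  { split.
    - intros c q Hq Hqp Hc. apply forces_ex_check; [auto|solve_extensional|].
      apply (mem_f c q Hq) in Hc. apply densely_impl with (2 := Hc); auto.
      intros r Hr _ [i [ξ [b [Hi [HR [Hrb HEq]]]]]]. exists i. split; auto.
      apply forces_ex_check; [auto|solve_extensional|].
      apply densely_here; auto. intros t Ht Htr. exists ξ. split; [apply HR|].
      apply forces_IsPair; auto. exact (eq_mono Hr Ht Htr HEq).
    - apply forces_all_check; [auto|solve_extensional|]. intros i Hi.
      apply forces_ex_check; [auto|solve_extensional|].
      intros q Hq Hqp. destruct (R_dense i q Hi Hq) as [a [ξ [HR Haq]]].
      assert (Ha : a ∈ Q) by apply HR.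
      exists a. split; auto. split; auto. exists ξ. split; [apply HR|]. split.
      + apply pair_f; auto. apply densely_here; auto. intros r Hr Hra. eauto.
      + apply forces_all_check; [auto|solve_extensional|]. intros ζ Hζ r Hr Hra H.
        apply pair_f in H; auto. destruct (H r Hr (le_refl Hr)) as [t [Ht [Htr [b [HR' Htb]]]]].
        apply eq_check; auto. apply (R_unique i b a t ζ ξ); auto. exact (le_trans Ht Hr Ha Htr Hra). }
  assert (Hreg : forces Q le p (IsRegular (check μ))) by exact (Hps p Hp).
  destruct Hreg as [_ Hreg].
  assert (Hβμ : forces_mem Q le (check β) (check μ) p) by (apply check_mem; auto).
  change (forall (τ : name V) q, q ∈ Q -> le q p -> forces_mem Q le τ (check μ) q ->
    forall g r, r ∈ Q -> le r q -> ~ forces Q le r (IsCofinalFun g τ (check μ))) in Hreg.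
  apply (Hreg (check β) p Hp (le_refl Hp) Hβμ f p Hp (le_refl Hp)).
  split; [exact Hfun|].
  apply forces_all_check; [auto|solve_extensional|]. intros ζ Hζ.
  apply forces_ex_check; [auto|solve_extensional|].
  intros q Hq Hqp.
  (* Since ζ does not serve as a bound at [q], some [r] below [q] is incompatible with all of [E i]
     inside V_ζ. Below [r] the value at [i] therefore exceeds ζ, which makes the named function
     cofinal. *)
  assert (exists i r, i ∈ β /\ r ∈ Q /\ le r q /\ forall a, E i a -> a ∈ stage ζ -> ~ compat μ r a)
    as [i [r [Hi [Hr [Hrq Hno]]]]].
  { apply NNPP. intros N'. apply N. exists q. split; auto. split; auto. exists ζ. split; auto.
    intros i Hi r Hr Hrq. apply NNPP. intros N''. apply N'. exists i, r. repeat split; auto.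
    intros a Ha Haz Hc. apply N''. eauto. }
  destruct (R_dense i r Hi Hr) as [a [ξ [HR Har]]].
  assert (Ha : a ∈ Q) by apply HR.
  exists a. split; auto. split; [exact (le_trans Ha Hr Hq Har Hrq)|]. exists i. split; auto.
  apply forces_ex_check; [auto|solve_extensional|].
  apply densely_here; auto. intros t Ht Hta. exists ξ. split; [apply HR|]. split.
  - apply pair_f; auto. apply densely_here; auto. intros s Hs Hst. exists a. split; auto.
    exact (le_trans Hs Ht Ha Hst Hta).
  - apply densely_here; auto. intros s Hs _. left. apply check_mem; auto.
    destruct HR as [_ [Hξ [[e [He [Heξ Hae]]] _]]].
    destruct (ord_sub_or_mem (ord_mem Oμ Hξ) (ord_mem Oμ Hζ)) as [H|H]; auto. exfalso.
    apply (Hno e He (stage_mono H Heξ)). exists a. auto.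
Qed.

End Tower.

(** * Sets that capture dense sets *)

Lemma small_bounded {V : zfc} (μ : V) (M : V -> Prop) : inaccessible μ ->
  small (fun β => β ∈ μ) M -> (forall z, M z -> z ∈ μ) -> exists η, η ∈ μ /\ forall z, M z -> z ∈ η.
Proof.
  intros Hμ [β [f [Hβ Hf]]] HM.
  set (h := fun i => if excluded_middle_informative (f i ∈ μ) then f i else β).
  destruct (@regular_bound V μ (proj1 Hμ) β h Hβ) as [η [Hη Hb]].
  - intros i _. unfold h. destruct (excluded_middle_informative _); auto.
  - exists η. split; auto. intros z Hz. destruct (Hf z Hz) as [i [Hi E]].
    specialize (Hb i Hi). unfold h in Hb. rewrite <- E in Hb.
    destruct (excluded_middle_informative _) as [|n]; auto. exfalso. auto.
Qed.

Section Capturing.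
Context {V : zfc} {κ ν : V} {Hκ : successor_index κ ν}.
Context {μ : V} (Hμ : inaccessible μ) (Hκμ : κ ∈ μ) (Hps : presaturated κ μ).
Implicit Types X Y Z T D x y z a b c p q α β γ : V.

Local Notation Q := (tower κ μ).
Local Notation le := (tower_le κ μ).
Local Notation W := (stage (succ μ)).

Definition capturing X : V :=
  ⦃ x | x ∈ Pk κ W /\ (hit x X /\ forall D, D ∈ x -> dense (κ := κ) μ D -> exists d, d ∈ D /\ d ∈ x /\ hit x d) ⦄.

Lemma limit_μ : limit μ.
Proof. exact (inaccessible_limit Hμ). Qed.

Lemma ord_μ : ordinal μ.
Proof. exact (limit_ord limit_μ). Qed.

#[local] Instance Q_preorder : preorder_on Q le := tower_preorder limit_μ.

Lemma compat_of_le p a : p ∈ Q -> a ∈ Q -> le a p -> compat (κ := κ) μ p a.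
Proof. intros Hp Ha H. exists a. split; auto. split; auto. exact (le_refl Ha). Qed.

(** * Hulls and the sequences that conditions decide *)

Context {F : tree V -> V} (HF : forall t, over (fun z => z ∈ W) t -> F t ∈ Pk κ W).
Context {α0 : V} (Hα0 : α0 ∈ μ).

(** The head of the list is the latest ordinal. The first hull contains V_{α0}, where [α0] will be
    the height of [X], so that the trace relevant for hitting [X] is present from the start. *)
Fixpoint hull (s : list V) : V -> Prop :=
  match s with
  | nil => clo F (fun z => z ∈ stage α0)
  | α :: s => clo F (fun z => hull s z \/ z ∈ stage α)
  end.

Definition below_μ (s : list V) : Prop := Forall (fun α => α ∈ μ) s.

Lemma stage_W α : α ∈ μ -> stage α ⊆ W.
Proof. intros H. apply stage_mono. intros z Hz. apply in_succ. left. exact (ord_mem_trans ord_μ Hz H). Qed.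

Lemma F_sub t z : over (fun z => z ∈ W) t -> z ∈ F t -> z ∈ W.
Proof. intros Ht Hz. exact (Pk_sub (HF Ht) Hz). Qed.

Lemma hull_sub s z : below_μ s -> hull s z -> z ∈ W.
Proof.
  intros Hs. revert z. induction Hs as [|α s Hα Hs IH]; simpl; apply clo_sub.
  - apply stage_W; auto.
  - intros t Ht z. apply F_sub; auto.
  - intros z [H|H]; auto. exact (stage_W Hα H).
  - intros t Ht z. apply F_sub; auto.
Qed.

Lemma small_ν_μ (T : Type) (M : T -> Prop) : small (eq ν) M -> small (fun β => β ∈ μ) M.
Proof.
  intros [k [f [<- Hf]]]. exists ν, f. split; auto. exact (ord_mem_trans ord_μ si_mem Hκμ).
Qed.

(** Inaccessibility makes each added V_α small, and each value of [F] has size less than κ, hence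
    less than μ. *)
Lemma small_hull s : below_μ s -> small (fun β => β ∈ μ) (hull s).
Proof.
  pose proof (index_class_inaccessible Hμ) as HC.
  assert (HFs : forall t, over (fun z => z ∈ W) t -> small (fun β => β ∈ μ) (fun z => z ∈ F t)).
  { intros t Ht. apply small_ν_μ. specialize (HF Ht). apply in_Pk_small in HF. tauto. }
  intros Hs. induction Hs as [|α s Hα Hs IH]; simpl; apply small_clo with (B := fun z => z ∈ W); auto.
  - apply stage_W; auto.
  - intros t Ht z. apply F_sub; auto.
  - apply small_stage; auto.
  - intros z [H|H]; [exact (hull_sub Hs H)|exact (stage_W Hα H)].
  - intros t Ht z. apply F_sub; auto.
  - apply small_or; auto using zfc_inhabited. apply small_stage; auto.
Qed.

Lemma hull_closed s t z : over (hull s) t -> z ∈ F t -> hull s z.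
Proof. destruct s; simpl; apply clo_step. Qed.

Lemma hull_tail α s z : hull s z -> hull (α :: s) z.
Proof. intros H. apply clo_base; auto. Qed.

Lemma hull_stage α s z : z ∈ stage α -> hull (α :: s) z.
Proof. intros H. apply clo_base; auto. Qed.

(** [a] forces every dense set in [hull s] to be met by the generic filter inside [V_α]. *)
Definition meets a s α : Prop := forall D, hull s D -> dense (κ := κ) μ D ->
  predense_below (κ := κ) μ (fun d => d ∈ D /\ d ∈ stage α) a.

(** [a] decides [s], listed from the last entry to the first, as the sequence of least
    ordinals that meet the successive hulls. *)
Fixpoint decides a s : Prop :=
  match s with
  | nil => True
  | α :: s => decides a s /\ meets a s α /\ forall β b, β ∈ α -> b ∈ Q -> le b a -> ~ meets b s β
  end.

Lemma meets_mono a b s α : a ∈ Q -> b ∈ Q -> le b a -> meets a s α -> meets b s α.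
Proof.
  intros Ha Hb Hba H D HD Hd r Hr Hrb. apply (H D HD Hd r Hr). exact (le_trans Hr Hb Ha Hrb Hba).
Qed.

Lemma decides_mono a b s : a ∈ Q -> b ∈ Q -> le b a -> decides a s -> decides b s.
Proof.
  intros Ha Hb Hba. induction s as [|α s IH]; simpl; auto.
  intros [H1 [H2 H3]]. split; auto. split; [exact (meets_mono Ha Hb Hba H2)|].
  intros β c Hβ Hc Hcb. apply (H3 β c Hβ Hc). exact (le_trans Hc Hb Ha Hcb Hba).
Qed.

(** First use of presaturation: the hull contains fewer than μ dense sets, so one stage bounds the
    places where they are met. *)
Lemma meets_ex p s : below_μ s -> p ∈ Q -> exists q α, q ∈ Q /\ le q p /\ α ∈ μ /\ meets q s α.
Proof.
  intros Hs Hp. destruct (small_hull Hs) as [β [f [Hβ Hf]]].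
  (* Indices at which [f] does not give a dense set of the hull are made harmless: there [E i] is
     the whole tower. *)
  set (E := fun i a => a ∈ Q /\ (hull s (f i) /\ dense (κ := κ) μ (f i) -> a ∈ f i)).
  destruct (@presaturated_bound V κ ν Hκ μ limit_μ Hps β E Hβ) with (p := p) as [q [Hq [Hqp [ξ [Hξ H]]]]]; auto.
  - intros i a _ [H _]; auto.
  - intros i r Hi Hr. destruct (classic (hull s (f i) /\ dense (κ := κ) μ (f i))) as [[H1 H2]|N].
    + destruct (proj2 H2 r Hr) as [d [Hd Hdr]]. exists d.
      assert (HdQ : d ∈ Q) by (apply H2; auto).
      split; [split; auto|]. apply compat_of_le; auto.
    + exists r. split; [split; tauto|]. apply compat_of_le; auto. exact (le_refl Hr).
  - exists q, ξ. repeat split; auto. intros D HD Hd r Hr Hrq.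
    destruct (Hf D HD) as [i [Hi ->]]. destruct (H i Hi r Hr Hrq) as [d [[[_ H1] H2] H3]].
    exists d. auto.
Qed.

(** Among all conditions below [a] one that admits the least possible α is chosen; nothing below it
    can do better, so it decides α. *)
Lemma decides_dense n p : p ∈ Q -> exists a s, a ∈ Q /\ le a p /\ length s = n /\ below_μ s /\ decides a s.
Proof.
  intros Hp. induction n as [|n [a [s [Ha [Hap [Hl [Hs He]]]]]]].
  - exists p, nil. repeat split; auto. exact (le_refl Hp). constructor.
  - set (S := fun α => α ∈ μ /\ exists q, q ∈ Q /\ le q a /\ meets q s α).
    assert (exists α, ordinal α /\ S α) as [α' [Oα' Sα']].
    { destruct (meets_ex Hs Ha) as [q [α [Hq [Hqa [Hα Hm]]]]].
      exists α. split; [exact (ord_mem ord_μ Hα)|]. split; auto. exists q; auto. }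
    destruct (least_ordinal Oα' Sα') as [α [Oα [_ [[Hα [q [Hq [Hqa Hm]]]] Hmin]]]].
    exists q, (α :: s). simpl. repeat split; auto.
    + exact (le_trans Hq Ha Hp Hqa Hap).
    + constructor; auto.
    + exact (decides_mono Ha Hq Hqa He).
    + intros β b Hβ Hb Hbq Hmb. apply (Hmin β Hβ). split; [exact (ord_mem_trans ord_μ Hβ Hα)|].
      exists b. split; auto. split; auto. exact (le_trans Hb Hq Ha Hbq Hqa).
Qed.

Lemma decides_unique a b s t : a ∈ Q -> b ∈ Q -> compat (κ := κ) μ a b -> below_μ s -> below_μ t ->
  length s = length t -> decides a s -> decides b t -> s = t.
Proof.
  intros Ha Hb [c [Hc [Hca Hcb]]] Hs. revert t.
  induction Hs as [|α s Hα Hs IH]; intros t Ht Hl; destruct Ht as [|α' t Hα' Ht]; try discriminate; auto.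
  simpl. intros [E1 [M1 N1]] [E2 [M2 N2]].
  assert (Est : s = t) by (apply IH; auto). subst t. f_equal.
  destruct (ord_trichotomy (ord_mem ord_μ Hα) (ord_mem ord_μ Hα')) as [H|[H|H]]; auto; exfalso.
  - apply (N2 α c H Hc Hcb). exact (meets_mono Ha Hc Hca M1).
  - apply (N1 α' c H Hc Hca). exact (meets_mono Hb Hc Hcb M2).
Qed.

(** Dropping the latest entries of [t] until the lengths agree gives [s] by [decides_unique], and
    hulls grow along a list. *)
Lemma decides_hull_mono a b s t z : a ∈ Q -> b ∈ Q -> compat (κ := κ) μ a b -> below_μ s -> below_μ t ->
  length s <= length t -> decides a s -> decides b t -> hull s z -> hull t z.
Proof.
  intros Ha Hb Hab Hs Ht. induction Ht as [|α t Hα Ht IH]; intros Hl E1 E2 Hz.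
  - destruct s; auto. simpl in Hl. lia.
  - destruct (Nat.eq_dec (length s) (length (α :: t))) as [E|E].
    + assert (Hαt : below_μ (α :: t)) by (constructor; auto).
      rewrite (decides_unique Ha Hb Hab Hs Hαt E E1 E2) in Hz. exact Hz.
    + apply hull_tail. apply IH; auto.
      * simpl in *. lia.
      * apply E2.
Qed.

(** Second use of presaturation, with index set ω: a single ξ bounds the conditions that decide the
    sequences of every finite length. *)
Lemma bounded_sequence X : X ∈ Q -> exists q ξ, q ∈ Q /\ le q X /\ ξ ∈ μ /\
  forall n, predense_below (κ := κ) μ (fun a => (a ∈ Q /\ exists s, length s = n /\ below_μ s /\ decides a s) /\ a ∈ stage ξ) q.
Proof.
  intros HX.
  set (E := fun (i : V) a => a ∈ Q /\ exists s, num (length s) = i /\ below_μ s /\ decides a s).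
  destruct (@presaturated_bound V κ ν Hκ μ limit_μ Hps omega E) with (p := X) as [q [Hq [HqX [ξ [Hξ H]]]]]; auto.
  - exact (ord_mem_trans ord_μ si_omega Hκμ).
  - intros i a _ [H _]; auto.
  - intros i p Hi Hp. apply in_omega in Hi. destruct Hi as [n ->].
    destruct (decides_dense n Hp) as [a [s [Ha [Hap [Hl [Hs He]]]]]].
    exists a. split; [|apply compat_of_le; auto]. split; auto. exists s. rewrite Hl. auto.
  - exists q, ξ. repeat split; auto. intros n r Hr Hrq.
    destruct (H (num n) (num_in_omega n) r Hr Hrq) as [d [[[H1 [s [H2 [H3 H4]]]] H5] H6]].
    exists d. apply num_inj in H2. split; auto. split; auto. split; auto. exists s; auto.
Qed.

Definition sequences (ξ : V) (s : list V) : Prop :=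
  exists a, a ∈ stage ξ /\ a ∈ Q /\ below_μ s /\ decides a s.

(** Everything that the construction can produce along any branch decided in V_ξ. Unlike the hull
    along the generic branch it is available in V, so it can be coded in advance. *)
Definition big_hull (ξ z : V) : Prop := exists s, sequences ξ s /\ hull s z.

(** A condition and a length determine the sequence, by [decides_unique] with both conditions
    equal. *)
Lemma small_sequences (ξ : V) : ξ ∈ μ -> small (fun β => β ∈ μ) (sequences ξ).
Proof.
  intros Hξ. pose proof (index_class_inaccessible Hμ) as HC.
  destruct (@choose_fun_on (V * nat) (list V)
    (fun u => fst u ∈ Q /\ exists s, length s = snd u /\ below_μ s /\ decides (fst u) s)
    (fun u s => length s = snd u /\ below_μ s /\ decides (fst u) s)) as [g Hg].
  { exact (inhabits nil). }
  { intros p [_ H]; exact H. }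
  apply small_image with (M := fun u : V * nat => fst u ∈ stage ξ /\ True) (g := g).
  - apply (@small_prod V _ HC V nat (fun z => z ∈ stage ξ) (fun _ => True)).
    + apply small_stage; auto.
    + apply small_nat; auto.
  - intros s [a [Ha [HaQ [Hs He]]]]. exists (a, length s). split; auto.
    destruct (Hg (a, length s)) as [H1 [H2 H3]]; simpl in *; [eauto|].
    apply (@decides_unique a a); auto. apply compat_of_le; auto. exact (le_refl HaQ).
Qed.

Lemma small_big_hull (ξ : V) : ξ ∈ μ -> small (fun β => β ∈ μ) (big_hull ξ).
Proof.
  intros Hξ. apply small_union; auto using index_class_inaccessible, zfc_inhabited, small_sequences.
  intros s [a [_ [_ [Hs _]]]]. apply small_hull; auto.
Qed.

Lemma sequences_bounded (ξ : V) : ξ ∈ μ ->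
  exists η, η ∈ μ /\ forall α s, sequences ξ (α :: s) -> α ∈ η.
Proof.
  intros Hξ.
  destruct (@small_bounded V μ (fun α => exists s, sequences ξ (α :: s)) Hμ) as [η [Hη H]].
  - apply small_image with (M := sequences ξ) (g := fun s => match s with nil => μ | α :: _ => α end).
    + apply small_sequences; auto.
    + intros α [s Hs]. exists (α :: s). auto.
  - intros α [s [a [_ [_ [Hs _]]]]]. inversion Hs; auto.
  - exists η. split; auto. intros α s Hs. eauto.
Qed.

Lemma big_hull_sub (ξ z : V) : big_hull ξ z -> z ∈ W.
Proof. intros [s [[a [_ [_ [Hs _]]]] Hz]]. exact (hull_sub Hs Hz). Qed.

(* [f : η → big_hull ξ] with section [ρ] transports a generic-like [x ∈ P_κ(V_η)] to
   [y ∈ P_κ(V_{μ+1})], keeping only the hulls along the branch that [x] decides. *)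
Lemma capturing_point X (ξ η q : V) (f ρ : V -> V) :
  ξ ⊆ η -> α0 ⊆ η -> κ ⊆ η -> η ∈ μ -> κ ⊆ α0 ->
  q ∈ Q -> bigcup q ⊆ stage η -> bigcup X = stage α0 ->
  clubF (κ := κ) (stage η) (fun x => hit x q -> hit x X) ->
  (forall n, predense_below (κ := κ) μ
    (fun a => (a ∈ Q /\ exists s, length s = n /\ below_μ s /\ decides a s) /\ a ∈ stage ξ) q) ->
  (forall α s, sequences ξ (α :: s) -> α ∈ η) ->
  (forall z, big_hull ξ z -> ρ z ∈ stage η /\ f (ρ z) = z) ->
  exists y, y ∈ capturing X /\ (exists z, z ∈ y) /\ forall t, over (fun z => z ∈ y) t -> F t ⊆ y.
Proof.
  intros Hξη Hαη Hκη Hη Hκα Hq Hqη HX CX Hpre Hbd Hρ.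
  pose proof (ord_mem ord_μ Hη) as Oη. pose proof (ord_mem ord_μ Hα0) as Oα.
  set (A := stage η).
  assert (IA : exists a, a ∈ A) by (apply stage_inhabited; auto).
  assert (HξA : stage ξ ⊆ A) by (apply stage_mono; auto).
  assert (Htrue : clubF (κ := κ) A (fun _ => True)) by (apply clubF_True; auto).
  assert (C1 : clubF (κ := κ) A (fun x => forall n, hit x q -> exists d,
    ((d ∈ Q /\ exists s, length s = n /\ below_μ s /\ decides d s) /\ d ∈ stage ξ) /\ d ∈ A /\ d ∈ x /\ hit x d)).
  { apply clubF_all; auto. intros n. apply (@capture V κ ν Hκ μ η q); auto using ord_μ.
    intros r Hr Hrq. destruct (Hpre n r Hr Hrq) as [d [H1 H2]]. exists d. split; auto. split; auto.
    apply HξA. tauto. }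
  (* Incompatible conditions are hit together only on a nonstationary set, so the conditions in [x]
     that [x] hits behave like a filter. *)
  assert (C2 : clubF (κ := κ) A (fun x => forall a, a ∈ x -> forall b, b ∈ x ->
    a ∈ Q -> b ∈ Q -> hit x a /\ hit x b -> compat (κ := κ) μ a b)).
  { apply (@clubF_diag1 V κ ν Hκ A (fun a x => forall b, b ∈ x -> a ∈ Q -> b ∈ Q -> hit x a /\ hit x b -> compat μ a b)).
    intros a Ha. apply (@clubF_diag1 V κ ν Hκ A (fun b x => a ∈ Q -> b ∈ Q -> hit x a /\ hit x b -> compat μ a b)).
    intros b Hb. destruct (classic (compat (κ := κ) μ a b)) as [H|N].
    - apply clubF_mono with (1 := Htrue). auto.
    - eapply clubF_mono.
      + apply (@incompat_club V κ ν Hκ μ η a b ord_μ Hη Hκη); auto; apply stage_bigcup; auto.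
      + simpl. tauto. }
  (* [C3] and [C4] translate between elements and codes inside V_η. They make [x] and the set
     decoded from it agree on the part of each decided hull that lies in V_η. *)
  assert (C3 : clubF (κ := κ) A (fun x => forall z, z ∈ x -> big_hull ξ z -> ρ z ∈ x)).
  { eapply clubF_mono.
    - apply (@clubF_closed1 V κ ν Hκ A (fun z => if excluded_middle_informative (big_hull ξ z) then ρ z else z)).
      intros a Ha. destruct (excluded_middle_informative _); auto. apply Hρ; auto.
    - simpl. intros x Hx z Hz HN. specialize (Hx z Hz).
      destruct (excluded_middle_informative _); tauto. }
  assert (C4 : clubF (κ := κ) A (fun x => forall v, v ∈ x -> f v ∈ A -> f v ∈ x)).
  { eapply clubF_mono.
    - apply (@clubF_closed1 V κ ν Hκ A (fun v => if excluded_middle_informative (f v ∈ A) then f v else v)).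
      intros a Ha. destruct (excluded_middle_informative _); auto.
    - simpl. intros x Hx v Hv HN. specialize (Hx v Hv).
      destruct (excluded_middle_informative _); tauto. }
  (* Closure under [F] conjugated by the coding; values outside [big_hull] have no code and are
     ignored. *)
  assert (C5 : clubF (κ := κ) A (fun x => forall t, over (fun z => z ∈ x) t -> over (fun z => z ∈ W) (tmap f t) ->
    forall z, z ∈ F (tmap f t) -> big_hull ξ z -> ρ z ∈ x)).
  { set (Ψ := fun t => ⦃ w | over (fun z => z ∈ W) (tmap f t) /\
      exists z, z ∈ F (tmap f t) /\ big_hull ξ z /\ w = ρ z ⦄).
    assert (HΨ : forall t w, w ∈ Ψ t <-> over (fun z => z ∈ W) (tmap f t) /\
      exists z, z ∈ F (tmap f t) /\ big_hull ξ z /\ w = ρ z).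
    { intros t. apply (@in_setof V A). intros w [_ [z [_ [Hz ->]]]]. apply Hρ; auto. }
    eapply clubF_mono.
    - apply (@clubF_closed V κ ν Hκ A Ψ). intros t _. apply in_Pk_small. split.
      + intros w Hw. apply HΨ in Hw. destruct Hw as [_ [z [_ [Hz ->]]]]. apply Hρ; auto.
      + destruct (classic (over (fun z => z ∈ W) (tmap f t))) as [Ht|N].
        * apply small_image with (M := fun z => z ∈ F (tmap f t)) (g := ρ).
          -- specialize (HF Ht). apply in_Pk_small in HF. tauto.
          -- intros w Hw. apply HΨ in Hw. destruct Hw as [_ [z [Hz [_ ->]]]]. eauto.
        * exists ν, (fun v => v). split; auto. intros w Hw. apply HΨ in Hw. tauto.
    - simpl. intros x Hx t Ht HtW z Hz HN. apply (Hx t Ht). apply HΨ. eauto. }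
  assert (C6 : clubF (κ := κ) A (fun x => forall v, v ∈ x -> forall a, a ∈ x -> hit x a ->
    forall α, α ∈ η -> predense_below (κ := κ) μ (fun d => d ∈ f v /\ d ∈ stage α) a ->
    exists d, d ∈ f v /\ d ∈ stage α /\ d ∈ x /\ hit x d)).
  { apply (@clubF_diag1 V κ ν Hκ A (fun v x => forall a, a ∈ x -> hit x a ->
      forall α, α ∈ η -> predense_below (κ := κ) μ (fun d => d ∈ f v /\ d ∈ stage α) a ->
      exists d, d ∈ f v /\ d ∈ stage α /\ d ∈ x /\ hit x d)). intros v Hv.
    apply (@clubF_diag1 V κ ν Hκ A (fun a x => hit x a ->
      forall α, α ∈ η -> predense_below (κ := κ) μ (fun d => d ∈ f v /\ d ∈ stage α) a ->
      exists d, d ∈ f v /\ d ∈ stage α /\ d ∈ x /\ hit x d)). intros a Ha.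
    (* α ranges over all of η and not only over elements of [x], so it cannot be handled by a
       diagonal intersection. Capturing for the least good α serves all larger ones. *)
    set (S := fun α => α ∈ η /\ predense_below (κ := κ) μ (fun d => d ∈ f v /\ d ∈ stage α) a).
    destruct (classic (exists α, S α)) as [[α1 Sα1]|N].
    2: { apply clubF_mono with (1 := Htrue). intros x _ _ α H1 H2. exfalso. apply N. exists α. split; auto. }
    destruct (@least_ordinal V S α1) as [α [Oα' [_ [[Hα Hpα] Hmin]]]]; auto.
    { exact (ord_mem Oη (proj1 Sα1)). }
    eapply clubF_mono.
    - apply (@capture V κ ν Hκ μ η a (fun d => d ∈ f v /\ d ∈ stage α) ord_μ Hη Hκη).
      + apply stage_bigcup; auto.
      + intros r Hr Hra. destruct (Hpα r Hr Hra) as [d [H1 H2]]. exists d. split; auto. split; auto.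
        exact (stage_mono (ord_trans Oη Hα) (proj2 H1)).
    - simpl. intros x Hx Hh α' Hα' Hp. destruct (Hx Hh) as [d [[H1 H2] [_ [H3 H4]]]].
      exists d. repeat split; auto. apply (stage_mono (α := α)); auto.
      destruct (ord_sub_or_mem Oα' (ord_mem Oη Hα')) as [H|H]; auto.
      exfalso. apply (Hmin α' H). split; auto. }
  assert (Z0 : num 0 ∈ stage α0).
  { apply ord_in_stage; auto. apply Hκα. apply (ord_trans si_ord si_omega), num_in_omega. }
  assert (C7 : clubF (κ := κ) A (fun x => num 0 ∈ x)).
  { apply clubF_in. exact (stage_mono Hαη Z0). }
  destruct (@hit_stationary V κ ν Hκ μ q η _ ord_μ Hq Hqη
    (clubF_and IA CX (clubF_and IA C1 (clubF_and IA C2 (clubF_and IA C3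
      (clubF_and IA C4 (clubF_and IA C5 (clubF_and IA C6 C7))))))))
    as [x [Hx [Hxq [K0 [K1 [K2 [K3 [K4 [K5 [K6 K7]]]]]]]]]].
  clear CX C1 C2 C3 C4 C5 C6 C7. specialize (K0 Hxq).
  (* The conditions in [x] that [x] hits replace the generic filter. They are pairwise compatible,
     so the sequences they decide cohere into one branch, and there is one of every length. *)
  set (branch := fun s => exists a, a ∈ x /\ a ∈ Q /\ a ∈ stage ξ /\ hit x a /\ below_μ s /\ decides a s).
  assert (Br : forall n, exists s, length s = n /\ branch s).
  { intros n. destruct (K1 n Hxq) as [d [[[HdQ [s [Hl [Hs He]]]] Hdξ] [_ [Hdx Hh]]]].
    exists s. split; auto. exists d. repeat split; auto. }
  assert (Brs : forall s, branch s -> sequences ξ s).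
  { intros s [a [_ [HaQ [Haξ [_ [Hs He]]]]]]. exists a. auto. }
  assert (Brm : forall s t, branch s -> branch t -> length s <= length t -> forall z, hull s z -> hull t z).
  { intros s t [a [Hax [HaQ [_ [Hha [Hs Hea]]]]]] [b [Hbx [HbQ [_ [Hhb [Ht Heb]]]]]] Hl z.
    apply (@decides_hull_mono a b); auto. }
  (* The union of the hulls along the branch, cut down to the elements whose code lies in [x]; this
     keeps the size below κ. *)
  set (y := ⦃ z | z ∈ W /\ (ρ z ∈ x /\ exists s, branch s /\ hull s z) ⦄).
  assert (Hy : forall z, z ∈ y <-> ρ z ∈ x /\ exists s, branch s /\ hull s z).
  { intros z. unfold y. rewrite (in_sep W (fun z => ρ z ∈ x /\ exists s, branch s /\ hull s z)).
    split; [tauto|]. intros H. split; auto. destruct H as [_ [s [Hs Hz]]].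
    apply (@big_hull_sub ξ). exists s; auto. }
  assert (Hyx : forall s z, branch s -> hull s z -> z ∈ A -> (z ∈ y <-> z ∈ x)).
  { intros s z Hs Hz HzA. assert (HN : big_hull ξ z) by (exists s; auto). rewrite Hy. split.
    - intros [H _]. destruct (Hρ z HN) as [_ E]. rewrite <- E. apply K4; auto. rewrite E; auto.
    - intros H. split; [apply K3; auto|eauto]. }
  destruct (Br 0) as [s0 [Hl0 B0]]. destruct s0; [|discriminate].
  assert (Hy0 : forall z, z ∈ stage α0 -> (z ∈ y <-> z ∈ x)).
  { intros z Hz. apply (Hyx nil); auto; [apply clo_base; auto|]. exact (stage_mono Hαη Hz). }
  assert (Hcl : forall t, over (fun z => z ∈ y) t -> F t ⊆ y).
  { intros t Ht.
    assert (exists s, branch s /\ over (hull s) t) as [s [Hs Hts]].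
    { induction t as [z|t1 IH1 t2 IH2]; simpl in Ht.
      - apply Hy in Ht. destruct Ht as [_ H]. exact H.
      - destruct IH1 as [s1 [B1 H1]]; [tauto|]. destruct IH2 as [s2 [B2 H2]]; [tauto|].
        destruct (Nat.le_ge_cases (length s1) (length s2)) as [H|H].
        + exists s2. split; auto. split; auto. apply over_impl with (2 := H1). apply Brm; auto.
        + exists s1. split; auto. split; auto. apply over_impl with (2 := H2). apply Brm; auto. }
    assert (HyN : forall z, z ∈ y -> big_hull ξ z).
    { intros z Hz. apply Hy in Hz. destruct Hz as [_ [s' [B' Hz]]]. exists s'; auto. }
    assert (Et : tmap f (tmap ρ t) = t).
    { rewrite tmap_tmap. apply (@tmap_id_on V (fun a => f (ρ a)) (fun z => z ∈ y)); auto.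
      intros z Hz. apply Hρ; auto. }
    intros z Hz. apply Hy. pose proof (hull_closed Hts Hz) as Hzs. split; [|eauto].
    apply (K5 (tmap ρ t)).
    - apply over_tmap. apply over_impl with (2 := Ht). intros w Hw. apply Hy in Hw. tauto.
    - rewrite Et. apply over_impl with (2 := Ht). intros w Hw. apply (@big_hull_sub ξ). auto.
    - rewrite Et; auto.
    - exists s; auto. }
  exists y. split; [|split; auto].
  2: { exists (num 0). apply Hy0; auto. }
  apply (in_sep (Pk κ W) (fun x => hit x X /\ forall D, D ∈ x -> dense (κ := κ) μ D -> exists d, d ∈ D /\ d ∈ x /\ hit x d)).
  split; [|split].
  - apply in_Pk_small. split.
    + intros z Hz. apply in_sep in Hz. tauto.
    + apply small_image with (M := fun z => z ∈ x) (g := f).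
      * apply in_Pk_small in Hx. tauto.
      * intros z Hz. apply Hy in Hz. destruct Hz as [H1 [s [Hs Hz]]]. exists (ρ z). split; auto.
        symmetry. apply Hρ. exists s; auto.
  - unfold hit in *. rewrite HX in *. replace (cap y (stage α0)) with (cap x (stage α0)); auto.
    apply set_ext. intros z. rewrite !in_cap. split; intros [H1 H2]; split; auto; apply (Hy0 z H2); auto.
  - intros D HD Hd. apply Hy in HD. destruct HD as [HρD [s [Hs HDs]]].
    (* One step further along the branch, the new entry α bounds where the dense sets of the hull
       containing [D] are met. *)
    destruct (Br (S (length s))) as [s' [Hl' Bs']].
    destruct s' as [|α s']; [discriminate|]. injection Hl' as Hl'.
    pose proof (Hbd α s' (Brs _ Bs')) as Hα.
    pose proof Bs' as [a [Hax [HaQ [Haξ [Hha [Hbs [Hes' [Hm _]]]]]]]].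
    assert (HDs' : hull s' D).
    { apply (Brm s s'); auto; [|lia]. exists a. repeat split; auto. inversion Hbs; auto. }
    assert (ED : f (ρ D) = D) by (apply Hρ; exists s; auto).
    destruct (K6 (ρ D) HρD a Hax Hha α Hα) as [d [H1 [H2 [H3 H4]]]].
    { rewrite ED. apply Hm; auto. }
    rewrite ED in H1.
    (* V_α is part of the next hull on the branch, so [x] and [y] agree on it. Hence [d] belongs to
       [y], and [y] hits [d] because [x] does. *)
    assert (Hst : forall z, z ∈ stage α -> (z ∈ y <-> z ∈ x)).
    { intros z Hz. apply (Hyx (α :: s')); auto; [apply hull_stage; auto|].
      exact (stage_mono (ord_trans Oη Hα) Hz). }
    exists d. split; auto. split; [apply Hst; auto|].
    unfold hit in *. replace (cap y (bigcup d)) with (cap x (bigcup d)); auto.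
    pose proof (stage_bigcup (ord_mem Oη Hα) H2) as Hdα.
    apply set_ext. intros z. rewrite !in_cap. split; intros [G1 G2]; split; auto; apply (Hst z (Hdα z G2)); auto.
Qed.

Lemma capturing_meets_closed X : X ∈ Q -> bigcup X = stage α0 -> κ ⊆ α0 ->
  exists y, y ∈ capturing X /\ (exists z, z ∈ y) /\ forall t, over (fun z => z ∈ y) t -> F t ⊆ y.
Proof.
  intros HX EX Hκα. destruct (bounded_sequence HX) as [q [ξ [Hq [HqX [Hξ Hpre]]]]].
  destruct (sequences_bounded Hξ) as [η1 [Hη1 Hb1]].
  destruct (small_big_hull Hξ) as [β [f [Hβ Hf]]].
  destruct (@choose_fun_on V V (big_hull ξ) (fun z v => v ∈ β /\ z = f v)) as [ρ Hρ]; auto using zfc_inhabited.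
  apply tower_leP in HqX. destruct HqX as [γ [Hγ [Hqγ [HXγ HC]]]].
  (* η has to include ξ, [α0], all ordinals occurring in decided sequences, the set β of codes, and
     the stage γ witnessing that [q] is below [X]. *)
  destruct (ord_max_in ord_μ Hξ Hα0) as [c1 [Hc1 [G1 G2]]].
  destruct (ord_max_in ord_μ Hη1 Hβ) as [c2 [Hc2 [G3 G4]]].
  destruct (ord_max_in ord_μ Hc1 Hγ) as [c3 [Hc3 [G5 G6]]].
  destruct (ord_max_in ord_μ Hc2 Hc3) as [η [Hη [G7 G8]]].
  apply (@capturing_point X ξ η q f ρ); auto.
  - exact (sub_trans G1 (sub_trans G5 G8)).
  - exact (sub_trans G2 (sub_trans G5 G8)).
  - exact (sub_trans Hκα (sub_trans G2 (sub_trans G5 G8))).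
  - exact (sub_trans Hqγ (stage_mono (sub_trans G6 G8))).
  - exact (clubF_hit_up (sub_trans G6 G8) Hqγ HXγ HC).
  - intros α s Hs. exact (G7 _ (G3 _ (Hb1 α s Hs))).
  - intros z Hz. destruct (Hρ z Hz) as [H1 H2]. split; auto.
    apply ord_in_stage; [exact (ord_mem ord_μ Hη)|]. apply G7, G4; auto.
Qed.

End Capturing.

Lemma capturing_stationary {V : zfc} {κ ν : V} {Hκ : successor_index κ ν} (μ X : V) :
  inaccessible μ -> κ ∈ μ -> presaturated κ μ -> X ∈ tower κ μ ->
  stationary κ (stage (succ μ)) (capturing (κ := κ) (μ := μ) X).
Proof.
  intros Hμ Hκμ Hps HX. apply stationaryP. split.
  - intros x Hx. apply in_sep in Hx. tauto.
  - intros C [D [HD HDC]]. destruct (club_operation HD) as [F [HF1 HF2]].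
    destruct (tower_bigcup HX) as [α0 [Hα0 [Hκα [_ E]]]].
    destruct (capturing_meets_closed Hμ Hκμ Hps HF1 Hα0 HX E Hκα) as [y [H1 [H2 H3]]].
    exists y. split; auto. apply HDC, HF2; auto. apply in_sep in H1. tauto.
Qed.

(** * Factoring *)

Section Factor.
Context {V : zfc} {κ ν : V} {Hκ : successor_index κ ν} {μ λ : V}.
Context (Hμ : inaccessible μ) (Hλ : inaccessible λ) (Hκμ : κ ∈ μ) (Hμλ : μ ∈ λ).
Context (Hps : presaturated κ μ) {X : V} (HX : X ∈ tower κ μ).
Implicit Types D Z d e p q r s x : V.

Local Notation Qμ := (tower κ μ).
Local Notation Qλ := (tower κ λ).
Local Notation leμ := (tower_le κ μ).
Local Notation leλ := (tower_le κ λ).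
Local Notation W := (stage (succ μ)).
Local Notation Y := (capturing (κ := κ) (μ := μ) X).
Local Notation "p ⊩ f" := (forces Qλ leλ p f) (at level 70).
Local Notation dns := (densely Qλ leλ).

Let limμ : limit μ := inaccessible_limit Hμ.
Let limλ : limit λ := inaccessible_limit Hλ.
Let ordμ : ordinal μ := limit_ord limμ.
Let ordλ : ordinal λ := limit_ord limλ.
Let statY : stationary κ W Y := capturing_stationary Hμ Hκμ Hps HX.

#[local] Instance Qλ_preorder : preorder_on Qλ leλ := tower_preorder limλ.
#[local] Instance Qμ_preorder : preorder_on Qμ leμ := tower_preorder limμ.

Lemma in_capturing x : x ∈ Y <-> x ∈ Pk κ W /\ (hit x X /\
  forall D, D ∈ x -> dense (κ := κ) μ D -> exists d, d ∈ D /\ d ∈ x /\ hit x d).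
Proof. apply (in_sep (Pk κ W) (fun x => hit x X /\
  forall D, D ∈ x -> dense (κ := κ) μ D -> exists d, d ∈ D /\ d ∈ x /\ hit x d)). Qed.

Lemma tower_sub d : d ∈ Qμ -> d ∈ Qλ.
Proof.
  intros H. apply in_tower in H. destruct H as [α [H1 H2]]. apply in_tower.
  exists α. split; auto. exact (ord_mem_trans ordλ H1 Hμλ).
Qed.

Lemma tower_le_sub d e : leμ d e -> leλ d e.
Proof. intros [γ [H1 H2]]. exists γ. split; auto. exact (ord_mem_trans ordλ H1 Hμλ). Qed.

Lemma tower_sub_stage : Qμ ⊆ stage μ.
Proof.
  intros d Hd. destruct (tower_rank limμ Hd) as [ξ [Hξ H]].
  exact (stage_mono (ord_trans ordμ Hξ) H).
Qed.

Lemma κ_sub_succμ : κ ⊆ succ μ.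
Proof. exact (sub_trans (ord_trans ordμ Hκμ) (sub_succ (a := μ))). Qed.

Lemma tower_bigcup_W d : d ∈ Qμ -> bigcup d ⊆ W.
Proof.
  intros Hd. apply stage_bigcup; [apply ord_succ; auto|].
  exact (stage_mono (sub_succ (a := μ)) (tower_sub_stage Hd)).
Qed.

Lemma capturing_in_tower : Y ∈ Qλ.
Proof. exact (in_tower_at (limit_succ limλ Hμλ) κ_sub_succμ statY). Qed.

Lemma capturing_le : leλ Y X.
Proof.
  apply tower_le_at with (succ μ); auto using limit_succ, κ_sub_succμ, tower_bigcup_W.
  intros x Hx. apply in_capturing in Hx. tauto.
Qed.

(** Club many points contain [D] as an element, and those that hit [Y] then choose some [d] in [D]
    regressively. Pressing down fixes [d] on a stationary subset of the points hitting [Z]. *)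
Lemma meet_dense Z D : Z ∈ Qλ -> leλ Z Y -> dense (κ := κ) μ D ->
  exists S d, S ∈ Qλ /\ leλ S Z /\ d ∈ D /\ leλ S d.
Proof.
  intros HZ HZY HD. apply tower_leP in HZY. destruct HZY as [γ1 [Hγ1 [HZ1 [HY1 HC]]]].
  destruct (ord_max_in ordλ Hγ1 (limit_succ limλ Hμλ)) as [γ [Hγ [G1 G2]]].
  pose proof (sub_trans κ_sub_succμ G2) as Hκγ.
  pose proof (sub_trans HZ1 (stage_mono G1)) as HZγ.
  pose proof (stage_mono G2) as HWγ.
  assert (DW : D ∈ W) by (apply stage_succ; exact (sub_trans (proj1 HD) tower_sub_stage)).
  assert (IA : exists a, a ∈ stage γ) by (exists D; auto).
  set (T := ⦃ x | x ∈ Pk κ (stage γ) /\ (hit x Z /\ hit x Y /\ D ∈ x) ⦄).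
  assert (HT : forall x, x ∈ T <-> x ∈ Pk κ (stage γ) /\ (hit x Z /\ hit x Y /\ D ∈ x))
    by (intros x; apply (in_sep (Pk κ (stage γ)) (fun x => hit x Z /\ hit x Y /\ D ∈ x))).
  assert (ST : stationary κ (stage γ) T).
  { apply stationaryP. split; [intros x Hx; apply HT in Hx; tauto|]. intros C HCl.
    destruct (@hit_stationary V κ ν Hκ λ Z γ _ ordλ HZ HZγ
      (clubF_and IA HCl (clubF_and IA (clubF_hit_up G1 HZ1 HY1 HC) (clubF_in (HWγ _ DW)))))
      as [x [Hx [HxZ [Hx1 [Hx2 Hx3]]]]].
    exists x. split; auto. apply HT. auto. }
  destruct (@fodor V κ ν Hκ (stage γ) T (fun d x => d ∈ D /\ hit x d) ST) as [d [Hd SS]].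
  { intros x Hx. apply HT in Hx. destruct Hx as [HxP [HxZ [HxY HDx]]].
    unfold hit in HxY. rewrite (stationary_bigcup statY) in HxY.
    apply in_capturing in HxY. destruct HxY as [_ [_ H]].
    destruct (H D) as [d [H1 [H2 H3]]]; auto; [apply in_cap; auto|].
    apply in_cap in H2. exists d. split; [tauto|]. split; auto.
    apply hit_cap in H3; auto. apply tower_bigcup_W. apply HD; auto. }
  set (S := ⦃ x | x ∈ T /\ d ∈ x /\ d ∈ D /\ hit x d ⦄) in *.
  assert (HS : forall x, x ∈ S -> x ∈ T /\ d ∈ D /\ hit x d).
  { intros x Hx. apply (in_sep T (fun x => d ∈ x /\ d ∈ D /\ hit x d)) in Hx. tauto. }
  assert (HdD : d ∈ D).
  { apply stationaryP in SS. destruct SS as [_ H]. destruct (H _ (clubF_True IA)) as [x [Hx _]].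
    apply HS in Hx. tauto. }
  exists S, d. split; [exact (in_tower_at Hγ Hκγ SS)|]. split; [|split; auto].
  - apply tower_le_at with γ; auto. intros x Hx. destruct (HS x Hx) as [H _]. apply HT in H. tauto.
  - apply tower_le_at with γ; auto.
    + exact (sub_trans (tower_bigcup_W (proj1 HD d HdD)) HWγ).
    + intros x Hx. apply HS; auto.
Qed.

(** * The generic filter of the large tower restricted to the small one *)

Lemma in_tower_order d e : pair d e ∈ tower_order κ μ <-> d ∈ Qμ /\ e ∈ Qμ /\ leμ d e.
Proof.
  transitivity (exists X Y, X ∈ Qμ /\ Y ∈ Qμ /\ leμ X Y /\ sat (IsPair X Y (pair d e))).
  - apply (@in_setof V (prod_set Qμ Qμ)). intros c [A [B [H1 [H2 [_ H3]]]]].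
    apply sat_IsPair in H3. apply in_prod_set. eauto.
  - split.
    + intros [A [B [H1 [H2 [H3 H4]]]]]. apply sat_IsPair, pair_inj in H4. destruct H4; subst; auto.
    + intros [H1 [H2 H3]]. exists d, e. repeat split; auto. apply sat_IsPair; auto.
Qed.

(** The canonical name for the small tower, read as a name for forcing with the large one; it is the
    witness for the intersection of the generic filter with [Qμ]. *)
Definition restricted_generic : name V :=
  Name Qμ (fun i => check (proj1_sig i)) (fun i p => p = proj1_sig i).

Local Notation H := restricted_generic.

(** Stated for any [P] included in [Qλ], so that it covers both [generic_name Qλ] and [H]. *)
Lemma mem_generic (P : V) (HP : P ⊆ Qλ) τ p : p ∈ Qλ ->
  (forces_mem Qλ leλ τ (Name P (fun i => check (proj1_sig i)) (fun i p => p = proj1_sig i)) p <->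
   dns p (fun r => exists d, d ∈ P /\ leλ r d /\ forces_eq Qλ leλ τ (check d) r)).
Proof.
  intros Hp. simpl. split; intros HH; apply densely_impl with (2 := HH); auto.
  - intros r Hr _ [[d Hd] [b [Hb [-> [Hrb E]]]]]. simpl in *. eauto.
  - intros r Hr _ [d [Hd [Hrd E]]]. exists (exist (fun i => i ∈ P) d Hd), d. simpl. auto.
Qed.

Lemma mem_H τ p : p ∈ Qλ -> (forces_mem Qλ leλ τ H p <->
   dns p (fun r => exists d, d ∈ Qμ /\ leλ r d /\ forces_eq Qλ leλ τ (check d) r)).
Proof. apply mem_generic. exact tower_sub. Qed.

Lemma check_in_H d p : d ∈ Qμ -> p ∈ Qλ -> leλ p d -> forces_mem Qλ leλ (check d) H p.
Proof.
  intros Hd Hp Hpd. apply mem_H; auto. apply densely_here; auto. intros r Hr Hrp.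
  exists d. split; auto. split; [exact (le_trans Hr Hp (tower_sub Hd) Hrp Hpd)|]. apply eq_refl_name; auto.
Qed.

Lemma forces_all_H φ p : p ∈ Qλ -> extensional (P := Qλ) (le := leλ) φ ->
  (forall d r, d ∈ Qμ -> r ∈ Qλ -> leλ r p -> leλ r d -> r ⊩ φ (check d)) ->
  p ⊩ All (fun z => Imp (Mem z H) (φ z)).
Proof.
  intros Hp Hφ Hall z q Hq Hqp Hz. apply (mem_H z Hq) in Hz. apply forces_dense; auto.
  apply densely_impl with (2 := Hz); auto. intros r Hr Hrq [d [Hd [Hrd E]]].
  apply (Hφ r (check d) z); auto; [apply eq_sym_name; auto|].
  apply Hall; auto. exact (le_trans Hr Hq Hp Hrq Hqp).
Qed.

Lemma forces_IsCap p : p ∈ Qλ -> p ⊩ IsCap (generic_name Qλ) (check Qμ) H.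
Proof.
  intros Hp z. apply forces_Iff; auto. intros q Hq Hqp.
  change (forces_mem Qλ leλ z H q <->
    forces_mem Qλ leλ z (generic_name Qλ) q /\ forces_mem Qλ leλ z (check Qμ) q).
  rewrite mem_H by auto.
  unfold generic_name. rewrite (mem_generic (sub_refl (a := Qλ))), mem_check by auto. split.
  - intros HH. split; apply densely_impl with (2 := HH); auto.
    + intros r Hr _ [d [Hd [Hrd E]]]. exists d. split; auto. apply tower_sub; auto.
    + intros r Hr _ [d [Hd [Hrd E]]]. eauto.
  - intros [H1 H2]. apply densely_idem; auto. apply densely_impl with (2 := H2); auto.
    intros r Hr Hrq [e [He E]].
    assert (H1' : dns r (fun r => exists d, d ∈ Qλ /\ leλ r d /\ forces_eq Qλ leλ z (check d) r)).
    { apply densely_mono with q; auto. }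
    apply densely_impl with (2 := H1'); auto. intros t Ht Htr [d [Hd [Htd E']]].
    assert (Ede : forces_eq Qλ leλ (check d) (check e) t).
    { apply eq_trans_name with z; auto; [apply eq_sym_name; auto|exact (eq_mono Hr Ht Htr E)]. }
    apply eq_check in Ede; auto. subst d. exists e. auto.
Qed.

Lemma forces_tower_order d e p : p ∈ Qλ ->
  (p ⊩ PairIn (check d) (check e) (check (tower_order κ μ)) <-> d ∈ Qμ /\ e ∈ Qμ /\ leμ d e).
Proof. intros Hp. rewrite forces_PairIn, check_mem, in_tower_order by auto. reflexivity. Qed.

(** Needed for directedness of [H]: two members have a common lower bound in [Qλ], but one in [Qμ]
    is required. Meeting this dense set provides it, once incompatibility is excluded. *)
Lemma dense_common_lower_or_incompat d e : d ∈ Qμ -> e ∈ Qμ ->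
  dense (κ := κ) μ ⦃ c | c ∈ Qμ /\ ((leμ c d /\ leμ c e) \/ ~ compat (κ := κ) μ c d \/ ~ compat (κ := κ) μ c e) ⦄.
Proof.
  intros Hd He. split; [intros c Hc; apply in_sep in Hc; tauto|].
  intros p Hp. setoid_rewrite in_sep.
  destruct (classic (compat (κ := κ) μ p d)) as [[p1 [Hp1 [H1 H2]]]|N].
  - destruct (classic (compat (κ := κ) μ p1 e)) as [[p2 [Hp2 [H3 H4]]]|N].
    + exists p2. split; [split; auto; left; split; auto|].
      * exact (le_trans Hp2 Hp1 Hd H3 H2).
      * exact (le_trans Hp2 Hp1 Hp H3 H1).
    + exists p1. auto.
  - exists p. split; auto. exact (le_refl Hp).
Qed.

Lemma forces_IsFilter p : p ∈ Qλ -> leλ p Y -> p ⊩ IsFilter (check Qμ) (check (tower_order κ μ)) H.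
Proof.
  intros Hp HpY. split; [|split; [|split]].
  - apply forces_all_H; [auto|solve_extensional|]. intros d r Hd Hr _ _. apply check_mem; auto.
  - apply densely_here; auto. intros r Hr Hrp. exists (check X). apply check_in_H; auto.
    exact (le_trans Hr capturing_in_tower (tower_sub HX) (le_trans Hr Hp capturing_in_tower Hrp HpY) capturing_le).
  - apply forces_all_H; [auto|solve_extensional|]. intros d r Hd Hr Hrp Hrd.
    apply forces_all_check; [auto|solve_extensional|]. intros e He q Hq Hqr Hde.
    apply forces_tower_order in Hde; auto. apply check_in_H; auto.
    apply (le_trans Hq (tower_sub Hd) (tower_sub He)).
    + exact (le_trans Hq Hr (tower_sub Hd) Hqr Hrd).
    + apply tower_le_sub. tauto.
  - apply forces_all_H; [auto|solve_extensional|]. intros d r Hd Hr Hrp Hrd.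
    apply forces_all_H; [auto|solve_extensional|]. intros e r' He Hr' Hrr' Hre.
    intros q Hq Hqr'.
    pose proof (le_trans Hq Hr' Hr Hqr' Hrr') as Hqr.
    assert (HqY : leλ q Y) by exact (le_trans Hq Hp capturing_in_tower (le_trans Hq Hr Hp Hqr Hrp) HpY).
    destruct (meet_dense Hq HqY (dense_common_lower_or_incompat Hd He)) as [S [c [HS [HSq [Hc HSc]]]]].
    apply in_sep in Hc. destruct Hc as [HcQ Hc].
    assert (HSd : leλ S d)
      by exact (le_trans HS Hq (tower_sub Hd) HSq (le_trans Hq Hr (tower_sub Hd) Hqr Hrd)).
    assert (HSe : leλ S e)
      by exact (le_trans HS Hq (tower_sub He) HSq (le_trans Hq Hr' (tower_sub He) Hqr' Hre)).
    assert (Hμλs : μ ⊆ λ) by exact (ord_trans ordλ Hμλ).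
    destruct Hc as [[Hcd Hce]|[N|N]].
    + exists S. split; auto. split; auto. exists (check c). split; [apply check_in_H; auto|].
      split; apply forces_tower_order; auto.
    (* [S] lies below [c] and below [d] in the large tower, and compatibility passes down to the
       small one. *)
    + exfalso. apply N. apply (@compat_absolute V κ ν Hκ μ λ); auto. exists S; auto.
    + exfalso. apply N. apply (@compat_absolute V κ ν Hκ μ λ); auto. exists S; auto.
Qed.

Lemma forces_IsGeneric : Y ⊩ IsGenericOverV (check Qμ) (check (tower_order κ μ)) H.
Proof.
  pose proof capturing_in_tower as HY. split; [apply forces_IsFilter; auto; exact (le_refl HY)|].
  intros E q Hq HqY HG r Hr Hrq HD. apply forces_dense; auto.
  (* Densely often [E] equals a check name. Density of the named set [D] then holds in V itself,
     because all quantifiers in [IsDense] are bounded by check names. *)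
  assert (HG' : dns r (fun t => exists D, forces_eq Qλ leλ E (check D) t)).
  { apply densely_mono with q; auto. }
  apply densely_impl with (2 := HG'); auto. intros t Ht Htr [D HE].
  assert (HD' : t ⊩ IsDense (check Qμ) (check (tower_order κ μ)) (check D)).
  { assert (Ext : extensional (P := Qλ) (le := leλ)
      (IsDense (check Qμ) (check (tower_order κ μ)))) by (unfold IsDense; solve_extensional).
    apply (Ext t E); auto. exact (forces_mono Hr Ht Htr HD). }
  assert (Dn : dense (κ := κ) μ D).
  { destruct HD' as [D1 D2]. split.
    - intros d Hd.
      assert (HH : t ⊩ Mem (check d) (check Qμ)).
      { apply (proj1 (forces_all_check D (φ := fun z => Mem z (check Qμ)) Ht
          ltac:(solve_extensional)) D1 d Hd). }
      apply check_mem in HH; auto.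
    - intros p Hp.
      pose proof (proj1 (forces_all_check Qμ
        (φ := fun z => Ex (fun w => And (Mem w (check D)) (PairIn w z (check (tower_order κ μ))))) Ht
        ltac:(solve_extensional)) D2 p Hp) as D3.
      apply forces_ex_check in D3; [|auto|solve_extensional].
      destruct (D3 t Ht (le_refl Ht)) as [u [Hu [_ [d [Hd Hdp]]]]].
      apply forces_tower_order in Hdp; auto. exists d. tauto. }
  intros u Hu Hut.
  pose proof (le_trans Hu Ht Hr Hut Htr) as Hur.
  assert (HuY : leλ u Y) by exact (le_trans Hu Hq HY (le_trans Hu Hr Hq Hur Hrq) HqY).
  destruct (meet_dense Hu HuY Dn) as [S [d [HS [HSu [Hd HSd]]]]].
  exists S. split; auto. split; auto. exists (check d). split.
  - apply check_in_H; auto. apply Dn; auto.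
  - apply mem_eq_r with (check D); auto.
    + apply eq_sym_name. exact (eq_mono Ht HS (le_trans HS Hu Ht HSu Hut) HE).
    + apply check_mem; auto.
Qed.

End Factor.

Theorem theorem3p23 (V : zfc) (κ μ λ : V)
  (hκ : successor_cardinal κ) (hμ : inaccessible μ) (hλ : inaccessible λ)
  (hκμ : κ ∈ μ) (hμλ : μ ∈ λ) (hpresat : presaturated κ μ) :
  factors_at κ λ μ.
Proof.
  destruct (successor_cardinal_spec hκ) as [ν [H1 [H2 [H3 H4]]]].
  assert (Hκ : successor_index κ ν) by (split; auto).
  intros X HX. exists (capturing (κ := κ) (μ := μ) X).
  pose proof (capturing_in_tower hμ hλ hκμ hμλ hpresat HX) as HY.
  pose proof (tower_preorder (inaccessible_limit hλ)) as PO.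
  split; [exact HY|]. split; [exact (capturing_le hμ hλ hκμ hμλ hpresat HX)|].
  apply (@densely_here V (tower κ λ) (tower_le κ λ) PO); auto. intros r Hr HrY.
  exists (restricted_generic (κ := κ) (μ := μ)). split.
  - exact (forces_IsCap hλ hμλ Hr).
  - exact (forces_mono HY Hr HrY (forces_IsGeneric hμ hλ hκμ hμλ hpresat HX)).
Qed.
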